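(* Let $(\Omega_1,\mathcal M_1,\mu_1)$ and $(\Omega_2,\mathcal M_2,\mu_2)$ be two finite measure spaces, and let $\mathcal M$ be a sub-$\sigma$-field of the $\sigma$-field generated by $\mathcal M_1\times\mathcal M_2$. Let $X$ and $Y$ be respectively a separable and a reflexive Banach space. Let $1\le p_1,p_2<\infty$ and $1<q_1,q_2<\infty$, and let $L^{p_1}_{\mathcal M}(\Omega_1;L^{p_2}(\Omega_2;\mathbb C))$ be separable. Assume that $\{\mathcal G_n\}_{n=1}^\infty$ is a sequence of uniformly bounded, pointwisely defined linear operators from $L^{p_1}_{\mathcal M}(\Omega_1;L^{p_2}(\Omega_2;X))$ to $L^{q_1}_{\mathcal M}(\Omega_1;L^{q_2}(\Omega_2;Y))$. Then there exist a subsequence $\{\mathcal G_{n_k}\}_{k=1}^\infty\subset\{\mathcal G_n\}_{n=1}^\infty$ and a $\mathcal G\in\mathcal L_{pd}\big(L^{p_1}_{\mathcal M}(\Omega_1;L^{p_2}(\Omega_2;X)),L^{q_1}_{\mathcal M}(\Omega_1;L^{q_2}(\Omega_2;Y))\big)$ such that, for all $u(\cdot)\in L^{p_1}_{\mathcal M}(\Omega_1;L^{p_2}(\Omega_2;X))$, $$\mathcal G_{n_k}u(\cdot)\to\mathcal Gu(\cdot)\ \text{ weakly in }L^{q_1}_{\mathcal M}(\Omega_1;L^{q_2}(\Omega_2;Y))\text{ as }k\to\infty.$$ Moreover, $\|\mathcal G\|\le\sup_{n\in\mathbb N}\|\mathcal G_n\|$, all norms being taken in $\mathcal L\big(L^{p_1}_{\mathcal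 M}(\Omega_1;L^{p_2}(\Omega_2;X)),L^{q_1}_{\mathcal M}(\Omega_1;L^{q_2}(\Omega_2;Y))\big)$.
   Context: For $1\le p,q<\infty$ and a Banach space $X$, $L^p_{\mathcal M}(\Omega_1;L^q(\Omega_2;X))$ is the Banach space (with the canonical norm) of $\mathcal M$-measurable functions $\varphi:\Omega_1\times\Omega_2\to X$ with $\int_{\Omega_1}\big(\int_{\Omega_2}|\varphi(\omega_1,\omega_2)|_X^q\,d\mu_2(\omega_2)\big)^{p/q}d\mu_1(\omega_1)<\infty$. $\mathcal L(X,Y)$ is the space of bounded linear operators from $X$ to $Y$. A bounded linear operator $\mathcal T$ from $L^{p_1}_{\mathcal M}(\Omega_1;L^{p_2}(\Omega_2;X))$ to $L^{q_1}_{\mathcal M}(\Omega_1;L^{q_2}(\Omega_2;Y))$ is called pointwisely defined if for a.e. $(\omega_1,\omega_2)\in\Omega_1\times\Omega_2$ there exists $L(\omega_1,\omega_2)\in\mathcal L(X,Y)$ with $(\mathcal Tu)(\omega_1,\omega_2)=L(\omega_1,\omega_2)u(\omega_1,\omega_2)$ for all $u$ in the domain; the vector space of such operators is denoted $\mathcal L_{pd}\big(L^{p_1}_{\mathcal M}(\Omega_1;L^{p_2}(\Omega_2;X)),L^{q_1}_{\mathcal M}(\Omega_1;L^{q_2}(\Omega_2;Y))\big)$. *)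

(* Defs.v *)
From HB Require Import structures.
From mathcomp Require Import all_boot all_order all_algebra.
From mathcomp Require Import complex.
From mathcomp Require Import all_classical all_reals all_analysis.

Set Implicit Arguments.
Unset Strict Implicit.
Unset Printing Implicit Defensive.

Import Order.TTheory GRing.Theory Num.Theory.
Import numFieldNormedType.Exports.

Local Open Scope classical_set_scope.
Local Open Scope ring_scope.

(* Banach spaces are taken over either the reals or the complex numbers. *)
Inductive scalar_kind := RealScalars | ComplexScalars.

Definition scalar_field (R : realType) (k : scalar_kind) : numFieldType :=
  match k with
  | RealScalars => R
  | ComplexScalars => R[i]
  end.

(* In a normed module over K the norm takes its values in K; it is brought back
   to R when K = R[i] by taking the real part (such a norm is a nonnegative
   element of R[i], hence has a zero imaginary part). *)
Definition scalar_re (R : realType) (k : scalar_kind) :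
    scalar_field R k -> R :=
  match k return scalar_field R k -> R with
  | RealScalars => fun x => x
  | ComplexScalars => fun x => complex.Re x
  end.

Definition rnorm (R : realType) (k : scalar_kind)
    (V : normedModType (scalar_field R k)) (v : V) : R :=
  scalar_re `|v|.

Definition separable_space (T : topologicalType) : Prop :=
  exists2 D : set T, countable D & dense D.

Section reflexivity.
Context (R : realType) (k : scalar_kind) (Y : normedModType (scalar_field R k)).
Local Notation K := (scalar_field R k).

Definition continuous_dual : set (Y -> K^o) :=
  [set f | linear f /\ continuous f].

Definition dual_norm (f : Y -> K^o) : R :=
  sup [set rnorm (f y) | y in [set y : Y | rnorm y <= 1]].

(* The canonical embedding of Y into its bidual is onto.  An element of the
   bidual is given by a function on all maps Y -> K, of which only the values
   on the dual matter. *)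
Definition reflexive_space : Prop :=
  forall Phi : (Y -> K^o) -> K^o,
    (forall (a : K) (f g : Y -> K^o), continuous_dual f -> continuous_dual g ->
       Phi (fun y => a *: f y + g y) = a *: Phi f + Phi g) ->
    (exists C : R, forall f, continuous_dual f ->
       rnorm (Phi f) <= C * dual_norm f) ->
    exists y : Y, forall f, continuous_dual f -> Phi f = f y.

End reflexivity.

Section strong_measurability.
Context (T : Type) (R : realType) (k : scalar_kind)
  (V : normedModType (scalar_field R k)) (M : set (set T)).

Definition Msimple (f : T -> V) : Prop :=
  finite_set (range f) /\ forall v, M (f @^-1` [set v]).

(* Measurability in the sense of Bochner integration; when V is separable it is
   the same as measurability for the Borel sets of V. *)
Definition strongly_measurable (f : T -> V) : Prop :=
  exists2 f_ : nat -> T -> V,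
    (forall n, Msimple (f_ n)) & forall t, f_ n t @[n --> \oo] --> f t.

End strong_measurability.

Section mixed_spaces.
Context d1 d2 (T1 : measurableType d1) (T2 : measurableType d2) (R : realType).
Context (mu1 : {finite_measure set T1 -> \bar R})
        (mu2 : {finite_measure set T2 -> \bar R}).
Context (M : set (set (T1 * T2))).

Definition mixed_norm (k : scalar_kind) (V : normedModType (scalar_field R k))
    (p1 p2 : R) (f : T1 * T2 -> V) : \bar R :=
  Lnorm mu1 p1%:E (fun w1 =>
    Lnorm mu2 p2%:E (fun w2 => (rnorm (f (w1, w2)))%:E)).

(* The Bochner space of the exponents p1 (outer) and p2 (inner), by means of
   representatives: its elements are the functions below up to equality almost
   everywhere for mu1 \x mu2, that is, up to a function of zero mixed norm. *)
Definition Lmix (k : scalar_kind) (V : normedModType (scalar_field R k))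
    (p1 p2 : R) : set (T1 * T2 -> V) :=
  [set f | strongly_measurable M f /\ (mixed_norm p1 p2 f < +oo)%E].

Definition separable_Lmix (k : scalar_kind)
    (V : normedModType (scalar_field R k)) (p1 p2 : R) : Prop :=
  exists D : set (T1 * T2 -> V),
    [/\ countable D, D `<=` Lmix p1 p2 &
        forall f, Lmix p1 p2 f -> forall e : R, 0 < e ->
          exists2 g, D g &
            (mixed_norm p1 p2 (fun w => (f w - g w)%R) < e%:E)%E].

Section functionals.
Context (k : scalar_kind) (Y : normedModType (scalar_field R k)) (q1 q2 : R).
Local Notation K := (scalar_field R k).

(* The values of l outside Lmix q1 q2 are irrelevant.  Boundedness makes l
   compatible with equality almost everywhere. *)
Definition Lmix_functional (l : (T1 * T2 -> Y) -> K^o) : Prop :=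
  (forall (a : K) (f g : T1 * T2 -> Y), Lmix q1 q2 f -> Lmix q1 q2 g ->
     l (fun w => a *: f w + g w) = a *: l f + l g) /\
  (exists C : R, forall f, Lmix q1 q2 f ->
     ((rnorm (l f))%:E <= C%:E * mixed_norm q1 q2 f)%E).

Definition Lmix_weak_cvg (f_ : nat -> T1 * T2 -> Y) (f : T1 * T2 -> Y) : Prop :=
  forall l, Lmix_functional l -> l (f_ n) @[n --> \oo] --> l f.

End functionals.

Section operators.
Context (k : scalar_kind) (X Y : normedModType (scalar_field R k)).
Context (p1 p2 q1 q2 : R).
Local Notation K := (scalar_field R k).
Implicit Type A : (T1 * T2 -> X) -> (T1 * T2 -> Y).

(* A u is a representative of the image of the class of u.  Linearity therefore
   holds almost everywhere, and boundedness makes A compatible with equality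
   almost everywhere. *)
Definition Lmix_bounded_linear A : Prop :=
  [/\ forall u, Lmix p1 p2 u -> Lmix q1 q2 (A u),
      forall (a : K) (u v : T1 * T2 -> X), Lmix p1 p2 u -> Lmix p1 p2 v ->
        {ae (mu1 \x mu2)%E, forall w,
          A (fun w' => a *: u w' + v w') w = a *: A u w + A v w} &
      exists C : R, forall u, Lmix p1 p2 u ->
        (mixed_norm q1 q2 (A u) <= C%:E * mixed_norm p1 p2 u)%E].

Definition Lmix_opnorm A : \bar R :=
  ereal_sup [set mixed_norm q1 q2 (A u) |
              u in [set u | Lmix p1 p2 u /\ (mixed_norm p1 p2 u <= 1)%E]].

(* The family L does not depend on u; as A u is defined only up to a null set,
   so is the set of the points where the identity holds for a given u. *)
Definition pointwisely_defined A : Prop :=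
  exists2 L : T1 * T2 -> {linear X -> Y},
    forall w, continuous (L w) &
    forall u, Lmix p1 p2 u ->
      {ae (mu1 \x mu2)%E, forall w, A u w = L w (u w)}.

Definition Lpd A : Prop := Lmix_bounded_linear A /\ pointwisely_defined A.

End operators.

End mixed_spaces.

(* Main.v *)
Require Import Defs.
From HB Require Import structures.
From mathcomp Require Import all_boot all_order all_algebra.
From mathcomp Require Import complex.
From mathcomp Require Import all_classical all_reals all_analysis.
From mathcomp Require Import measurable_realfun.
From mathcomp Require Import ring lra.
Set Implicit Arguments.
Unset Strict Implicit.
Unset Printing Implicit Defensive.
Import Order.TTheory GRing.Theory Num.Theory.
Import numFieldNormedType.Exports.
Local Open Scope classical_set_scope.
Local Open Scope ring_scope.

(** Weak limits of operators preserve linearity and bounds for free; the point of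
    the theorem is that they also preserve the pointwise form.  The reason is
    that, for a bounded operator, being given pointwise amounts to commuting with
    the multiplication by indicator functions, a condition that is tested by
    continuous functionals.  So the proof has two parts: the weak sequential
    compactness of bounded sets of the target space, which yields a limit
    operator, and the passage from this commutation property, called locality
    below, to a pointwise form.

    The analysis takes place over the reals, on [T1 * T2] with the sigma-algebra
    [M] and the restriction of the product measure.  A complex space is replaced
    by its underlying real space ([realified]) and complex linearity by the
    commutation with [unit_scalar], which acts as an isometry.  The mixed norm
    enters through two properties only: it is a [function_norm], and when both
    exponents exceed 1 it is [disjointly_smooth], which means that two disjointly
    supported functions of norm at most 1 have a sum of norm at most some
    [kappa < 2].

    Weak compactness.  By smoothness a bounded functional [l] is uniformly small
    on the functions of the unit ball that are supported in a small set
    ([functional_small_sets]).  Hence the set functions that map [A] to the value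
    of [l] at the indicator of [A] times [x] have densities, by the
    Radon-Nikodym theorem, and for [x] in a separable closed subspace these
    densities assemble into a function with values in the dual of this subspace
    ([functional_kernel]).  Reflexivity makes this dual separable
    ([reflexive_separable_dual]), so that the weak convergence of a bounded
    sequence can be tested on the integrals over sets of countably many
    functionals ([setwise_weak_cvg]).  The separability of the scalar function
    space lets countably many sets suffice ([measure_algebra_separable]), and a
    diagonal extraction makes all these integrals converge.  Their limits form a
    measure with values in the bidual of [Y]; its density takes values in [Y] by
    reflexivity ([setwise_limit_density]) and is the weak limit
    ([weak_sequential_compactness]).

    Operators.  Since [X] and the scalar function space are separable, so is the
    space of arguments ([fspace_separable]); a second diagonal extraction and
    the uniform bound give a limit operator, which is local and obeys the bound
    on the norm because norms are weakly lower semicontinuous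
    ([local_operator_compactness], [fnorm_weak_le]).  On a function with finitely
    many values a local operator is determined by its images [S x] of the
    constant functions [x].  The measurable selections from the norms of
    countably many images [S x], with [x] in the unit ball, have bounded
    integrals; so for almost every [t] the norm of [S x t] is at most a multiple
    of the norm of [x] along a countable dense set, and [S x t] extends to a
    bounded linear operator [L t] in [x]
    ([ae_bounded_of_selectors], [pointwise_kernel]); the density of the functions
    with finitely many values shows that [L] represents the operator
    ([local_operator_pointwise]).  Finally the limit commutes with
    [unit_scalar], hence so does almost every [L t]
    ([intertwining_limit], [pointwise_intertwining]), which restores linearity
    over the original scalars. *)

(** * Domination of a cone by a linear functional *)

Section hahn_banach.
Context (R : realType) (V : lmodType R).
Implicit Types (E : set V) (p q : V -> R).

Definition subspace_pred E : Prop :=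
  E 0 /\ forall (a : R) x y, E x -> E y -> E (a *: x + y).

Definition sublinear_on E p : Prop :=
  (forall x y, E x -> E y -> p (x + y) <= p x + p y) /\
  (forall c x, 0 <= c -> E x -> p (c *: x) = c * p x).

Definition linear_on (W : lmodType R) E (f : V -> W) : Prop :=
  forall (a : R) x y, E x -> E y -> f (a *: x + y) = a *: f x + f y.

Lemma subspace_predD E x y : subspace_pred E -> E x -> E y -> E (x + y).
Proof. by move=> [_ h] Ex Ey; rewrite -[x]scale1r; exact: h. Qed.

Lemma subspace_predZ E a x : subspace_pred E -> E x -> E (a *: x).
Proof. by move=> [h0 h] Ex; rewrite -[_ *: _]addr0; exact: h. Qed.

Lemma subspace_predN E x : subspace_pred E -> E x -> E (- x).
Proof. by move=> hE Ex; rewrite -scaleN1r; exact: subspace_predZ. Qed.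

Lemma subspace_predB E x y : subspace_pred E -> E x -> E y -> E (x - y).
Proof. by move=> hE Ex Ey; apply: subspace_predD => //; exact: subspace_predN. Qed.

Lemma linear_on0 (W : lmodType R) E (f : V -> W) :
  subspace_pred E -> linear_on E f -> f 0 = 0.
Proof.
move=> [E0 _] lf; have := lf (-1) 0 0 E0 E0.
by rewrite scaler0 addr0 scaleN1r addNr.
Qed.

Lemma linear_onZ (W : lmodType R) E (f : V -> W) a x :
  subspace_pred E -> linear_on E f -> E x -> f (a *: x) = a *: f x.
Proof.
move=> hE lf Ex; have := lf a x 0 Ex hE.1.
by rewrite !addr0 (linear_on0 hE lf) addr0.
Qed.

Lemma linear_onD (W : lmodType R) E (f : V -> W) x y :
  linear_on E f -> E x -> E y -> f (x + y) = f x + f y.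
Proof. by move=> lf Ex Ey; have := lf 1 x y Ex Ey; rewrite !scale1r. Qed.

Lemma linear_onN (W : lmodType R) E (f : V -> W) x :
  subspace_pred E -> linear_on E f -> E x -> f (- x) = - f x.
Proof. by move=> hE lf Ex; rewrite -scaleN1r (linear_onZ _ hE lf)// scaleN1r. Qed.

Lemma linear_onB (W : lmodType R) E (f : V -> W) x y :
  subspace_pred E -> linear_on E f -> E x -> E y -> f (x - y) = f x - f y.
Proof.
move=> hE lf Ex Ey; rewrite (linear_onD lf)//; last exact: subspace_predN.
by rewrite (linear_onN hE lf).
Qed.

Definition convex_cone (G : set (V * R)) : Prop :=
  [/\ G (0, 0), forall g h, G g -> G h -> G (g.1 + h.1, g.2 + h.2) &
      forall c g, 0 <= c -> G g -> G (c *: g.1, c * g.2)].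

Section cone_infimum.
Variables (E : set V) (s : V -> R) (G : set (V * R)).
Hypotheses (hE : subspace_pred E) (hs : sublinear_on E s) (hG : convex_cone G).
Hypotheses (GE : forall g, G g -> E g.1) (Gs : forall g, G g -> g.2 <= s g.1).

(** A linear functional below [s] satisfies [a <= f v] for all pairs [(v, a)] of
    [G] exactly when it is below [cone_inf]: apply [f <= s] to [x + v]. *)
Definition cone_inf x := inf [set s (x + g.1) - g.2 | g in G].

Let s0 : s 0 = 0.
Proof. by have := hs.2 0 0 (lexx _) hE.1; rewrite scaler0 mul0r. Qed.

Let lb x : E x -> lbound [set s (x + g.1) - g.2 | g in G] (- s (- x)).
Proof.
move=> Ex _ [g Gg <-]; have Eg := GE Gg.
have := hs.1 (x + g.1) (- x) (subspace_predD hE Ex Eg) (subspace_predN hE Ex).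
rewrite addrC addKr; have := Gs Gg; lra.
Qed.

Lemma cone_inf_le x g : E x -> G g -> cone_inf x <= s (x + g.1) - g.2.
Proof.
by move=> Ex Gg; apply: ge_inf; [exists (- s (- x)); exact: lb | exists g].
Qed.

Lemma le_cone_inf x m : E x ->
  (forall g, G g -> m <= s (x + g.1) - g.2) -> m <= cone_inf x.
Proof.
case: hG => G0 _ _ Ex h; apply: lb_le_inf; first by exists (s (x + 0) - 0), (0, 0).
by move=> _ [g Gg <-]; exact: h.
Qed.

Lemma cone_inf_dom x : E x -> cone_inf x <= s x.
Proof.
case: hG => G0 _ _ Ex.
by have := cone_inf_le Ex G0; rewrite /= addr0 subr0.
Qed.

Lemma cone_infN g : G g -> cone_inf (- g.1) <= - g.2.
Proof.
move=> Gg; have := cone_inf_le (subspace_predN hE (GE Gg)) Gg.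
by rewrite addNr s0 sub0r.
Qed.

Lemma cone_inf_sublinear : sublinear_on E cone_inf.
Proof.
case: (hG) => G0 GD GZ; split=> [x y Ex Ey|].
  rewrite -lerBlDr; apply: le_cone_inf => // g Gg.
  rewrite lerBlDr -lerBlDl; apply: le_cone_inf => // h Gh.
  have Exy := subspace_predD hE Ex Ey.
  have /= := cone_inf_le Exy (GD _ _ Gg Gh).
  have -> : x + y + (g.1 + h.1) = (x + g.1) + (y + h.1) by rewrite addrACA.
  have := hs.1 _ _ (subspace_predD hE Ex (GE Gg)) (subspace_predD hE Ey (GE Gh)).
  lra.
have Zle c x : 0 < c -> E x -> cone_inf (c *: x) <= c * cone_inf x.
  move=> c0 Ex; rewrite mulrC -ler_pdivrMr//; apply: le_cone_inf => // g Gg.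
  rewrite ler_pdivrMr//.
  have /= := cone_inf_le (subspace_predZ c hE Ex) (GZ c g (ltW c0) Gg).
  rewrite -scalerDr hs.2 ?(ltW c0)//; last exact: (subspace_predD hE Ex (GE Gg)).
  by rewrite mulrBl mulrC (mulrC c).
move=> c x; rewrite le_eqVlt => /predU1P[<- Ex|c0 Ex].
  rewrite scale0r mul0r; apply/eqP; rewrite eq_le; apply/andP; split.
    by have := cone_inf_dom hE.1; rewrite s0.
  by apply: le_cone_inf => [|g Gg]; [exact: hE.1|rewrite add0r subr_ge0 Gs].
apply/eqP; rewrite eq_le Zle//=.
have ci : 0 < c^-1 by rewrite invr_gt0.
have := Zle _ _ ci (subspace_predZ c hE Ex).
by rewrite scalerA mulVf ?gt_eqF// scale1r ler_pdivlMl.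
Qed.

End cone_infimum.

(** A minimal sublinear functional [q] is linear: for [y] in [E], the infimum of
    [q (x + t *: y) - t * q y] over [t >= 0] is again sublinear and below [q],
    hence equal to [q], which forces [q (- y) = - q y]. *)
Lemma sublinear_above_linear E s : subspace_pred E -> sublinear_on E s ->
  exists2 f : V -> R^o, linear_on E f & forall x, E x -> f x <= s x.
Proof.
move=> hE hs.
pose T := {q : V -> R | sublinear_on E q /\ forall x, E x -> q x <= s x}.
pose rel (a b : T) := `[< forall x, E x -> sval b x <= sval a x >].
have t0 : T by exists s; split.
have sub0 q : sublinear_on E q -> q 0 = 0.
  by move=> hq; have := hq.2 0 0 (lexx _) hE.1; rewrite scaler0 mul0r.
have subN q x : sublinear_on E q -> E x -> - q (- x) <= q x.
  move=> hq Ex; have := hq.1 x (- x) Ex (subspace_predN hE Ex).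
  by rewrite subrr sub0// => h; lra.
have [|a b c|A Atot|m mmin] := @ZL_preorder T t0 rel.
- by move=> a; apply/asboolP.
- by move=> /asboolP h1 /asboolP h2; apply/asboolP => x Ex; exact: le_trans (h2 _ Ex) (h1 _ Ex).
(* The infimum of a nonempty chain is sublinear because two members of the
   chain can be replaced by the smaller one. *)
- have [[a0 Aa0]|A0] := pselect (exists a, A a).
    pose S x := [set sval a x | a in A].
    have lbS x : E x -> lbound (S x) (- s (- x)).
      move=> Ex _ [a Aa <-]; case: (svalP a) => ha ale.
      apply: le_trans (subN _ _ ha Ex); rewrite lerN2.
      by apply: ale; exact: subspace_predN.
    have infle x (a : T) : E x -> A a -> inf (S x) <= sval a x.
      move=> Ex Aa; apply: ge_inf; last by exists a.
      by exists (- s (- x)); exact: lbS.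
    have leinf x r : E x -> (forall a, A a -> r <= sval a x) -> r <= inf (S x).
      move=> Ex h; apply: lb_le_inf; first by exists (sval a0 x), a0.
      by move=> _ [a Aa <-]; exact: h.
    pose q x := inf (S x).
    have hq : sublinear_on E q.
      split=> [x y Ex Ey|c x c0 Ex].
        rewrite -lerBlDr; apply: (leinf) => // a Aa.
        rewrite lerBlDr -lerBlDl; apply: (leinf) => // b Ab.
        rewrite lerBlDl.
        have Exy := subspace_predD hE Ex Ey.
        have [/asboolP ab|/asboolP ba] := Atot _ _ Aa Ab.
          apply: (le_trans (infle _ _ Exy Ab)).
          apply: (le_trans ((svalP b).1.1 _ _ Ex Ey)); rewrite lerD2r; exact: ab.
        apply: (le_trans (infle _ _ Exy Aa)).
        apply: (le_trans ((svalP a).1.1 _ _ Ex Ey)); rewrite lerD2l; exact: ba.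
      have Ecx := subspace_predZ c hE Ex.
      move: c0; rewrite le_eqVlt => /predU1P[<-|c0].
        rewrite scale0r mul0r; apply/eqP; rewrite eq_le; apply/andP; split.
          by apply: le_trans (infle _ _ hE.1 Aa0) _; rewrite sub0//; case: (svalP a0).
        by apply: (leinf) => [|a _]; [exact: hE.1|rewrite sub0//; case: (svalP a)].
      apply/eqP; rewrite eq_le; apply/andP; split.
        rewrite mulrC -ler_pdivrMr//; apply: (leinf) => // a Aa.
        rewrite ler_pdivrMr// mulrC -(svalP a).1.2//; [exact: infle|exact: ltW].
      apply: (leinf) => // a Aa; rewrite (svalP a).1.2//; [rewrite ler_pM2l//; exact: infle|exact: ltW].
    have qs x : E x -> q x <= s x.
      by move=> Ex; apply: le_trans (infle _ _ Ex Aa0) _; case: (svalP a0) => _; exact.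
    exists (exist _ q (conj hq qs)) => a Aa; apply/asboolP => x Ex /=; exact: infle.
  by exists t0 => a Aa; case: A0; exists a.
case: m mmin => q [hq qs] mmin; exists q => //.
have qN y : E y -> q (- y) = - q y.
  move=> Ey; pose G := [set g : V * R | exists2 t, 0 <= t & g = (t *: y, t * q y)].
  have hG : convex_cone G.
    split=> [|_ _ [t t0' ->] [u u0 ->]|c _ c0 [t t0' ->]] /=.
    - by exists 0 => //; rewrite scale0r mul0r.
    - by exists (t + u); rewrite ?addr_ge0// scalerDl mulrDl.
    - by exists (c * t); rewrite ?mulr_ge0// scalerA mulrA.
  have GE g : G g -> E g.1 by move=> [t _ ->]; exact: subspace_predZ.
  have Gq g : G g -> g.2 <= q g.1 by move=> [t t0' ->] /=; rewrite hq.2.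
  have h1 := cone_inf_sublinear hE hq hG GE Gq.
  have h2 x : E x -> cone_inf q G x <= q x by exact: cone_inf_dom.
  have h3 x : E x -> cone_inf q G x <= s x by move=> Ex; apply: le_trans (h2 x Ex) (qs x Ex).
  have Gy : G (y, q y) by exists 1 => //; rewrite scale1r mul1r.
  have /asboolP/(_ _ (subspace_predN hE Ey)) /= h4 :=
    mmin (exist _ _ (conj h1 h3)) (introT (asboolP _) h2).
  have := cone_infN hE hq GE Gq Gy; have := subN q y hq Ey => /=; lra.
move=> a x y Ex Ey; have Eax := subspace_predZ a hE Ex.
have qD u v : E u -> E v -> q (u + v) = q u + q v.
  move=> Eu Ev; apply/eqP; rewrite eq_le hq.1//=.
  have Euv := subspace_predD hE Eu Ev.
  have := hq.1 _ _ (subspace_predN hE Eu) (subspace_predN hE Ev).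
  rewrite -opprD !qN//; lra.
rewrite qD//; congr (_ + _); case: (leP 0 a) => [a0|a0]; first exact: hq.2.
have -> : a *: x = - ((- a) *: x) by rewrite scaleNr opprK.
rewrite qN; last exact: subspace_predZ.
rewrite hq.2//; last by rewrite oppr_ge0 ltW.
by rewrite mulNr opprK.
Qed.

(** The Mazur-Orlicz form of the Hahn-Banach theorem.  Pairs [(v, a)] of the
    cone prescribe lower bounds [a <= f v]; graphs of functionals and half-lines
    give the usual extension and separation statements. *)
Lemma mazur_orlicz E s (G : set (V * R)) :
  subspace_pred E -> sublinear_on E s -> convex_cone G ->
  (forall g, G g -> E g.1) -> (forall g, G g -> g.2 <= s g.1) ->
  exists f : V -> R^o, [/\ linear_on E f, forall x, E x -> f x <= s x &
    forall g, G g -> g.2 <= f g.1].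
Proof.
move=> hE hs hG GE Gs.
have [f lf fle] := sublinear_above_linear hE (cone_inf_sublinear hE hs hG GE Gs).
exists f; split=> // [x Ex|g Gg].
  exact: le_trans (fle _ Ex) (cone_inf_dom hE hs hG GE Gs Ex).
have Eg := GE _ Gg.
have := le_trans (fle _ (subspace_predN hE Eg)) (cone_infN hE hs GE Gs Gg).
by rewrite (linear_onN hE lf)// lerN2.
Qed.

End hahn_banach.

(** * Countable rational spans and diagonal subsequences *)

Section rational_span.
Context (R : realType) (V : lmodType R).
Implicit Types (E : set V) (d : nat -> V).

Definition seminorm_on E (s : V -> R) : Prop :=
  (forall x y, E x -> E y -> s (x + y) <= s x + s y) /\
  (forall a x, E x -> s (a *: x) = `|a| * s x).

Section seminorm_lemmas.
Variables (E : set V) (s : V -> R).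
Hypotheses (hE : subspace_pred E) (hs : seminorm_on E s).

Lemma seminorm0 : s 0 = 0.
Proof. by have := hs.2 0 0 hE.1; rewrite scaler0 normr0 mul0r. Qed.

Lemma seminormN x : E x -> s (- x) = s x.
Proof. by move=> Ex; rewrite -scaleN1r hs.2// normrN1 mul1r. Qed.

Lemma seminorm_ge0 x : E x -> 0 <= s x.
Proof.
move=> Ex; have := hs.1 x (- x) Ex (subspace_predN hE Ex).
rewrite subrr seminorm0 seminormN//; lra.
Qed.

Lemma seminormB x y : E x -> E y -> s (x - y) <= s x + s y.
Proof.
move=> Ex Ey; rewrite -(seminormN Ey); apply: hs.1 => //.
exact: subspace_predN.
Qed.

Lemma seminorm_sublinear : sublinear_on E s.
Proof. by split=> [|c x c0 Ex]; [exact: hs.1|rewrite hs.2// ger0_norm]. Qed.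
End seminorm_lemmas.

(** With [q = 1] and [q = -1] the family is closed under sums and differences;
    a countable family of this kind serves as a dense subset of the subspace
    that it spans. *)
Definition rat_closed d : Prop :=
  forall (q : rat) i j, exists k, d k = ratr q *: d i + d j.

(** The rational combinations of the [x i], enumerated through the codes of the
    lists of their coefficients and indices. *)
Definition rat_span (x : nat -> V) (k : nat) : V :=
  if @unpickle (seq (rat * nat)) k is Some l
  then \sum_(p <- l) ratr p.1 *: x p.2 else 0.

Lemma rat_span_closed x : rat_closed (rat_span x).
Proof.
move=> q i j.
have E k : exists l : seq (rat * nat), rat_span x k = \sum_(p <- l) ratr p.1 *: x p.2.
  rewrite /rat_span; case: unpickle => [l|]; first by exists l.
  by exists [::]; rewrite big_nil.
have [l1 ->] := E i; have [l2 ->] := E j.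
exists (pickle ([seq (q * p.1, p.2) | p <- l1] ++ l2)).
rewrite /rat_span pickleK big_cat big_map /=; congr (_ + _).
by rewrite scaler_sumr; apply: eq_bigr => p _; rewrite scalerA rmorphM.
Qed.

Lemma rat_span_gen x i : exists k, rat_span x k = x i.
Proof.
exists (pickle [:: (1%Q, i)]); rewrite /rat_span pickleK big_seq1 /=.
by rewrite rmorph1 scale1r.
Qed.

Lemma rat_span_sub E x k :
  subspace_pred E -> (forall i, E (x i)) -> E (rat_span x k).
Proof.
move=> hE hx; rewrite /rat_span; case: unpickle => [l|]; last exact: hE.1.
by apply: big_rec => [|p y _ Ey]; [exact: hE.1|exact: hE.2].
Qed.

Lemma rat_closed0 d : rat_closed d -> exists k, d k = 0.
Proof.
move=> hd; have [k dk] := hd (-1)%Q 0%N 0%N; exists k.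
by rewrite dk rmorphN1 scaleN1r addNr.
Qed.

Lemma rat_closedB d i j : rat_closed d -> exists k, d k = d i - d j.
Proof.
move=> hd; have [k dk] := hd (-1)%Q j i; exists k.
by rewrite dk rmorphN1 scaleN1r addrC.
Qed.

Lemma ratr_approx (a e : R) : 0 < e -> exists q : rat, `|a - ratr q| < e.
Proof.
move=> e0; have ae : a - e < a + e by lra.
have [q] := rat_in_itvoo ae; rewrite in_itv/= => /andP[h1 h2].
by exists q; rewrite ltr_norml; apply/andP; split; lra.
Qed.

Definition seminorm_closure E (s : V -> R) d : set V :=
  [set x | E x /\ forall e, 0 < e -> exists j, s (x - d j) < e].

Section closure.
Variables (E : set V) (s : V -> R) (d : nat -> V).
Hypotheses (hE : subspace_pred E) (hs : seminorm_on E s).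
Hypotheses (dE : forall j, E (d j)) (hd : rat_closed d).

Lemma rat_comb_approx (a : R) x y (e : R) : E x -> E y -> 0 < e ->
  exists2 e', 0 < e' & forall i j, s (x - d i) < e' -> s (y - d j) < e' ->
    exists2 q, `|a - ratr q| < e & s (a *: x + y - (ratr q *: d i + d j)) < e.
Proof.
move=> Ex Ey e0; pose C : R := `|a| + s x + 2.
have sx := seminorm_ge0 hE hs Ex.
have C0 : 0 < C by rewrite /C; have := normr_ge0 a; lra.
pose e1 := Num.min 1 (e / (C + C)).
have e10 : 0 < e1 by rewrite lt_min ltr01 divr_gt0// addr_gt0.
exists e1 => // i j hi hj.
have [q hq] := ratr_approx a e10.
have e1e : e1 * (C + C) <= e by rewrite -ler_pdivlMr; [rewrite /e1 ge_min lexx orbT|exact: addr_gt0].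
have e11 : e1 <= 1 by rewrite /e1 ge_min lexx.
exists q.
  apply: lt_le_trans hq _; apply: le_trans e1e.
  rewrite ler_peMr ?(ltW e10)//; rewrite /C; have := normr_ge0 a; lra.
have -> : a *: x + y - (ratr q *: d i + d j) =
    a *: (x - d i) + ((a - ratr q) *: d i + (y - d j)).
  rewrite scalerBr scalerBl opprD addrACA !addrA; congr (_ + _ - _).
  by rewrite subrK.
have Exi := subspace_predB hE Ex (dE i); have Eyj := subspace_predB hE Ey (dE j).
have h1 := hs.1 _ _ (subspace_predZ a hE Exi)
  (subspace_predD hE (subspace_predZ (a - ratr q) hE (dE i)) Eyj).
have h2 := hs.1 _ _ (subspace_predZ (a - ratr q) hE (dE i)) Eyj.
have h3 := hs.2 a _ Exi; have h4 := hs.2 (a - ratr q) _ (dE i).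
have h5 : s (d i) <= s x + 1.
  have := hs.1 _ _ (subspace_predN hE Exi) Ex.
  rewrite (seminormN hs Exi) opprB subrK; lra.
have h6 := seminorm_ge0 hE hs (dE i).
have h7 : `|a| * s (x - d i) <= `|a| * e1 by rewrite ler_wpM2l// ltW.
have h8 : `|a - ratr q| * s (d i) <= e1 * (s x + 1) by rewrite ler_pM// ltW.
have h9 : `|a| * e1 + e1 * (s x + 1) + e1 = e1 * C by rewrite /C; ring.
have h10 : 0 < e1 * C by rewrite mulr_gt0.
have h11 : e1 * (C + C) = e1 * C + e1 * C by rewrite mulrDr.
lra.
Qed.

Lemma seminorm_closure_subspace : subspace_pred (seminorm_closure E s d).
Proof.
split=> [|a x y [Ex hx] [Ey hy]].
  split=> [|e e0]; first exact: hE.1.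
  have [k dk] := rat_closed0 hd.
  by exists k; rewrite dk subrr (seminorm0 hE hs).
split=> [|e e0]; first exact: hE.2.
have [e' e'0 h] := rat_comb_approx a Ex Ey e0.
have [i hi] := hx _ e'0; have [j hj] := hy _ e'0.
have [q _ hq] := h i j hi hj; have [k dk] := hd q i j.
by exists k; rewrite dk.
Qed.

Lemma seminorm_closure_gen j : seminorm_closure E s d (d j).
Proof. by split=> // e e0; exists j; rewrite subrr (seminorm0 hE hs). Qed.
End closure.

End rational_span.

Section hahn_banach_corollaries.
Context (R : realType) (V : lmodType R).
Variables (E : set V) (s : V -> R).
Hypotheses (hE : subspace_pred E) (hs : seminorm_on E s).

Let abs_le (f : V -> R^o) : linear_on E f -> (forall x, E x -> f x <= s x) ->
  forall x, E x -> `|f x| <= s x.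
Proof.
move=> lf fs x Ex; rewrite ler_norml fs// andbT lerNl -(seminormN hs Ex).
by rewrite -(linear_onN hE lf Ex); apply: fs; exact: subspace_predN.
Qed.

(** The cone is generated by [F] with lower bound 0, which forces [f] to vanish
    on [F], and by [x] with lower bound [e]. *)
Lemma seminorm_separation (F : set V) x (e : R) : subspace_pred F ->
  F `<=` E -> E x -> 0 <= e -> (forall v, F v -> e <= s (x - v)) ->
  exists f : V -> R^o, [/\ linear_on E f, forall y, E y -> `|f y| <= s y,
    forall v, F v -> f v = 0 & e <= f x].
Proof.
move=> hF FE Ex e0 h.
pose G : set (V * R) := [set g | exists2 t, 0 <= t &
  exists2 v, F v & g = (t *: x - v, t * e)].
have hG : convex_cone G.
  split=> [|_ _ [t t0 [v Fv ->]] [u u0 [w Fw ->]]|c _ c0 [t t0 [v Fv ->]]] /=.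
  - exists 0 => //; exists 0; first exact: hF.1.
    by rewrite scale0r mul0r subr0.
  - exists (t + u); first exact: addr_ge0.
    exists (v + w); first exact: subspace_predD.
    by rewrite scalerDl mulrDl opprD addrACA.
  - exists (c * t); first exact: mulr_ge0.
    exists (c *: v); first exact: subspace_predZ.
    by rewrite scalerBr scalerA mulrA.
have [_ [t _ [v Fv ->]]|_ [t t0 [v Fv ->]]|f [lf fs fG]] :=
    mazur_orlicz hE (seminorm_sublinear hs) hG.
- by apply: subspace_predB => //; [exact: subspace_predZ|exact: FE].
- move: t0; rewrite le_eqVlt => /predU1P[<-|t0] /=.
    rewrite mul0r scale0r sub0r; apply: (seminorm_ge0 hE hs).
    by apply: subspace_predN => //; exact: FE.
  have -> : t *: x - v = t *: (x - t^-1 *: v).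
    by rewrite scalerBr scalerA divff ?gt_eqF// scale1r.
  have Ftv : F (t^-1 *: v) by exact: subspace_predZ.
  rewrite hs.2; last by apply: subspace_predB => //; exact: FE.
  by rewrite gtr0_norm// ler_pM2l//; exact: h.
have fv v : F v -> 0 <= - f v.
  move=> Fv; have /= := fG (0 *: x - v, 0 * e).
  rewrite scale0r sub0r mul0r -(linear_onN hE lf (FE _ Fv)); apply.
  by exists 0 => //; exists v => //; rewrite scale0r sub0r mul0r.
exists f; split=> //; first exact: abs_le.
  move=> v Fv; have := fv _ (subspace_predN hF Fv); have := fv _ Fv.
  rewrite (linear_onN hE lf (FE _ Fv)) => h1 h2.
  by apply/eqP; rewrite eq_le; apply/andP; split; lra.
have /= := fG (1 *: x - 0, 1 * e); rewrite scale1r mul1r subr0; apply.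
by exists 1 => //; exists 0; [exact: hF.1|rewrite scale1r mul1r subr0].
Qed.

Lemma seminorm_norming x : E x -> exists f : V -> R^o,
  [/\ linear_on E f, forall y, E y -> `|f y| <= s y & f x = s x].
Proof.
move=> Ex; have h0 : subspace_pred [set 0 : V].
  by split=> // a y z -> ->; rewrite scaler0 addr0.
have [|||v ->|f [lf fs _ fx]] := seminorm_separation (x := x) (e := s x) h0.
- by move=> _ ->; exact: hE.1.
- by [].
- exact: (seminorm_ge0 hE hs Ex).
- by rewrite subr0.
exists f; split=> //; apply/eqP; rewrite eq_le fx andbT.
by apply: le_trans (fs _ Ex); exact: ler_norm.
Qed.

Lemma seminorm_extension (F : set V) (g : V -> R^o) : subspace_pred F ->
  F `<=` E -> linear_on F g -> (forall v, F v -> `|g v| <= s v) ->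
  exists f : V -> R^o, [/\ linear_on E f, forall y, E y -> `|f y| <= s y &
    forall v, F v -> f v = g v].
Proof.
move=> hF FE lg gs.
pose G : set (V * R) := [set p | F p.1 /\ p.2 = g p.1].
have hG : convex_cone G.
  split=> [|p q [Fp gp] [Fq gq]|c p _ [Fp gp]]; rewrite /G /=.
  - by split; [exact: hF.1|rewrite (linear_on0 hF lg)].
  - by split; [exact: subspace_predD|rewrite (linear_onD lg)// gp gq].
  - by split; [exact: subspace_predZ|rewrite (linear_onZ _ hF lg)// gp].
have [p [Fp _]|p [Fp ->]|f [lf fs fG]] := mazur_orlicz hE (seminorm_sublinear hs) hG.
- exact: FE.
- by apply: le_trans (gs _ Fp); exact: ler_norm.
exists f; split=> //; first exact: abs_le.
have fge v : F v -> g v <= f v by move=> Fv; exact: (fG (v, g v)).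
move=> v Fv; apply/eqP; rewrite eq_le fge// andbT.
have := fge _ (subspace_predN hF Fv).
by rewrite (linear_onN hF lg)// (linear_onN hE lf) ?lerN2//; exact: FE.
Qed.

End hahn_banach_corollaries.

Section diagonal.

Definition subsequence (t : nat -> nat) : Prop := {homo t : i j / (i < j)%N}.

Lemma subsequence_ge t n : subsequence t -> (n <= t n)%N.
Proof. by move=> ht; elim: n => // n IH; apply: leq_ltn_trans IH _; exact: ht. Qed.

Lemma subsequence_comp t u : subsequence t -> subsequence u -> subsequence (t \o u).
Proof. by move=> ht hu i j ij; apply: ht; exact: hu. Qed.

(** The second hypothesis says that [P j] is a property of the tail of a
    sequence that passes to subsequences; it is phrased with a reindexing [r]
    tending to infinity because the diagonal is a subsequence of the [j]-th
    extraction only from the index [j] on. *)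
Lemma diagonal_subsequence (P : nat -> (nat -> nat) -> Prop) :
  (forall j t, subsequence t -> exists2 u, subsequence u & P j (t \o u)) ->
  (forall j t u (r : nat -> nat), P j t -> (forall n, (n <= r n)%N) ->
     (forall n, (j <= n)%N -> u n = t (r n)) -> P j u) ->
  exists2 t, subsequence t & forall j, P j t.
Proof.
move=> hex htail.
have /choice[next hnext] : forall jt : nat * (nat -> nat), exists u,
    subsequence jt.2 -> subsequence u /\ P jt.1 (jt.2 \o u).
  move=> [j t]; have [st|nst] := pselect (subsequence t); last by exists id.
  by have [u su Pu] := hex j t st; exists u.
pose fix S n : nat -> nat :=
  if n is m.+1 then S m \o next (n, S m) else next (0%N, id).
have id_sub : subsequence id by [].
have Ssub n : subsequence (S n).
  elim: n => [|n IH] /=; first by have [] := hnext (0%N, id) id_sub.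
  by apply: (subsequence_comp (IH)); have [] := hnext (n.+1, S n) IH.
have SP n : P n (S n).
  case: n => [|n]; first by have [] := hnext (0%N, id) id_sub.
  by have [_] := hnext (n.+1, S n) (Ssub n).
have SS j i : exists2 r, subsequence r & S (j + i)%N = S j \o r.
  elim: i => [|i [r hr IH]]; first by exists id; rewrite ?addn0.
  rewrite addnS /=; have [hn _] := hnext ((j + i).+1, S (j + i)%N) (Ssub _).
  by rewrite {1}IH; exists (r \o next ((j + i).+1, S (j + i)%N)) => //; exact: subsequence_comp.
exists (fun n => S n n) => [|j].
  apply: homo_ltn => [|n]; first exact: ltn_trans.
  have [r hr] := SS n 1%N; rewrite addn1 => ->; apply: Ssub.
  exact: leq_trans (subsequence_ge n.+1 hr).
have /choice[r hr] : forall n, exists m, (n <= m)%N /\ ((j <= n)%N -> S n n = S j m).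
  move=> n; have [jn|nj] := leqP j n; last by exists n.
  have [r sr] := SS j (n - j)%N; rewrite subnKC// => ->.
  by exists (r n); split => //; exact: subsequence_ge.
apply: (htail j (S j) _ r (SP j)) => n; have [] := hr n => //.
Qed.

End diagonal.

(** * Strong measurability *)

Lemma countable_enum (S : Type) (D : set S) : countable D -> D !=set0 ->
  exists y : nat -> S, (forall n, D (y n)) /\ D `<=` range y.
Proof.
move=> /pfcard_geP[->[x []]//|[g] _]; exists g; split=> [n|].
  exact: (@funS _ _ _ _ g).
exact: (@surj _ _ _ _ g).
Qed.

Section strong_measurability_real.
Context d (T : measurableType d) (R : realType).

Definition simple_map (S : Type) (f : T -> S) : Prop :=
  finite_set (range f) /\ forall v, measurable (f @^-1` [set v]).

Definition smeas (V : normedModType R) (f : T -> V) : Prop :=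
  exists2 f_ : nat -> T -> V, (forall n, simple_map (f_ n)) &
    forall t, f_ n t @[n --> \oo] --> f t.

(** A selector picks, measurably, one index among finitely many; simple
    functions are handled as [fun t => y (s t)] for a selector [s]. *)
Definition selector (m : nat) (s : T -> nat) : Prop :=
  (forall t, (s t <= m)%N) /\ forall j, measurable (s @^-1` [set j]).

Definition cutoff (V : lmodType R) (A : set T) (f : T -> V) : T -> V :=
  fun t => (\1_A t : R) *: f t.

Lemma simple_map_preimage (S : Type) (f : T -> S) (B : set S) :
  simple_map f -> measurable (f @^-1` B).
Proof.
move=> [ff mf].
have -> : f @^-1` B = \bigcup_(v in range f `&` B) f @^-1` [set v].
  apply/seteqP; split=> [t /= Bt|t [v [_ Bv] /= ->]//].
  by exists (f t) => //; split => //; exists t.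
by apply: fin_bigcup_measurable => //; exact: finite_setIl.
Qed.

Lemma simple_map_comp (S U : Type) (h : S -> U) (f : T -> S) :
  simple_map f -> simple_map (h \o f).
Proof.
move=> sf; split=> [|v]; last first.
  by rewrite comp_preimage; exact: simple_map_preimage.
by rewrite -(image_comp f h); exact: finite_image sf.1.
Qed.

Lemma simple_map_pair (S U : Type) (f : T -> S) (g : T -> U) :
  simple_map f -> simple_map g -> simple_map (fun t => (f t, g t)).
Proof.
move=> [ff mf] [fg mg]; split=> [|[u v]].
  apply: sub_finite_set (finite_setX ff fg) => _ [t _ <-].
  by split; exists t.
rewrite [X in measurable X](_ : _ = f @^-1` [set u] `&` g @^-1` [set v]).
  exact: measurableI.
by apply/seteqP; split=> [t [<- <-]|t [/= -> ->]].
Qed.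

Lemma simple_map_cst (S : Type) (v : S) : simple_map (fun _ : T => v).
Proof.
split=> [|w]; last by rewrite preimage_cst; case: ifP => _; [exact: measurableT|].
by apply: sub_finite_set (finite_set1 v) => _ [t _ <-].
Qed.

Lemma simple_map_measurable (f : T -> R) :
  simple_map f -> measurable_fun setT f.
Proof. by move=> sf _ Y _; rewrite setTI; exact: simple_map_preimage. Qed.

Lemma simple_map_bool (A : set T) : measurable A -> simple_map (fun t => t \in A).
Proof.
move=> mA; split=> [|b].
  exact: finite_finset.
case: b; last first.
  rewrite [X in measurable X](_ : _ = ~` A); first exact: measurableC.
  apply/seteqP; split=> t /=; first by move=> h At; rewrite mem_set in h.
  by move=> h; apply/negbTE/negP => /set_mem.
by rewrite [X in measurable X](_ : _ = A)//; apply/seteqP;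
  split=> t /=; [move/set_mem|move/mem_set].
Qed.

Lemma selector_simple m s : selector m s -> simple_map s.
Proof.
move=> [sm ms]; split => //; apply: sub_finite_set (finite_II m.+1) => _ [t _ <-].
by rewrite /= ltnS.
Qed.

Lemma smeas_simple (V : normedModType R) (f : T -> V) : simple_map f -> smeas f.
Proof. by move=> sf; exists (fun=> f) => // t; exact: cvg_cst. Qed.

Lemma smeas_cst (V : normedModType R) (v : V) : smeas (fun _ : T => v).
Proof. apply: smeas_simple; exact: simple_map_cst. Qed.

Lemma smeas_comp2 (U V W : normedModType R) (h : U -> V -> W) f g :
  (forall u v, h z.1 z.2 @[z --> (u, v)] --> h u v) ->
  smeas f -> smeas g -> smeas (fun t : T => h (f t) (g t)).
Proof.
move=> ch [f_ sf cf] [g_ sg cg]; exists (fun n t => h (f_ n t) (g_ n t)) => [n|t].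
  by have := simple_map_comp (fun z => h z.1 z.2) (simple_map_pair (sf n) (sg n)).
exact: continuous2_cvg (ch _ _) (cf t) (cg t).
Qed.

Lemma smeas_comp (U V : normedModType R) (h : U -> V) f :
  continuous h -> smeas f -> smeas (fun t : T => h (f t)).
Proof.
move=> ch [f_ sf cf]; exists (fun n t => h (f_ n t)) => [n|t].
  by have := simple_map_comp h (sf n).
exact: (cvg_comp _ _ (cf t) (ch (f t))).
Qed.

Lemma smeasD (V : normedModType R) (f g : T -> V) :
  smeas f -> smeas g -> smeas (fun t => f t + g t).
Proof.
by move=> mf mg; apply: (smeas_comp2 _ mf mg) => u v; exact: (add_continuous (u, v)).
Qed.

Lemma smeasZ (V : normedModType R) (h : T -> R^o) (f : T -> V) :
  smeas h -> smeas f -> smeas (fun t => h t *: f t).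
Proof.
by move=> mf mg; apply: (smeas_comp2 _ mf mg) => u v; exact: (scale_continuous (u, v)).
Qed.

Lemma smeas_scale (V : normedModType R) (a : R) (f : T -> V) :
  smeas f -> smeas (fun t => a *: f t).
Proof. by move=> mf; apply: (@smeasZ _ (fun=> a)) => //; exact: smeas_cst. Qed.

Lemma smeasB (V : normedModType R) (f g : T -> V) :
  smeas f -> smeas g -> smeas (fun t => f t - g t).
Proof.
move=> mf mg.
have -> : (fun t => f t - g t) = (fun t => f t + (-1) *: g t).
  by apply/funext => t; rewrite scaleN1r.
by apply: smeasD => //; exact: smeas_scale.
Qed.

Lemma smeas_cutoff (V : normedModType R) A (f : T -> V) :
  measurable A -> smeas f -> smeas (cutoff A f).
Proof.
move=> mA mf; apply: smeasZ => //; apply: smeas_simple.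
have -> : (\1_A : T -> R^o) = (fun b : bool => b%:R) \o (fun t => t \in A).
  by apply/funext => t; rewrite indicE.
by apply: simple_map_comp; exact: simple_map_bool.
Qed.

Lemma smeas_measurable (f : T -> R^o) : smeas f -> measurable_fun setT (f : T -> R).
Proof.
move=> [f_ sf cf]; apply: (@measurable_fun_cvg _ _ _ _ f_) => [m|x _].
  exact: simple_map_measurable.
exact: cf.
Qed.

Lemma smeas_measurable_norm (V : normedModType R) (f : T -> V) :
  smeas f -> measurable_fun setT (fun t => `|f t|).
Proof.
move=> mf; apply: smeas_measurable; apply: smeas_comp mf.
exact: norm_continuous.
Qed.

(** The maximum, taken along a selector, can be integrated piece by piece, with a
    constant index on each piece. *)
Lemma argmax_selector (g : nat -> T -> R) (m : nat) :
  (forall j, measurable_fun setT (g j)) ->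
  exists s, [/\ selector m s, measurable_fun setT (fun t => g (s t) t) &
    forall j t, (j <= m)%N -> g j t <= g (s t) t].
Proof.
move=> mg; elim: m => [|m [s [[sm ms] mgs hs]]].
  exists (fun=> 0%N); split=> // [|j t]; last by rewrite leqn0 => /eqP ->.
  by split=> // j; exact: (simple_map_cst 0%N).2.
pose s' t := if g (s t) t < g m.+1 t then m.+1 else s t.
have mB : measurable [set t | g (s t) t < g m.+1 t].
  have := measurable_fun_ltr mgs (mg m.+1) measurableT (Y := [set true]) I.
  by rewrite setTI; exact.
exists s'; split.
- split=> [t|j]; rewrite /s'; first by case: ifP => // _; rewrite (leq_trans (sm t)).
  rewrite [X in measurable X](_ : _ =
    ([set t | g (s t) t < g m.+1 t] `&` [set t | m.+1 = j]) `|`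
    (~` [set t | g (s t) t < g m.+1 t] `&` s @^-1` [set j])).
    apply: measurableU; apply: measurableI => //; last exact: measurableC.
    by have [e|ne] := pselect (m.+1 = j);
      [rewrite [X in measurable X](_ : _ = setT)|rewrite [X in measurable X](_ : _ = set0)] => //;
      apply/seteqP; split.
  apply/seteqP; split=> t /=.
    by case: ifPn => [h e|/negP h e]; [left|right].
  by case=> [[h <-]|[/negP h <-]]; [rewrite h|rewrite (negbTE h)].
- rewrite [X in measurable_fun _ X](_ : _ = (fun t => g (s t) t) \max g m.+1).
    exact: measurable_maxr.
  by apply/funext => t; rewrite /s' /= maxElt; case: ifP.
- move=> j t; rewrite leq_eqVlt => /predU1P[->|].
    by rewrite /s'; case: ltP => // ; rewrite lexx.
  rewrite ltnS => /(hs _ t) h; rewrite /s'; case: ltP => // /ltW.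
  exact: le_trans.
Qed.

(** Pettis' criterion in the form that is used here: a function with values in
    the closure of a sequence [y] is the limit of its nearest points in the
    finite sets [y 0, ..., y n], which are chosen by a selector. *)
Lemma nearest_point_approx (V : normedModType R) (f : T -> V) (y : nat -> V) :
  (forall t (e : R), 0 < e -> exists j, `|f t - y j| < e) ->
  (forall j, measurable_fun setT (fun t => `|f t - y j|)) ->
  exists s : nat -> T -> nat, [/\ forall n, selector n (s n),
    forall t, y (s n t) @[n --> \oo] --> f t &
    forall n j t, (j <= n)%N -> `|f t - y (s n t)| <= `|f t - y j|].
Proof.
move=> dy my.
have mN j : measurable_fun setT (fun t => - `|f t - y j|).
  exact: measurableT_comp (my j).
have /choice[s hs] : forall n, exists s, selector n s /\
    forall j t, (j <= n)%N -> `|f t - y (s t)| <= `|f t - y j|.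
  move=> n; have [s [h1 _ h2]] := argmax_selector n mN.
  by exists s; split=> // j t jn; have := h2 j t jn; rewrite lerN2.
exists s; split=> [n|t|n j t jn]; [exact: (hs n).1| |exact: (hs n).2].
apply/cvgrPdist_lt => e e0; have [j hj] := dy t e e0.
exists j => // n /= jn; apply: le_lt_trans hj; exact: (hs n).2.
Qed.

Lemma nearest_point_smeas (V : normedModType R) (f : T -> V) (y : nat -> V) :
  (forall t (e : R), 0 < e -> exists j, `|f t - y j| < e) ->
  (forall j, measurable_fun setT (fun t => `|f t - y j|)) -> smeas f.
Proof.
move=> dy my; have [s [ss cs _]] := nearest_point_approx dy my.
exists (fun n t => y (s n t)) => // n.
exact: (simple_map_comp y (selector_simple (ss n))).
Qed.

Lemma smeas_separable_seq (V : normedModType R) (f : nat -> T -> V) :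
  (forall n, smeas (f n)) ->
  exists y : nat -> V, forall n t (e : R), 0 < e -> exists j, `|f n t - y j| < e.
Proof.
move=> mf.
have /choice[f_ hf] : forall n, exists g : nat -> T -> V,
    (forall m, simple_map (g m)) /\ forall t, g m t @[m --> \oo] --> f n t.
  by move=> n; have [g ? ?] := mf n; exists g.
pose D := \bigcup_(p in [set: nat * nat]) range (f_ p.1 p.2).
have cD : countable D.
  apply: bigcup_countable => // p _.
  by apply: finite_set_countable; exact: ((hf p.1).1 p.2).1.
have [y [_ yD]] : exists y : nat -> V, (forall n, D (y n)) /\ D `<=` range y.
  apply: countable_enum => //; exists (f_ 0%N 0%N point).
  by exists (0%N, 0%N) => //; exists point.
exists y => n t e e0.
have /cvgrPdist_lt/(_ e e0)[m _ hm] := (hf n).2 t.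
have [j _ hj] : range y (f_ n m t).
  by apply: yD; exists (n, m) => //; exists t.
by exists j; rewrite hj; apply: hm => /=.
Qed.

Lemma smeas_dist (V : normedModType R) (f : T -> V) (v : V) :
  smeas f -> measurable_fun setT (fun t => `|f t - v|).
Proof.
by move=> mf; apply: smeas_measurable_norm; apply: smeasB => //; exact: smeas_cst.
Qed.

(** The range of the limit is in the closure of a countable set that serves all
    the [f_ n], and its distances to points are limits of measurable functions. *)
Lemma smeas_cvg (V : normedModType R) (f_ : nat -> T -> V) (f : T -> V) :
  (forall n, smeas (f_ n)) -> (forall t, f_ n t @[n --> \oo] --> f t) -> smeas f.
Proof.
move=> mf cf; have [y hy] := smeas_separable_seq mf.
apply: (@nearest_point_smeas _ f y) => [t e e0|j].
  have e20 : 0 < e / 2 by rewrite divr_gt0.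
  have /cvgrPdist_lt/(_ _ e20)[n _ /(_ n (leqnn n)) hn] := cf t.
  have [j hj] := hy n t _ e20; exists j.
  rewrite -(subrK (f_ n t) (f t)) -addrA (splitr e).
  by apply: le_lt_trans (ler_normD _ _) _; exact: ltrD.
apply: (@measurable_fun_cvg _ _ _ _ (fun n t => `|f_ n t - y j|)) => [n|t _].
  exact: smeas_dist.
by apply: cvg_norm; apply: cvgB => //; exact: cvg_cst.
Qed.

Lemma measurable_smeas (f : T -> R) :
  measurable_fun setT f -> smeas (f : T -> R^o).
Proof.
move=> mf; pose y n : R^o := if @unpickle rat n is Some q then ratr q else 0.
apply: (@nearest_point_smeas _ _ y) => [t e e0|j].
  have [q hq] := ratr_approx (f t) e0.
  by exists (pickle q); rewrite /y pickleK.
apply: measurableT_comp => //; exact: measurable_funB.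
Qed.

(** Once 0 is among the candidates for the nearest point, the error is at most
    the norm of [f]. *)
Lemma smeas_dominated_approx (V : normedModType R) (f : T -> V) (y : nat -> V) :
  smeas f -> (forall t (e : R), 0 < e -> exists j, `|f t - y j| < e) ->
  (exists j, y j = 0) ->
  exists s : nat -> T -> nat, exists m0 : nat, [/\ forall n, selector n (s n),
    forall t, `|f t - y (s n t)| @[n --> \oo] --> (0 : R) &
    forall n t, (m0 <= n)%N -> `|f t - y (s n t)| <= `|f t|].
Proof.
move=> mf dy [j0 yj0].
have [s [h1 h2 h3]] := nearest_point_approx dy (fun j => smeas_dist (y j) mf).
exists s, j0; split=> // [t|n t jn].
  have := cvg_norm (cvgB (cvg_cst (f t)) (h2 t)); rewrite subrr normr0; exact.
by have := h3 n _ t jn; rewrite yj0 subr0.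
Qed.

End strong_measurability_real.

(** * Function norms and the spaces that they define *)

Section function_norms.
Context d (T : measurableType d) (R : realType).
Variable mu : {finite_measure set T -> \bar R}.

(** The properties of a mixed norm that matter for weak compactness: it is a
    norm on nonnegative measurable functions, stronger than the norm of [L^1],
    with dominated and monotone convergence. *)
Record function_norm (rho : (T -> R) -> \bar R) : Prop := FunctionNorm {
  fn_ge0 : forall f, (0 <= rho f)%E;
  fn_le : forall f g : T -> R, measurable_fun setT f -> measurable_fun setT g ->
    {ae mu, forall t, (0 <= f t <= g t)%R} -> (rho f <= rho g)%E;
  fnD : forall f g : T -> R, measurable_fun setT f -> measurable_fun setT g ->
    (forall t, 0 <= f t) -> (forall t, 0 <= g t) ->
    (rho (fun t => f t + g t)%R <= rho f + rho g)%E;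
  fnZ : forall (c : R) (f : T -> R), 0 <= c -> measurable_fun setT f -> (forall t, 0 <= f t) ->
    (rho (fun t => c * f t)%R = c%:E * rho f)%E;
  fn_one : (rho (fun=> 1%R) < +oo)%E;
  fn_int : exists2 c : R, 0 < c & forall f : T -> R, measurable_fun setT f ->
    (forall t, 0 <= f t) -> (\int[mu]_t (f t)%:E <= c%:E * rho f)%E;
  fn_dominated : forall (f_ : nat -> T -> R) (g : T -> R),
    (forall n, measurable_fun setT (f_ n)) -> measurable_fun setT g ->
    (forall n t, 0 <= f_ n t <= g t) -> (rho g < +oo)%E ->
    (forall t, f_ n t @[n --> \oo] --> (0 : R)) ->
    rho (f_ n) @[n --> \oo] --> 0%E;
  fn_monotone : forall (f_ : nat -> T -> R) (f : T -> R) (C : R),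
    (forall n, measurable_fun setT (f_ n)) -> measurable_fun setT f ->
    (forall n t, 0 <= f_ n t) ->
    (forall t, {homo f_ ^~ t : n m / (n <= m)%N >-> n <= m}) ->
    (forall t, f_ n t @[n --> \oo] --> f t) ->
    (forall n, (rho (f_ n) <= C%:E)%E) -> (rho f <= C%:E)%E }.

(** A quantitative form of the order continuity of the dual norm: two disjoint
    pieces of norm at most 1 have a sum of norm bounded by a constant smaller
    than 2. *)
Definition disjointly_smooth (rho : (T -> R) -> \bar R) : Prop :=
  exists2 kappa : R, kappa < 2 & forall f g : T -> R,
    measurable_fun setT f -> measurable_fun setT g ->
    (forall t, 0 <= f t) -> (forall t, 0 <= g t) ->
    (forall t, f t = 0 \/ g t = 0) -> (rho f <= 1)%E -> (rho g <= 1)%E ->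
    (rho (fun t => f t + g t)%R <= kappa%:E)%E.

Section theory.
Variables (rho : (T -> R) -> \bar R).

Definition fspace (V : normedModType R) : set (T -> V) :=
  [set f | smeas f /\ (rho (fun t => `|f t|%R) < +oo)%E].

Definition fnorm (V : normedModType R) (f : T -> V) : R :=
  fine (rho (fun t => `|f t|)).

Definition bounded_functional (V : normedModType R) (l : (T -> V) -> R^o) : Prop :=
  linear_on (@fspace V) l /\
  exists2 C, 0 <= C & forall f, fspace f -> `|l f| <= C * fnorm f.

Hypothesis hrho : function_norm rho.

Lemma fspace_fnormE (V : normedModType R) (f : T -> V) : fspace f ->
  rho (fun t => `|f t|) = (fnorm f)%:E.
Proof. by move=> [_ h]; rewrite fineK// ge0_fin_numE// (fn_ge0 hrho). Qed.

Lemma fnorm_ge0 (V : normedModType R) (f : T -> V) : 0 <= fnorm f.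
Proof. by rewrite fine_ge0// (fn_ge0 hrho). Qed.

Lemma fnorm_le (V : normedModType R) (f : T -> V) c :
  (rho (fun t => `|f t|%R) <= c%:E)%E -> fnorm f <= c.
Proof.
move=> h; rewrite -lee_fin fineK// ge0_fin_numE ?(fn_ge0 hrho)//.
by apply: le_lt_trans h _; exact: ltry.
Qed.

Lemma fspace_le_ae (U V : normedModType R) (f : T -> U) (g : T -> V) :
  smeas f -> fspace g -> {ae mu, forall t, `|f t| <= `|g t|} ->
  fspace f /\ fnorm f <= fnorm g.
Proof.
move=> mf hg fg.
have h : (rho (fun t => `|f t|%R) <= rho (fun t => `|g t|%R))%E.
  apply: (fn_le hrho); [exact: smeas_measurable_norm|
    exact: (smeas_measurable_norm hg.1)|].
  by apply: filterS fg => t ->; rewrite normr_ge0.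
split; first by split => //; apply: le_lt_trans h hg.2.
by apply: fnorm_le; rewrite -(fspace_fnormE hg).
Qed.

Lemma fspace_le (U V : normedModType R) (f : T -> U) (g : T -> V) :
  smeas f -> fspace g -> (forall t, `|f t| <= `|g t|) ->
  fspace f /\ fnorm f <= fnorm g.
Proof. by move=> mf hg fg; apply: fspace_le_ae => //; exact: aeW. Qed.

Lemma fspaceD (V : normedModType R) (f g : T -> V) : fspace f -> fspace g ->
  fspace (fun t => f t + g t) /\ fnorm (fun t => f t + g t) <= fnorm f + fnorm g.
Proof.
move=> hf hg; have mfg := smeasD hf.1 hg.1.
have mf := smeas_measurable_norm hf.1; have mg := smeas_measurable_norm hg.1.
have h : (rho (fun t => `|f t + g t|%R) <= (fnorm f + fnorm g)%:E)%E.
  rewrite EFinD -!fspace_fnormE//.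
  apply: le_trans (fnD hrho mf mg _ _) => //.
  apply: (fn_le hrho); [exact: smeas_measurable_norm|exact: measurable_funD|].
  by apply: aeW => t; rewrite normr_ge0 ler_normD.
split; first by split => //; apply: le_lt_trans h (ltry _).
exact: fnorm_le.
Qed.

Lemma fspaceZ (V : normedModType R) a (f : T -> V) : fspace f ->
  fspace (fun t => a *: f t) /\ fnorm (fun t => a *: f t) = `|a| * fnorm f.
Proof.
move=> hf.
have h : rho (fun t => `|a *: f t|) = (`|a| * fnorm f)%:E.
  under [in LHS]eq_fun do rewrite normrZ.
  rewrite (fnZ hrho) ?normr_ge0 ?fspace_fnormE ?EFinM//.
  exact: (smeas_measurable_norm hf.1).
split; first by split; [exact: smeas_scale hf.1|rewrite h ltry].
by rewrite /fnorm h.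
Qed.

Lemma fspace0 (V : normedModType R) : @fspace V (fun=> 0).
Proof.
split; first exact: smeas_cst.
apply: le_lt_trans (fn_one hrho); apply: (fn_le hrho) => //.
by apply: aeW => t; rewrite normr0 lexx ler01.
Qed.

Lemma fspace_subspace (V : normedModType R) : subspace_pred (@fspace V).
Proof.
split=> [|a f g hf hg]; first exact: fspace0.
exact: (fspaceD (fspaceZ a hf).1 hg).1.
Qed.

Lemma fnorm_seminorm (V : normedModType R) : seminorm_on (@fspace V) (@fnorm V).
Proof. by split=> [f g hf hg|a f hf]; [exact: (fspaceD hf hg).2|exact: (fspaceZ a hf).2]. Qed.

Lemma fspaceB (V : normedModType R) (f g : T -> V) : fspace f -> fspace g ->
  fspace (fun t => f t - g t) /\ fnorm (fun t => f t - g t) <= fnorm f + fnorm g.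
Proof.
move=> hf hg; split.
  exact: (subspace_predB (@fspace_subspace V) hf hg).
exact: (seminormB (@fspace_subspace V) (@fnorm_seminorm V) hf hg).
Qed.

Lemma fspace_cst (V : normedModType R) (v : V) : fspace (fun=> v).
Proof.
split; first exact: smeas_cst.
have -> : (fun t : T => `|v|) = (fun t : T => `|v| * (fun=> 1 : R) t).
  by apply/funext => t; rewrite mulr1.
rewrite (fnZ hrho)//.
by rewrite lte_mul_pinfty ?lee_fin//; exact: (fn_one hrho).
Qed.

Lemma fspace_bounded (V : normedModType R) (f : T -> V) (c : R) : smeas f ->
  (forall t, `|f t| <= c) ->
  fspace f /\ fnorm f <= c * fnorm (fun=> 1 : R^o).
Proof.
move=> mf fc; have c0 : 0 <= c by apply: le_trans (fc point).
have [h1 h2] := fspaceZ c (fspace_cst (1 : R^o)).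
have [] := @fspace_le V _ f _ mf h1.
  by move=> t; apply: le_trans (fc t) _; rewrite normrZ normr1 mulr1 ler_norm.
by rewrite h2 ger0_norm.
Qed.

Lemma cutoff_le (V : normedModType R) A (f : T -> V) t : `|cutoff A f t| <= `|f t|.
Proof.
rewrite /cutoff normrZ indicE; case: (t \in A); rewrite ?normr1 ?mul1r//.
by rewrite normr0 mul0r.
Qed.

Lemma fspace_cutoff (V : normedModType R) A (f : T -> V) : measurable A ->
  fspace f -> fspace (cutoff A f) /\ fnorm (cutoff A f) <= fnorm f.
Proof.
by move=> mA hf; apply: fspace_le => //;
  [exact: smeas_cutoff hf.1|exact: cutoff_le].
Qed.

Lemma fspace_L1 : exists2 c : R, 0 < c & forall (V : normedModType R) (f : T -> V),
  fspace f -> mu.-integrable setT (fun t => (`|f t|)%:E) /\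
    \int[mu]_t `|f t| <= c * fnorm f.
Proof.
have [c c0 hc] := fn_int hrho; exists c => // V f hf.
have mf := smeas_measurable_norm hf.1.
have h := hc _ mf (fun t => normr_ge0 (f t)).
rewrite fspace_fnormE// -EFinM in h.
split.
  apply/integrableP; split; first exact/measurable_EFinP.
  under eq_integral do rewrite /= normr_id.
  by apply: le_lt_trans h (ltry _).
rewrite /Rintegral -lee_fin fineK// ge0_fin_numE.
  by apply: le_lt_trans h (ltry _).
by apply: integral_ge0 => t _; rewrite lee_fin.
Qed.

Lemma fnorm0_ae (V : normedModType R) (f : T -> V) : fspace f -> fnorm f = 0 ->
  {ae mu, forall t, f t = 0}.
Proof.
move=> hf f0; have [c _ hc] := fn_int hrho.
have mf := smeas_measurable_norm hf.1.
have h := hc _ mf (fun t => normr_ge0 (f t)).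
rewrite fspace_fnormE// f0 mule0 in h.
have me : measurable_fun setT (fun t => (`|f t|)%:E) by exact/measurable_EFinP.
have [+ _] := ae_eq_integral_abs mu measurableT me.
have -> : (\int[mu]_x `|(`|f x|)%:E| = 0)%E.
  apply/eqP; rewrite eq_le; apply/andP; split.
    by under eq_integral do rewrite /= normr_id.
  by apply: integral_ge0 => t _; exact: abse_ge0.
move=> /(_ erefl); apply: filterS => t /(_ I) /eqP.
by rewrite eqe normr_eq0 => /eqP.
Qed.

Lemma ae_fnorm0 (V : normedModType R) (f : T -> V) : smeas f ->
  {ae mu, forall t, f t = 0} -> fspace f /\ fnorm f = 0.
Proof.
move=> mf f0; have [h1 h2] : fspace f /\ fnorm f <= fnorm (fun=> 0 : V).
  by apply: fspace_le_ae => //; [exact: fspace0|apply: filterS f0 => t ->].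
split=> //; apply/eqP; rewrite eq_le fnorm_ge0 andbT.
by rewrite (seminorm0 (@fspace_subspace V) (@fnorm_seminorm V)) in h2.
Qed.

Lemma ae_fspace (V : normedModType R) (f g : T -> V) : fspace f -> smeas g ->
  {ae mu, forall t, f t = g t} ->
  [/\ fspace g, fnorm g = fnorm f & fnorm (fun t => f t - g t) = 0].
Proof.
move=> hf mg fg.
have [hg gf] : fspace g /\ fnorm g <= fnorm f.
  by apply: fspace_le_ae => //; apply: filterS fg => t ->.
split=> //.
  apply/eqP; rewrite eq_le gf/=.
  by apply: (fspace_le_ae hf.1 hg _).2; apply: filterS fg => t ->.
apply: (ae_fnorm0 _ _).2; first exact: (smeasB hf.1 mg).
by apply: filterS fg => t ->; rewrite subrr.
Qed.

Lemma functional_ae (V : normedModType R) (l : (T -> V) -> R^o) f g :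
  bounded_functional l -> fspace f -> smeas g ->
  {ae mu, forall t, f t = g t} -> l f = l g.
Proof.
move=> [ll [C C0 lC]] hf mg fg; have [hg _ h0] := ae_fspace hf mg fg.
have hfg := subspace_predB (@fspace_subspace V) hf hg.
have := lC _ hfg; rewrite [fnorm _]h0 mulr0 normr_le0.
by rewrite (linear_onB (@fspace_subspace V) ll)// subr_eq0 => /eqP.
Qed.

Lemma fnorm_dominated (V : normedModType R) (f_ : nat -> T -> V) (g : T -> V) :
  (forall n, smeas (f_ n)) -> fspace g ->
  (forall n t, `|f_ n t| <= `|g t|) ->
  (forall t, `|f_ n t| @[n --> \oo] --> (0 : R)) ->
  fnorm (f_ n) @[n --> \oo] --> (0 : R).
Proof.
move=> mf hg fg f0.
have := @fn_dominated _ hrho (fun n t => `|f_ n t|) (fun t => `|g t|).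
move=> /(_ (fun n => smeas_measurable_norm (mf n)) (smeas_measurable_norm hg.1)).
move=> /(_ _ hg.2 f0) h; apply: (fine_cvg (h _)) => n t.
by rewrite normr_ge0 fg.
Qed.

Lemma cvg_real_lt (u : nat -> R) (e : R) : u n @[n --> \oo] --> (0 : R) -> 0 < e ->
  exists N, forall n, (N <= n)%N -> `|u n| < e.
Proof.
move=> /cvgrPdist_lt/(_ e) h /h [N _ hN]; exists N => n Nn.
by have := hN n Nn; rewrite sub0r normrN.
Qed.

(** If it failed, there would be sets [A n] of measure less than [2 ^- n.+1] on
    which [f] keeps a norm at least [e]; as almost every point belongs to finitely
    many of them only, this contradicts dominated convergence. *)
Lemma fnorm_abs_cont (V : normedModType R) (f : T -> V) (e : R) : fspace f ->
  0 < e -> exists2 dl : R, 0 < dl & forall A, measurable A -> (mu A < dl%:E)%E ->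
    fnorm (cutoff A f) < e.
Proof.
move=> hf e0; apply: contrapT => hn.
have /choice[A hA] : forall n, exists A, [/\ measurable A,
    (mu A < (1 / (2 ^ n.+1)%:R)%:E)%E & e <= fnorm (cutoff A f)].
  move=> n; apply: contrapT => hA; apply: hn.
  exists (1 / (2 ^ n.+1)%:R); first by rewrite divr_gt0// ltr0n expn_gt0.
  by move=> A mA muA; rewrite ltNge; apply/negP => hle; apply: hA; exists A.
have mA n : measurable (A n) by have [] := hA n.
pose B := lim_sup_set A.
have mB : measurable B.
  by apply: bigcap_measurable => // n _; apply: bigcup_measurable => k _.
have B0 : mu B = 0%E.
  apply: lim_sup_set_cvg0 => //.
  apply: (@le_lt_trans _ _ (\sum_(n <oo) (1 / (2 ^ n.+1)%:R)%:E)%E).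
    by apply: lee_nneseries => n *; [exact: measure_ge0|have [_ /ltW] := hA n].
  apply: le_lt_trans (epsilon_trick0 xpredT (@ler01 R)) _; exact: ltry.
pose g n := cutoff (A n `\` B) f.
have mg n : smeas (g n) by apply: smeas_cutoff hf.1; exact: measurableD.
have g0 t : `|g n t| @[n --> \oo] --> (0 : R).
  apply/cvgrPdist_lt => eps eps0.
  have [Bt|nBt] := pselect (B t).
    exists 0%N => // n _; rewrite sub0r normrN /g /cutoff indicE.
    have -> : (t \in A n `\` B) = false by apply/negbTE/negP => /set_mem [].
    by rewrite scale0r normr0 normr0.
  have [N hN] : exists N, forall n, (N <= n)%N -> ~ A n t.
    apply: contrapT => h; apply: nBt => N _; apply: contrapT => h2.
    by apply: h; exists N => n Nn An; apply: h2; exists n.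
  exists N => // n /= Nn; rewrite sub0r normrN /g /cutoff indicE.
  have -> : (t \in A n `\` B) = false by apply/negbTE/negP => /set_mem [/(hN _ Nn)].
  by rewrite scale0r normr0 normr0.
have /cvg_real_lt/(_ e0)[N hN] :=
  fnorm_dominated mg hf (fun n t => cutoff_le _ _ _) g0.
have [_ _] := hA N; apply/negP; rewrite -ltNge.
have [_ -> _] : [/\ fspace (cutoff (A N) f), fnorm (cutoff (A N) f) = fnorm (g N) &
    fnorm (fun t => g N t - cutoff (A N) f t) = 0].
  apply: ae_fspace; [|exact: smeas_cutoff hf.1|].
    by apply: (fspace_cutoff _ hf).1; exact: measurableD.
  exists B; split => // t /= h; apply: contrapT => nBt; apply: h.
  rewrite /g /cutoff !indicE; congr (_%:R *: _).
  have [At|nAt] := pselect (A N t); first by rewrite !mem_set.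
  by rewrite !memNset// => -[].
by have := hN N (leqnn N); apply: le_lt_trans; exact: ler_norm.
Qed.

Lemma fspace_norming (V : normedModType R) (f : T -> V) : fspace f ->
  exists l : (T -> V) -> R^o, [/\ bounded_functional l,
    forall g, fspace g -> `|l g| <= fnorm g & l f = fnorm f].
Proof.
move=> hf; have hE := @fspace_subspace V; have hs := @fnorm_seminorm V.
have [l [ll ls lf]] := seminorm_norming hE hs hf.
exists l; split=> //; split=> //; exists 1 => // g hg.
by rewrite mul1r; exact: ls.
Qed.

Lemma functional_cutoff (V : normedModType R) (l : (T -> V) -> R^o) A :
  measurable A -> bounded_functional l -> bounded_functional (l \o cutoff A).
Proof.
move=> mA [ll [C C0 lC]]; split=> [a f g hf hg /=|].
  have -> : cutoff A (a *: f + g) = a *: cutoff A f + cutoff A g.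
    apply/funext => t; rewrite /cutoff [LHS]scalerDr.
    by congr (_ + _); rewrite [LHS]scalerA mulrC -scalerA.
  by rewrite ll//; [exact: (fspace_cutoff mA hf).1|exact: (fspace_cutoff mA hg).1].
exists C => // f hf /=; have [h1 h2] := fspace_cutoff mA hf.
by apply: le_trans (lC _ h1) _; rewrite ler_wpM2l.
Qed.

(** Dominated convergence applied to the nearest point approximations. *)
Lemma dense_approx (V : normedModType R) (f : T -> V) (y : nat -> V) :
  fspace f -> (forall t (e : R), 0 < e -> exists j, `|f t - y j| < e) ->
  (exists j, y j = 0) ->
  exists s : nat -> T -> nat, [/\ forall n, selector n (s n),
    forall n, fspace (fun t => y (s n t)),
    forall t, `|f t - y (s n t)| @[n --> \oo] --> (0 : R) &
    fnorm (fun t => f t - y (s n t)) @[n --> \oo] --> (0 : R)].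
Proof.
move=> hf dy y0; have [s [m0 [h1 h2 h3]]] := smeas_dominated_approx hf.1 dy y0.
have ms n : smeas (fun t => y (s n t)).
  exact/smeas_simple/(simple_map_comp y (selector_simple (h1 n))).
exists s; split=> // [n|].
  have yb : exists c, forall t, `|y (s n t)| <= c.
    exists (\sum_(j < n.+1) `|y j|) => t.
    have jn : (s n t < n.+1)%N by rewrite ltnS; exact: (h1 n).1.
    rewrite (bigD1 (Ordinal jn))//= lerDl; exact: sumr_ge0.
  by have [c yc] := yb; exact: (fspace_bounded (ms n) yc).1.
(* The domination by the norm of [f] holds from the index [m0] on. *)
have := @fnorm_dominated V (fun n t => f t - y (s (n + m0)%N t)) f.
move=> /(_ (fun n => smeasB hf.1 (ms _)) hf) h.
rewrite -(cvg_shiftn m0); apply: h => [n t|t]; first exact/h3/leq_addl.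
by rewrite (cvg_shiftn m0 (fun n => `|f t - y (s n t)|)).
Qed.

End theory.
End function_norms.

(** * Pointwise kernels of bounded families of functions *)

Section integral_tools.
Context d (T : measurableType d) (R : realType).
Variable mu : {finite_measure set T -> \bar R}.

Definition integrable_fun (g : T -> R) : Prop := mu.-integrable setT (EFin \o g).

Lemma measurable_le_set (g h : T -> R) : measurable_fun setT g ->
  measurable_fun setT h -> measurable [set t | g t <= h t].
Proof.
by move=> mg mh; have := measurable_fun_le measurableT mg mh; rewrite setTI.
Qed.

Lemma integrable_fun_on A g : measurable A -> integrable_fun g ->
  mu.-integrable A (EFin \o g).
Proof. by move=> mA; exact: integrableS. Qed.

Lemma integrable_fun_le (g h : T -> R) : measurable_fun setT g ->
  integrable_fun h -> (forall t, `|g t| <= h t) -> integrable_fun g.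
Proof.
move=> mg ih gh; apply: le_integrable ih => //; first exact/measurable_EFinP.
move=> t _ /=; rewrite lee_fin; apply: le_trans (gh t) _; exact: ler_norm.
Qed.

Lemma integral_ge0_fin (g : T -> R) A : measurable A -> integrable_fun g ->
  (\int[mu]_(t in A) (g t)%:E)%E = (\int[mu]_(t in A) g t)%:E.
Proof.
move=> mA ig; rewrite /Rintegral fineK//.
exact: integrable_fin_num (integrable_fun_on mA ig).
Qed.

Lemma Rintegral_norm_le (g h : T -> R) A : measurable A -> integrable_fun g ->
  integrable_fun h -> (forall t, A t -> `|g t| <= h t) ->
  `|\int[mu]_(t in A) g t| <= \int[mu]_(t in A) h t.
Proof.
move=> mA ig ih gh.
apply: le_trans (le_normr_Rintegral mA (integrable_fun_on mA ig)) _.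
apply: le_Rintegral => //; [|exact: integrable_fun_on].
by apply: (integrable_fun_on mA); exact: integrable_norm.
Qed.

Lemma Rintegral_subset_le (h : T -> R) A : measurable A -> integrable_fun h ->
  (forall t, 0 <= h t) -> \int[mu]_(t in A) h t <= \int[mu]_t h t.
Proof.
move=> mA ih h0; rewrite -lee_fin -!integral_ge0_fin//.
apply: ge0_subset_integral => //; first exact: (measurable_int mu).
by move=> t _; rewrite lee_fin.
Qed.

Lemma Rintegral_disjointU (g : T -> R) A B : measurable A -> measurable B ->
  integrable_fun g -> A `&` B = set0 ->
  \int[mu]_(t in A `|` B) g t = \int[mu]_(t in A) g t + \int[mu]_(t in B) g t.
Proof.
move=> mA mB ig AB; apply: Rintegral_setU => //.
  by apply: integrable_fun_on => //; exact: measurableU.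
by apply/disj_setPS; rewrite AB.
Qed.

Lemma Rintegral_selector m s (g : T -> R) A : selector m s -> measurable A ->
  integrable_fun g ->
  \int[mu]_(t in A) g t =
  \sum_(j < m.+1) \int[mu]_(t in A `&` s @^-1` [set val j]) g t.
Proof.
move=> [sm ms] mA ig.
pose F j := A `&` s @^-1` [set j].
have mF j : measurable (F j) by exact: measurableI.
have key n : \int[mu]_(t in \big[setU/set0]_(j < n) F (val j)) g t =
    \sum_(j < n) \int[mu]_(t in F (val j)) g t.
  elim: n => [|n IH]; first by rewrite !big_ord0 Rintegral_set0.
  rewrite !big_ord_recr/= Rintegral_disjointU ?IH//.
    exact: bigsetU_measurable.
  rewrite -subset0 => t [+ Ft]; rewrite -bigcup_mkord => -[j /= jn Fj].
  by move: jn; rewrite -(Fj.2 : s t = j) -(Ft.2 : s t = n) ltnn.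
rewrite -key; congr (Rintegral _ _ _); apply/seteqP; split=> t.
  by move=> At; rewrite -bigcup_mkord; exists (s t) => //=; rewrite ltnS.
by rewrite -bigcup_mkord => -[j _ []].
Qed.

Lemma ae_forall_countable (I : countType) (P : I -> T -> Prop) :
  (forall i, {ae mu, forall t, P i t}) -> {ae mu, forall t, forall i, P i t}.
Proof.
move=> h.
have : {ae mu, forall t, forall n,
    if @unpickle I n is Some i then P i t else True}.
  by apply: ae_foralln => n; case: unpickle => [i|]; [exact: h|exact: aeW].
by apply: filterS => t ht i; have := ht (pickle i); rewrite pickleK.
Qed.

Lemma Rintegral_ae_eq (f g : T -> R) : integrable_fun f -> integrable_fun g ->
  (forall A, measurable A -> \int[mu]_(t in A) f t = \int[mu]_(t in A) g t) ->
  {ae mu, forall t, f t = g t}.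
Proof.
move=> fi gi fg.
have : ae_eq mu setT (EFin \o f) (EFin \o g).
  apply: integral_ae_eq => //; first exact: (measurable_int mu).
  move=> A _ mA; rewrite [LHS]integral_ge0_fin// [RHS]integral_ge0_fin//.
  by rewrite fg.
by apply: filterS => t /(_ I) [].
Qed.

Section radon_nikodym.
Variable lam : set T -> R.
Hypothesis lamU : forall A B, measurable A -> measurable B -> A `&` B = set0 ->
  lam (A `|` B) = lam A + lam B.
Hypothesis lam_ac : forall e : R, 0 < e -> exists2 dl : R, 0 < dl &
  forall A, measurable A -> (mu A < dl%:E)%E -> `|lam A| <= e.

Definition efin_setfun (A : set T) : \bar R := (lam A)%:E.

Let lam0 : lam set0 = 0.
Proof. by have := lamU measurable0 measurable0 (setI0 _); rewrite setU0; lra. Qed.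

Let efin_setfun0 : efin_setfun set0 = 0%E.
Proof. by rewrite /efin_setfun lam0. Qed.

Let efin_setfun_fin A : measurable A -> efin_setfun A \is a fin_num.
Proof. by []. Qed.

(** The tail of a disjoint sequence has a measure that tends to 0, so that finite
    additivity and absolute continuity give countable additivity. *)
Let efin_setfun_sigma : semi_sigma_additive efin_setfun.
Proof.
move=> F mF tF mUF.
have mU n : measurable (\bigcup_(k >= n) F k) by exact: bigcup_measurable.
have sumE n : (\sum_(0 <= i < n) efin_setfun (F i))%E =
    (lam (\bigcup_k F k) - lam (\bigcup_(k >= n) F k))%:E.
  elim: n => [|n IH].
    rewrite big_geq//; congr (_%:E); apply/esym/eqP; rewrite subr_eq0.
    by apply/eqP; congr lam; apply: eq_bigcup => //; apply/seteqP; split.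
  rewrite big_nat_recr//= IH /efin_setfun -EFinD; congr (_%:E).
  have -> : \bigcup_(k >= n) F k = F n `|` \bigcup_(k >= n.+1) F k.
    apply/seteqP; split=> [t [k /= + Fk]|t [Fn|[k /= nk Fk]]].
    - by rewrite leq_eqVlt => /predU1P[->|nk]; [left|right; exists k].
    - by exists n => /=.
    - by exists k => //=; exact: ltnW.
  rewrite lamU//; first by ring.
  rewrite -subset0 => t [Fn [k /= nk Fk]].
  have E := tF n k I I (ex_intro _ t (conj Fn Fk)).
  by move: nk; rewrite /= E ltnn.
under eq_fun do rewrite sumE.
apply: cvg_EFin; first by exact: nearW.
rewrite -[X in _ --> X]subr0; apply: cvgB; first exact: cvg_cst.
have mu0 : mu (\bigcup_(k >= n) F k) @[n --> \oo] --> 0%E.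
  have -> : 0%E = mu (lim_sup_set F).
    rewrite [X in mu X](_ : _ = set0) ?measure0//.
    rewrite -subset0 => t ht; have [k _ Fk] := ht 0%N I.
    have [j /= kj Fj] := ht k.+1 I.
    have E := tF k j I I (ex_intro _ t (conj Fk Fj)).
    by move: kj; rewrite E ltnn.
  apply: lim_sup_set_cvg => //.
  by rewrite ltey_eq fin_num_measure//; exact: mU.
apply/cvgrPdist_le => e e0; have [dl dl0 hdl] := lam_ac e0.
have dlE : (0 < dl%:E)%E by rewrite lte_fin.
have : \forall n \near \oo, (mu (\bigcup_(k >= n) F k) < dl%:E)%E.
  by apply: (mu0 [set x | (x < dl%:E)%E]); exact: nbhs_open_ereal_lt.
apply: filterS => n hn; rewrite sub0r normrN; exact: hdl.
Qed.

HB.instance Definition _ := isCharge.Build _ _ _ efin_setfun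
  efin_setfun0 efin_setfun_fin efin_setfun_sigma.

Lemma abs_cont_density : exists2 h : T -> R, integrable_fun h &
  forall A, measurable A -> lam A = \int[mu]_(t in A) h t.
Proof.
have dom : efin_setfun `<< mu.
  apply/null_content_dominatesP => A mA A0; rewrite /efin_setfun.
  apply/eqP; rewrite eqe -normr_le0; apply/ler_addgt0Pr => e e0; rewrite add0r.
  by have [dl dl0 hdl] := lam_ac e0; apply: hdl => //; rewrite A0 lte_fin.
have hi := Radon_Nikodym_integrable dom.
have E : EFin \o (fine \o Radon_Nikodym efin_setfun mu) = Radon_Nikodym efin_setfun mu.
  by apply/funext => t /=; rewrite fineK// Radon_Nikodym_fin_num.
exists (fine \o Radon_Nikodym efin_setfun mu); first by rewrite /integrable_fun E.
move=> A mA; apply/eqP; rewrite -eqe -integral_ge0_fin//; last by rewrite /integrable_fun E.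
apply/eqP; apply: etrans (Radon_Nikodym_integral dom mA) _.
by apply: eq_integral => t _; rewrite -[in LHS]E.
Qed.

End radon_nikodym.

(** The maximum of [g 0, ..., g m] is itself a measurable selection, so that the
    integrals of the positive parts of these maxima are bounded; by monotone
    convergence so is the integral of their limit. *)
Lemma ae_bounded_of_selectors (g : nat -> T -> R) (C : R) :
  (forall j, measurable_fun setT (g j)) ->
  (forall m s A, selector m s -> measurable A ->
    (forall t, A t -> 0 <= g (s t) t) -> measurable_fun setT (fun t => g (s t) t) ->
    (\int[mu]_(t in A) (g (s t) t)%:E <= C%:E)%E) ->
  {ae mu, forall t, exists c, forall j, g j t <= c}.
Proof.
move=> mg hC.
have /choice[s hs] : forall m, exists s, [/\ selector m s,
    measurable_fun setT (fun t => g (s t) t) &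
    forall j t, (j <= m)%N -> g j t <= g (s t) t].
  by move=> m; exact: argmax_selector.
pose M m t : \bar R := (Num.max 0 (g (s m t) t))%:E.
have mM m : measurable_fun setT (M m).
  apply/measurable_EFinP.
  rewrite [X in measurable_fun _ X](_ : _ = cst 0 \max (fun t => g (s m t) t))//.
  by apply: measurable_maxr => //; have [] := hs m.
have M0 m t : setT t -> (0 <= M m t)%E by rewrite /M lee_fin le_max lexx.
have ndM t : setT t -> {homo M ^~ t : n m / (n <= m)%N >-> (n <= m)%E}.
  move=> _ n m nm; rewrite /M lee_fin ge_max le_max lexx/=.
  rewrite le_max; apply/orP; right; have [_ _ h] := hs m; apply: h.
  by apply: leq_trans nm; have [[sn _] _ _] := hs n; exact: sn.
have IM m : (\int[mu]_t M m t <= C%:E)%E.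
  have [ss ms hm] := hs m; pose A := [set t | 0 <= g (s m t) t].
  have mA : measurable A.
    exact: measurable_le_set.
  apply: le_trans (hC m (s m) A ss mA _ ms) => //.
  rewrite [leRHS]integral_mkcond; apply: ge0_le_integral => //.
  - by move=> t; exact: M0.
  - apply/(measurable_restrictT _ mA)/measurable_EFinP.
    exact: measurable_funS ms.
  - move=> t _; rewrite /patch /M; case: ifPn => [/set_mem At|/negP At].
      by rewrite lee_fin ge_max lexx andbT.
    rewrite lee_fin ge_max lexx/= leNgt; apply/negP => h; apply: At.
    by apply/mem_set; exact: ltW.
have Ilim : (\int[mu]_t limn (M ^~ t) <= C%:E)%E.
  rewrite (monotone_convergence mu measurableT mM M0 ndM).
  apply: lime_le; last exact: nearW.
  apply: ereal_nondecreasing_is_cvgn => n m nm; apply: ge0_le_integral => // t _.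
    exact: M0.
  exact: ndM.
have mlim : measurable_fun setT (fun t => limn (M ^~ t)).
  apply: (emeasurable_fun_cvg _ _ mM) => t _.
  by apply: ereal_nondecreasing_is_cvgn => n m nm; exact: ndM.
have lim0 t : (0 <= limn (M ^~ t))%E.
  apply: lime_ge; last by apply: nearW => n; exact: M0.
  by apply: ereal_nondecreasing_is_cvgn => n m nm; exact: ndM.
have : mu.-integrable setT (fun t => limn (M ^~ t)).
  apply/integrableP; split=> //.
  under eq_integral do rewrite gee0_abs//.
  by apply: le_lt_trans Ilim (ltry _).
move=> /(integrable_ae measurableT); apply: filterS => t /(_ I) hfin.
exists (fine (limn (M ^~ t))) => j.
rewrite -lee_fin fineK//; apply: (@le_trans _ _ (M j t)).
  by rewrite /M lee_fin le_max; apply/orP; right; have [_ _ h] := hs j; exact: h.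
have /cvg_lim -> // := ereal_nondecreasing_cvgn (ndM t I).
by apply: ereal_sup_ubound; exists j.
Qed.

End integral_tools.

(** Completeness in terms of sequences, the form in which it transfers between
    the real and the complex structures of a space. *)
Definition seq_complete (R : realType) (V : normedModType R) : Prop :=
  forall u : nat -> V,
    (forall e : R, 0 < e -> exists N, forall n m, (N <= n)%N -> (N <= m)%N ->
       `|u n - u m| < e) ->
    exists l : V, u n @[n --> \oo] --> l.

Lemma cvg_normr_le (R : realType) (V : normedModType R) (u : nat -> V) (l v : V) (c : R) :
  u n @[n --> \oo] --> l -> (forall e : R, 0 < e -> exists N, forall n, (N <= n)%N ->
    `|u n - v| <= c + e) -> `|l - v| <= c.
Proof.
move=> ul hu; apply/ler_addgt0Pr => e e0.
have e20 : 0 < e / 2 by rewrite divr_gt0.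
have [N hN] := hu _ e20.
move/cvgrPdist_lt : ul => /(_ _ e20) [M _ hM].
pose n := maxn N M.
have h1 := hN n (leq_maxl _ _); have h2 := hM n (leq_maxr _ _).
rewrite -(subrK (u n) l) -addrA; apply: le_trans (ler_normD _ _) _.
have -> : c + e = e / 2 + (c + e / 2) by rewrite addrCA -splitr.
by apply: lerD => //; exact: ltW.
Qed.

Section kernels.
Context (R : realType) (X : lmodType R) (V : normedModType R).
Hypothesis cV : seq_complete V.
Variables (E : set X) (s : X -> R) (x_ : nat -> X).
Hypotheses (hE : subspace_pred E) (hs : seminorm_on E s).
Hypotheses (xE : forall j, E (x_ j)) (xQ : rat_closed x_).
Hypothesis x_dense : forall x, E x -> forall e : R, 0 < e -> exists j, s (x - x_ j) < e.

(** A bounded additive map on a dense rational subspace extends to a bounded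
    linear map; the value at [x] is the only [v] with
    [`|y j - v| <= c * s (x_ j - x)] for all [j]. *)
Lemma rat_linear_extension (y : nat -> V) (c : R) : 0 <= c ->
  (forall q i j k, x_ k = ratr q *: x_ i + x_ j -> y k = ratr q *: y i + y j) ->
  (forall j, `|y j| <= c * s (x_ j)) ->
  exists L : X -> V, [/\ linear_on E L, forall x, E x -> `|L x| <= c * s x &
    forall j, L (x_ j) = y j].
Proof.
move=> c0 yl yb.
have ydist i j : `|y i - y j| <= c * s (x_ i - x_ j).
  have [k xk] := rat_closedB i j xQ.
  have xk' : x_ k = ratr (-1)%Q *: x_ j + x_ i by rewrite rmorphN1 scaleN1r addrC.
  by have := yb k; rewrite (yl _ _ _ _ xk') xk rmorphN1 scaleN1r addrC.
have sC x z : E x -> E z -> s (x - z) = s (z - x).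
  by move=> Ex Ez; rewrite -opprB (seminormN hs)//; exact: subspace_predB.
have tri x z w : E x -> E z -> E w -> s (x - w) <= s (x - z) + s (z - w).
  move=> Ex Ez Ew; have -> : x - w = (x - z) + (z - w) by rewrite addrA subrK.
  by apply: hs.1; exact: subspace_predB.
have hex x : exists v, E x -> forall j, `|v - y j| <= c * s (x_ j - x).
  have [Ex|nEx] := pselect (E x); last by exists 0.
  have /choice[j hj] : forall n : nat, exists j, s (x - x_ j) < n.+1%:R^-1.
    by move=> n; apply: x_dense => //; rewrite invr_gt0.
  have small (e : R) : 0 < e -> exists N, forall n, (N <= n)%N -> c * s (x - x_ (j n)) <= e.
    move=> e0; pose N := Num.bound (c / e).
    have hN : c / e < N%:R by apply: archi_boundP; rewrite divr_ge0// ltW.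
    exists N => n Nn; apply: (@le_trans _ _ (c * n.+1%:R^-1)).
      by rewrite ler_wpM2l// ltW.
    rewrite ler_pdivrMr// mulrC -ler_pdivrMr//; apply: le_trans (ltW hN) _.
    by rewrite ler_nat; apply: leq_trans Nn _.
  have [v hv] : exists v : V, y (j n) @[n --> \oo] --> v.
    apply: cV => e e0; have e40 : 0 < e / 4 by rewrite divr_gt0.
    have [N hN] := small _ e40; exists N => n m Nn Nm.
    apply: le_lt_trans (ydist _ _) _.
    have h1 := tri _ _ _ (xE (j n)) Ex (xE (j m)).
    have h2 := ler_wpM2l c0 h1; rewrite mulrDr in h2.
    have := hN n Nn; have := hN m Nm; rewrite (sC x (x_ (j n)))//; lra.
  exists v => _ k; apply: cvg_normr_le hv _ => e e0.
  have [N hN] := small e e0; exists N => n Nn.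
  apply: le_trans (ydist _ _) _.
  have h1 := ler_wpM2l c0 (tri _ _ _ (xE (j n)) Ex (xE k)); rewrite mulrDr in h1.
  have := hN n Nn; rewrite (sC x (x_ (j n)))// (sC (x_ k) x)//; lra.
have [L hL] := choice hex.
have Lx j : L (x_ j) = y j.
  apply/eqP; rewrite -subr_eq0 -normr_le0; have := hL (x_ j) (xE j) j.
  by rewrite subrr (seminorm0 hE hs) mulr0.
have Lb x : E x -> `|L x| <= c * s x.
  move=> Ex; apply/ler_addgt0Pr => e e0.
  have e'0 : 0 < e / (2 * c + 1) by rewrite divr_gt0// ltr_wpDl// mulr_ge0.
  have [j hj] := x_dense Ex e'0.
  have h1 := hL x Ex j; have h2 := yb j; have h3 := tri _ _ _ (xE j) Ex hE.1.
  rewrite !subr0 in h3; rewrite sC// in h1 h3.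
  have h4 := ler_wpM2l c0 h3; rewrite mulrDr in h4.
  have h5 : c * s (x - x_ j) <= c * (e / (2 * c + 1)) by rewrite ler_wpM2l// ltW.
  have h6 : c * (e / (2 * c + 1)) * 2 <= e.
    by rewrite mulrA mulrAC ler_pdivrMr ?ltr_wpDl ?mulr_ge0//; lra.
  have h7 : `|L x| <= `|L x - y j| + `|y j|.
    by rewrite -{1}(subrK (y j) (L x)); exact: ler_normD.
  lra.
exists L; split=> // a x z Ex Ez.
apply/eqP; rewrite -subr_eq0 -normr_le0; apply/ler_addgt0Pr => e e0; rewrite add0r.
have Eaxz : E (a *: x + z) by exact: hE.2.
pose B : R := c + c * (`|a| + 1) + c + `|L x| + 1.
have B0 : 0 < B.
  by rewrite /B ltr_wpDl// !addr_ge0// mulr_ge0// addr_ge0.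
pose e1 := Num.min 1 (e / B).
have e10 : 0 < e1 by rewrite lt_min ltr01 divr_gt0.
have e1e : e1 * B <= e by rewrite -ler_pdivlMr//; rewrite /e1 ge_min lexx orbT.
have e11 : e1 <= 1 by rewrite /e1 ge_min lexx.
have [e' e'0 happ] := rat_comb_approx hE hs xE a Ex Ez e10.
pose e2 := Num.min e1 e'.
have e20 : 0 < e2 by rewrite lt_min e10.
have [i hi] := x_dense Ex e20; have [j hj] := x_dense Ez e20.
rewrite lt_min in hi; rewrite lt_min in hj.
case/andP : hi => hi1 hi2; case/andP : hj => hj1 hj2.
have [q hq1 hq2] := happ i j hi2 hj2.
have [k xk] := xQ q i j; rewrite -xk in hq2.
have yk := yl _ _ _ _ xk.
move: hq1 yk; move: (ratr q : R) => b hq1 yk.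
have h1 := hL _ Eaxz k; have h2 := hL _ Ex i; have h3 := hL _ Ez j.
rewrite sC// in h1; rewrite sC// in h2; rewrite sC// in h3.
have -> : L (a *: x + z) - (a *: L x + L z) = (L (a *: x + z) - y k) +
    (- (b *: (L x - y i)) + ((b - a) *: L x - (L z - y j))).
  have aux (u p r l m n : V) :
      u - (m + n) = (u - (p + r)) + (- (l - p) + ((l - m) - (n - r))).
    rewrite (_ : - (l - p) + _ = (p + r) - (m + n)); first by rewrite addrA subrK.
    by rewrite [- (l - p)]opprB [- (n - r)]opprB addrA [p - l + _]addrA subrK addrACA -opprD.
  by rewrite yk scalerBr scalerBl; exact: aux.
have n1 := ler_normD (L (a *: x + z) - y k)
  (- (b *: (L x - y i)) + ((b - a) *: L x - (L z - y j))).
have n2 := ler_normD (- (b *: (L x - y i))) ((b - a) *: L x - (L z - y j)).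
have n3 := ler_normB ((b - a) *: L x) (L z - y j).
rewrite normrN !normrZ in n2 n3; rewrite (distrC (b)) in n2 n3.
have q1 : `|b| <= `|a| + 1.
  have := ler_normD (a - b) (- a); rewrite addrAC subrr add0r !normrN; lra.
have m1 : c * s (a *: x + z - x_ k) <= c * e1 by rewrite ler_wpM2l// ltW.
have m2 : c * s (x - x_ i) <= c * e1 by rewrite ler_wpM2l// ltW.
have m3 : c * s (z - x_ j) <= c * e1 by rewrite ler_wpM2l// ltW.
have m4 : `|b| * `|L x - y i| <= (`|a| + 1) * (c * e1).
  by rewrite ler_pM// (le_trans h2).
have m5 : `|a - b| * `|L x| <= e1 * `|L x| by rewrite ler_wpM2r// ltW.
have E1 : e1 * B = c * e1 + (`|a| + 1) * (c * e1) + c * e1 + e1 * `|L x| + e1.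
  by rewrite /B; ring.
lra.
Qed.

Context d (T : measurableType d).
Variable mu : {finite_measure set T -> \bar R}.
Variable S : X -> T -> V.
Hypothesis Sm : forall x, E x -> smeas (S x).
Hypothesis Sl : forall a x z, E x -> E z ->
  {ae mu, forall t, S (a *: x + z) t = a *: S x t + S z t}.

(** Normalizing [z j] by [s (z j)] alone would fail where [s] vanishes; the
    vectors [z j] divided by [s (z j) + 1 / n.+1] are in the unit ball for all
    [n], and [n] then tends to infinity. *)
Lemma ae_bounded_normalize :
  (forall z : nat -> X, (forall j, E (z j) /\ s (z j) <= 1) ->
    {ae mu, forall t, exists c, forall j, `|S (z j) t| <= c}) ->
  forall z : nat -> X, (forall j, E (z j)) ->
    {ae mu, forall t, exists c, forall j, `|S (z j) t| <= c * s (z j)}.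
Proof.
move=> hb z zE.
have s0 j := seminorm_ge0 hE hs (zE j).
pose r (p : nat * nat) : R := s (z p.1) + p.2.+1%:R^-1.
have r0 p : 0 < r p by rewrite ltr_wpDl// invr_gt0.
pose z' (n : nat) : X := if @unpickle (nat * nat)%type n is Some p
  then (r p)^-1 *: z p.1 else 0.
have z'E n : E (z' n) /\ s (z' n) <= 1.
  rewrite /z'; case: unpickle => [p|]; last first.
    by split; [exact: hE.1|rewrite (seminorm0 hE hs)].
  split; first exact: subspace_predZ.
  rewrite hs.2// gtr0_norm ?invr_gt0// mulrC ler_pdivrMr// mul1r.
  by rewrite lerDl invr_ge0.
have hZ : {ae mu, forall t, forall p : nat * nat,
    S ((r p)^-1 *: z p.1) t = (r p)^-1 *: S (z p.1) t}.
  apply: ae_forall_countable => p.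
  have h0 : {ae mu, forall t, S 0 t = 0}.
    apply: filterS (Sl (-1) hE.1 hE.1) => t.
    by rewrite scaler0 addr0 scaleN1r addNr.
  apply: filterS2 (Sl (r p)^-1 (zE p.1) hE.1) h0 => t h1 h2.
  by move: h1; rewrite addr0 h2 addr0.
apply: filterS2 hZ (hb z' z'E) => t h1 [c hc].
exists (Num.max c 0) => j; apply/ler_addgt0Pr => e e0.
have c0 : 0 <= Num.max c 0 by rewrite le_max lexx orbT.
pose n := Num.bound (Num.max c 0 / e).
have hn : Num.max c 0 / e < n%:R by apply: archi_boundP; rewrite divr_ge0// ltW.
have := hc (pickle (j, n)); rewrite /z' pickleK h1 normrZ gtr0_norm ?invr_gt0//.
rewrite mulrC ler_pdivrMr// => h.
apply: le_trans h _; apply: (@le_trans _ _ (Num.max c 0 * r (j, n))).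
  by apply: ler_wpM2r; [exact: ltW|rewrite le_max lexx].
rewrite /r mulrDr lerD2l ler_pdivrMr// mulrC -ler_pdivrMr//.
by apply: le_trans (ltW hn) _; rewrite ler_nat.
Qed.

Hypothesis Sb : forall z : nat -> X, (forall j, E (z j)) ->
  {ae mu, forall t, exists c, forall j, `|S (z j) t| <= c * s (z j)}.

(** Outside one null set the values [S x t] are linear and bounded in [x]
    along a countable dense set, so that they come from a bounded operator. *)
Lemma pointwise_kernel : exists L : T -> X -> V,
  [/\ forall t, linear_on E (L t),
      forall t, exists2 c, 0 <= c & forall x, E x -> `|L t x| <= c * s x,
      forall x, E x -> smeas (fun t => L t x) &
      forall x, E x -> {ae mu, forall t, S x t = L t x}].
Proof.
have : {ae mu, forall t, (exists c, forall j, `|S (x_ j) t| <= c * s (x_ j)) /\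
    forall p : rat * nat * nat, S (ratr p.1.1 *: x_ p.1.2 + x_ p.2) t =
      ratr p.1.1 *: S (x_ p.1.2) t + S (x_ p.2) t}.
  apply: filterS2 (Sb xE) _ => [t h1 h2|]; first by split; [exact: h1|exact: h2].
  by apply: ae_forall_countable => p; exact: Sl.
move=> [N [mN N0 hN]].
have good t : ~ N t -> (exists c, forall j, `|S (x_ j) t| <= c * s (x_ j)) /\
    forall p : rat * nat * nat, S (ratr p.1.1 *: x_ p.1.2 + x_ p.2) t =
      ratr p.1.1 *: S (x_ p.1.2) t + S (x_ p.2) t.
  by move=> nNt; apply: contrapT => h; apply: nNt; exact: hN.
pose y t j := cutoff (~` N) (S (x_ j)) t.
have yN t j : N t -> y t j = 0.
  by move=> Nt; rewrite /y /cutoff indicE memNset ?scale0r//=; apply.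
have ynN t j : ~ N t -> y t j = S (x_ j) t.
  by move=> Nt; rewrite /y /cutoff indicE mem_set// scale1r.
have /choice[L hL] : forall t, exists L : X -> V, [/\ linear_on E L,
    exists2 c, 0 <= c & forall x, E x -> `|L x| <= c * s x &
    forall j, L (x_ j) = y t j].
  move=> t; have [Nt|nNt] := pselect (N t).
    exists (fun=> 0); split=> [a x z _ _||j]; first by rewrite scaler0 addr0.
      by exists 0 => // x _; rewrite normr0 mul0r.
    by rewrite yN.
  have [[c hc] hl] := good t nNt.
  have [//||j|L [h1 h2 h3]] := @rat_linear_extension (y t) (Num.max c 0).
  - by rewrite le_max lexx orbT.
  - by move=> q i j k xk; rewrite !ynN// xk (hl (q, i, j)).
  - rewrite ynN//; apply: le_trans (hc j) _; rewrite ler_wpM2r ?le_max ?lexx//.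
    exact: (seminorm_ge0 hE hs).
  - by exists L; split=> //; exists (Num.max c 0); rewrite ?le_max ?lexx ?orbT.
have Lcont x e t : E x -> 0 < e -> exists2 e', 0 < e' & forall j, s (x - x_ j) < e' ->
    `|L t x - y t j| < e.
  move=> Ex e0; have [ll [c c0 lc] ly] := hL t.
  have c1 : 0 < c + 1 by rewrite ltr_wpDl.
  exists (e / (c + 1)) => [|j hj]; first by rewrite divr_gt0.
  rewrite -ly -(linear_onB hE ll)//; apply: le_lt_trans (lc _ _) _.
    exact: subspace_predB.
  have sx := seminorm_ge0 hE hs (subspace_predB hE Ex (xE j)).
  rewrite ltr_pdivlMr// in hj; apply: le_lt_trans hj.
  by rewrite mulrC ler_wpM2l// lerDl.
have ym j : smeas (y ^~ j) by apply: smeas_cutoff; [exact: measurableC|exact: Sm].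
exists L; split=> [t|t|x Ex|x Ex].
- by have [] := hL t.
- by have [] := hL t.
- have /choice[j hj] : forall n : nat, exists j, s (x - x_ j) < n.+1%:R^-1.
    by move=> n; apply: x_dense => //; rewrite invr_gt0.
  apply: (@smeas_cvg _ _ _ _ (fun n t => y t (j n))) => // t.
  apply/cvgrPdist_lt => e e0; have [e' e'0 he'] := Lcont x e t Ex e0.
  pose m := Num.bound e'^-1.
  have hm : e'^-1 < m%:R by apply: archi_boundP; rewrite invr_ge0 ltW.
  exists m => // n /= mn; apply: he'; apply: lt_trans (hj n) _.
  rewrite invf_plt ?posrE//; apply: lt_le_trans hm _; rewrite ler_nat.
  exact: leqW.
- have h1 := Sb (fun j => subspace_predB hE Ex (xE j)).
  have h2 : {ae mu, forall t, forall j, S (x - x_ j) t = S x t - S (x_ j) t}.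
    apply: ae_forall_countable => j; apply: filterS (Sl (-1) (xE j) Ex) => t.
    by rewrite !scaleN1r addrC => ->; rewrite addrC.
  have h3 : {ae mu, forall t, ~ N t}.
    by exists N; split=> // t /=; exact: contrapT.
  apply: filterS3 h1 h2 h3 => t [c hc] hB nNt.
  apply/eqP; rewrite -subr_eq0 -normr_le0; apply/ler_addgt0Pr => e e0.
  rewrite add0r; have e20 : 0 < e / 2 by rewrite divr_gt0.
  have [e' e'0 he'] := Lcont x _ t Ex e20.
  pose c' := Num.max c 0 + 1.
  have c'0 : 0 < c' by rewrite ltr_wpDl// le_max lexx orbT.
  have mn0 : 0 < Num.min e' (e / 2 / c') by rewrite lt_min e'0 divr_gt0.
  have [j] := x_dense Ex mn0; rewrite lt_min => /andP[hj1 hj2].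
  have k1 := he' _ hj1; have k2 := hc j; rewrite hB -(ynN _ _ nNt) in k2.
  have k3 : c * s (x - x_ j) <= c' * s (x - x_ j).
    rewrite ler_wpM2r//; first exact: (seminorm_ge0 hE hs (subspace_predB hE Ex (xE j))).
    by rewrite /c' (@le_trans _ _ (Num.max c 0))// ?le_max ?lexx// lerDl.
  have k4 : c' * s (x - x_ j) < e / 2 by rewrite mulrC -ltr_pdivlMr.
  rewrite -(subrK (y t j) (S x t)) -addrA.
  have := ler_normD (S x t - y t j) (y t j - L t x).
  rewrite (distrC (y t j)); lra.
Qed.

End kernels.

Section integral_kernel.
Context d (T : measurableType d) (R : realType).
Variable mu : {finite_measure set T -> \bar R}.

Lemma integrable_funD (f g : T -> R) : integrable_fun mu f -> integrable_fun mu g ->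
  integrable_fun mu (fun t => f t + g t).
Proof. by move=> hf hg; have := integrableD measurableT hf hg. Qed.

Lemma integrable_funZ (a : R) (f : T -> R) : integrable_fun mu f ->
  integrable_fun mu (fun t => a * f t).
Proof. by move=> hf; have := integrableZl measurableT a hf. Qed.

Lemma integrable_fun_cst (a : R) : integrable_fun mu (fun=> a).
Proof. exact: finite_measure_integrable_cst. Qed.

Lemma integrable_fun_sum n (f : nat -> T -> R) :
  (forall j, integrable_fun mu (f j)) ->
  integrable_fun mu (fun t => \sum_(j < n) f j t).
Proof.
move=> hf; elim: n => [|n IH].
  under [X in integrable_fun _ X]eq_fun do rewrite big_ord0.
  exact: integrable_fun_cst.
under [X in integrable_fun _ X]eq_fun do rewrite big_ord_recr/=.
exact: integrable_funD.
Qed.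

Lemma integrable_fun_measurable (f : T -> R) : integrable_fun mu f ->
  measurable_fun setT f.
Proof. by move=> /(measurable_int mu)/measurable_EFinP. Qed.

Lemma Rintegral_lin (a : R) (f g : T -> R) A : measurable A ->
  integrable_fun mu f -> integrable_fun mu g ->
  \int[mu]_(t in A) (a * f t + g t) =
  a * (\int[mu]_(t in A) f t) + \int[mu]_(t in A) g t.
Proof.
move=> mA hf hg; rewrite RintegralD//.
- by rewrite RintegralZl//; exact: integrable_fun_on.
- by apply: integrable_fun_on => //; exact: integrable_funZ.
- exact: integrable_fun_on.
Qed.

Lemma Rintegral_ae (f g : T -> R) A : measurable A -> integrable_fun mu f ->
  measurable_fun setT g -> {ae mu, forall t, f t = g t} ->
  integrable_fun mu g /\ \int[mu]_(t in A) f t = \int[mu]_(t in A) g t.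
Proof.
move=> mA hf mg fg; split.
  move: (hf) => /integrableP[mf fi]; apply/integrableP; split.
    exact/measurable_EFinP.
  rewrite -(_ : (\int[mu]_x `|(EFin \o f) x| = \int[mu]_x `|(EFin \o g) x|)%E)//.
  apply: ae_eq_integral => //; try exact: measurableT_comp.
    by apply: measurableT_comp => //; exact/measurable_EFinP.
  by apply: filterS fg => t fgt _ /=; rewrite fgt.
rewrite /Rintegral; congr fine; apply: ae_eq_integral => //.
- exact: (measurable_funS measurableT) (measurable_int _ hf).
- by apply: (measurable_funS measurableT) => //; exact/measurable_EFinP.
- by apply: filterS fg => t fgt _ /=; rewrite fgt.
Qed.

Lemma integrable_selector m s (g : nat -> T -> R) : selector m s ->
  (forall j, integrable_fun mu (g j)) -> measurable_fun setT (fun t => g (s t) t) ->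
  integrable_fun mu (fun t => g (s t) t).
Proof.
move=> [sm ms] hg mg.
apply: (@integrable_fun_le _ _ _ mu _ (fun t => \sum_(j < m.+1) `|g j t|)) => //.
  apply: (@integrable_fun_sum m.+1 (fun j t => `|g j t|)) => j.
  exact: integrable_norm (hg j).
move=> t; have jm : (s t < m.+1)%N by rewrite ltnS.
by rewrite (bigD1 (Ordinal jm))//= lerDl; exact: sumr_ge0.
Qed.

Lemma complete_seq_complete (V : completeNormedModType R) : seq_complete V.
Proof.
move=> u hu; apply/cvg_ex; apply: cauchy_cvg; apply/cauchy_exP => e e0.
have [N hN] := hu e e0; exists (u N).
by exists N => // n /= Nn; rewrite -ball_normE /ball_/=; exact: hN.
Qed.

(** Each [lam ^~ x] has a density [S x] by the Radon-Nikodym theorem.  The last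
    hypothesis bounds the integrals of the selections from a sequence of
    densities [S (z j)] with [z j] in the unit ball; hence these densities are
    bounded at almost every point, and come from a bounded functional there. *)
Theorem integral_kernel (X : lmodType R) (E : set X) (s : X -> R) (x_ : nat -> X)
  (lam : set T -> X -> R^o) (C : R) :
  subspace_pred E -> seminorm_on E s -> (forall j, E (x_ j)) -> rat_closed x_ ->
  (forall x, E x -> forall e : R, 0 < e -> exists j, s (x - x_ j) < e) ->
  (forall A, measurable A -> linear_on E (lam A)) ->
  (forall x, E x -> forall A B, measurable A -> measurable B -> A `&` B = set0 ->
     lam (A `|` B) x = lam A x + lam B x) ->
  (forall x, E x -> forall e : R, 0 < e -> exists2 dl : R, 0 < dl &
     forall A, measurable A -> (mu A < dl%:E)%E -> `|lam A x| <= e) ->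
  (forall m p A (z : nat -> X), selector m p -> measurable A ->
     (forall j, E (z j) /\ s (z j) <= 1) ->
     \sum_(j < m.+1) lam (A `&` p @^-1` [set val j]) (z j) <= C) ->
  exists L : T -> X -> R^o,
    [/\ forall t, linear_on E (L t),
      forall t, exists2 c, 0 <= c & forall x, E x -> `|L t x| <= c * s x,
      forall x, E x -> smeas (fun t => L t x) &
      forall x, E x -> integrable_fun mu (fun t => L t x) /\
        forall A, measurable A -> lam A x = \int[mu]_(t in A) L t x].
Proof.
move=> hE hs xE xQ xd lin lamU ac bnd.
have /choice[S hS] : forall x, exists h : T -> R^o, E x -> integrable_fun mu h /\
    forall A, measurable A -> lam A x = \int[mu]_(t in A) h t.
  move=> x; have [Ex|nEx] := pselect (E x); last by exists (fun=> 0).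
  have [h h1 h2] := @abs_cont_density _ _ _ mu (fun A => lam A x) (lamU x Ex) (ac x Ex).
  by exists h.
have Sm x : E x -> smeas (S x).
  by move=> Ex; apply: measurable_smeas; exact: (integrable_fun_measurable (hS x Ex).1).
have Sl (a : R) x z : E x -> E z ->
    {ae mu, forall t, S (a *: x + z) t = a *: S x t + S z t}.
  move=> Ex Ez; have Eaxz := hE.2 a x z Ex Ez.
  apply: Rintegral_ae_eq; first exact: (hS _ Eaxz).1.
    by apply: integrable_funD; [apply: integrable_funZ|]; exact: (hS _ _).1.
  move=> A mA; rewrite -(hS _ Eaxz).2// lin//.
  rewrite (hS _ Ex).2// (hS _ Ez).2//; apply/esym/Rintegral_lin => //.
  - exact: (hS _ Ex).1.
  - exact: (hS _ Ez).1.
have hb (z : nat -> X) : (forall j, E (z j) /\ s (z j) <= 1) ->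
    {ae mu, forall t, exists c, forall j, `|S (z j) t| <= c}.
  move=> hz.
  (* Interleaving [z j] and [- z j] turns one-sided bounds into bounds of
     absolute values. *)
  pose z' n : X := (-1) ^+ (odd n) *: z n./2.
  have hz' n : E (z' n) /\ s (z' n) <= 1.
    have [h1 h2] := hz n./2; split; first exact: subspace_predZ.
    by rewrite hs.2// normrX normrN1 expr1n mul1r.
  have h1 : {ae mu, forall t, exists c, forall n, S (z' n) t <= c}.
    apply: (@ae_bounded_of_selectors _ _ _ mu _ C) => [j|m p A sp mA p0 mp].
      exact: (integrable_fun_measurable (hS _ (hz' j).1).1).
    have ip : integrable_fun mu (fun t => S (z' (p t)) t).
      apply: (@integrable_selector m p (fun j => S (z' j))) => // j.
      exact: (hS _ (hz' j).1).1.
    rewrite integral_ge0_fin// lee_fin (Rintegral_selector sp mA ip).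
    rewrite (eq_bigr (fun j : 'I_m.+1 => lam (A `&` p @^-1` [set val j]) (z' j))).
      exact: bnd.
    move=> j _; rewrite (hS _ (hz' j).1).2; last first.
      by apply: measurableI => //; exact: sp.2.
    by apply: eq_Rintegral => t /set_mem [_ /= ->].
  have h2 : {ae mu, forall t, forall j, S (- z j) t = - S (z j) t}.
    apply: ae_forall_countable => j; have [Ej _] := hz j.
    apply: filterS2 (Sl (-1) _ _ Ej hE.1) (Sl (-1) _ _ hE.1 hE.1) => t.
    by rewrite scaler0 !addr0 !scaleN1r => -> ->; rewrite addNr addr0.
  apply: filterS2 h1 h2 => t [c hc] hN; exists c => j.
  rewrite ler_norml; apply/andP; split.
    have := hc j.*2.+1; rewrite /z' /= odd_double/= uphalf_double expr1 scaleN1r hN.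
    by rewrite lerNl.
  by have := hc j.*2; rewrite /z' odd_double doubleK expr0 scale1r.
have cR : seq_complete (R^o : normedModType R).
  exact: (@complete_seq_complete R^o).
have Sb := ae_bounded_normalize hE hs Sl hb.
have [L [L1 L2 L3 L4]] := pointwise_kernel cR hE hs xE xQ xd Sm Sl Sb.
exists L; split=> // x Ex.
have LA A : measurable A -> _ := fun mA => Rintegral_ae mA (hS x Ex).1
  (smeas_measurable (L3 x Ex)) (L4 x Ex).
split; first exact: (LA setT measurableT).1.
by move=> A mA; rewrite (hS x Ex).2// (LA A mA).2.
Qed.

End integral_kernel.

(** * Reflexive spaces *)

Section reflexive.
Context (R : realType) (Y : normedModType R).

Definition bounded_dual : set (Y -> R^o) :=
  [set u | linear_on setT u /\ exists2 C, 0 <= C & forall y, `|u y| <= C * `|y|].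

(** The bound on [Psi] is expressed by means of any bound [t] for the norm of [u],
    which avoids the norm of the dual. *)
Definition real_reflexive : Prop :=
  forall Psi : (Y -> R^o) -> R^o, linear_on bounded_dual Psi ->
    (exists C, forall u t, bounded_dual u -> 0 <= t ->
       (forall y, `|u y| <= t * `|y|) -> `|Psi u| <= C * t) ->
    exists y, forall u, bounded_dual u -> Psi u = u y.

Lemma setT_subspace (V : lmodType R) : subspace_pred [set: V].
Proof. by []. Qed.

Lemma norm_seminorm : seminorm_on setT (fun y : Y => `|y|).
Proof. by split=> [x y _ _|a x _]; [exact: ler_normD|exact: normrZ]. Qed.

Lemma bounded_dual_subspace : subspace_pred bounded_dual.
Proof.
split; first by split=> [a x y _ _|]; [rewrite scaler0 addr0|exists 0 => // y; rewrite normr0 mul0r].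
move=> a u v [lu [C C0 hu]] [lv [D D0 hv]]; split.
  move=> b x y _ _; rewrite -![(_ + _) _]/(_ + _) -![(_ *: u) _]/(_ *: _) lu// lv//.
  rewrite [in LHS]scalerDr [in RHS]scalerDr !scalerA (mulrC a).
  by rewrite addrACA.
exists (`|a| * C + D) => [|y]; first by rewrite addr_ge0// mulr_ge0.
apply: le_trans (ler_normD _ _) _; rewrite mulrDl; apply: lerD => //.
by rewrite -[(a *: u) y]/(a * u y) normrM -mulrA ler_wpM2l.
Qed.

Lemma dual_norming (y : Y) : exists u, [/\ bounded_dual u,
  forall z, `|u z| <= `|z| & u y = `|y|].
Proof.
have [u [lu us uy]] := seminorm_norming (@setT_subspace Y) norm_seminorm (x := y) I.
have ub z : `|u z| <= `|z| by exact: us.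
exists u; split=> //; split=> //; exists 1 => // z.
by rewrite mul1r.
Qed.

Variable x_ : nat -> Y.
Hypothesis xQ : rat_closed x_.

(** As the [x_ j] are closed under rational combinations, their closure is a
    subspace over the reals. *)
Definition span_closure : set Y := seminorm_closure setT (fun y => `|y|) x_.

Lemma span_closureP y : span_closure y <-> forall e : R, 0 < e -> exists j, `|y - x_ j| < e.
Proof. by split=> [[]|]. Qed.

Lemma span_closure_subspace : subspace_pred span_closure.
Proof. exact: (seminorm_closure_subspace (@setT_subspace Y) norm_seminorm). Qed.

Lemma span_closure_gen j : span_closure (x_ j).
Proof. exact: (seminorm_closure_gen (@setT_subspace Y) norm_seminorm). Qed.

(** The norm of the restriction of [u] to the closed span of the [x_ j]. *)
Definition span_gauge (u : Y -> R^o) : R :=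
  sup (range (fun j => `|u (x_ j)| / `|x_ j|)).

Lemma span_gauge_ub u j : bounded_dual u -> `|u (x_ j)| <= span_gauge u * `|x_ j|.
Proof.
move=> [lu [C C0 uC]].
have h : `|u (x_ j)| / `|x_ j| <= span_gauge u.
  apply: ub_le_sup; last by exists j.
  exists C => _ [i _ <-]; have [x0|x0] := eqVneq (x_ i) 0.
    by rewrite x0 normr0 invr0 mulr0.
  by rewrite ler_pdivrMr ?normr_gt0.
have [x0|x0] := eqVneq (x_ j) 0; last by rewrite -ler_pdivrMr ?normr_gt0.
by rewrite x0 (linear_on0 (@setT_subspace Y) lu) !normr0 mulr0.
Qed.

Lemma span_gauge_le u t : 0 <= t -> (forall j, `|u (x_ j)| <= t * `|x_ j|) ->
  span_gauge u <= t.
Proof.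
move=> t0 h; apply: ge_sup; first by exists (`|u (x_ 0%N)| / `|x_ 0%N|), 0%N.
move=> _ [j _ <-]; have [x0|x0] := eqVneq (x_ j) 0.
  by rewrite x0 normr0 invr0 mulr0.
by rewrite ler_pdivrMr ?normr_gt0.
Qed.

Lemma span_gauge_ge0 u : bounded_dual u -> 0 <= span_gauge u.
Proof.
move=> [_ [C C0 uC]]; apply: (@le_trans _ _ (`|u (x_ 0%N)| / `|x_ 0%N|)).
  by rewrite divr_ge0.
apply: ub_le_sup; last by exists 0%N.
exists C => _ [i _ <-]; have [x0|x0] := eqVneq (x_ i) 0.
  by rewrite x0 normr0 invr0 mulr0.
by rewrite ler_pdivrMr ?normr_gt0.
Qed.

Lemma span_gauge_seminorm : seminorm_on bounded_dual span_gauge.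
Proof.
split=> [u v hu hv|a u hu].
  apply: span_gauge_le; first by rewrite addr_ge0 ?span_gauge_ge0.
  move=> j; apply: le_trans (ler_normD _ _) _.
  by rewrite mulrDl lerD ?span_gauge_ub.
have Zle b w : bounded_dual w -> span_gauge (b *: w) <= `|b| * span_gauge w.
  move=> hw; apply: span_gauge_le; first by rewrite mulr_ge0 ?span_gauge_ge0.
  by move=> j; rewrite -[(b *: w) _]/(b * w _) normrM -mulrA ler_wpM2l ?span_gauge_ub.
apply/eqP; rewrite eq_le Zle//=; have [->|a0] := eqVneq a 0.
  rewrite normr0 mul0r scale0r span_gauge_ge0//; exact: bounded_dual_subspace.1.
have := Zle a^-1 _ (subspace_predZ a bounded_dual_subspace hu).
rewrite scalerA mulVf// scale1r normfV => h.
by rewrite -ler_pdivlMl ?normr_gt0.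
Qed.

Lemma span_gauge_closure u y : bounded_dual u -> span_closure y ->
  `|u y| <= span_gauge u * `|y|.
Proof.
move=> hu /span_closureP hy; have [lu [C C0 uC]] := hu.
apply/ler_addgt0Pr => e e0; have g0 := span_gauge_ge0 hu.
have D0 : 0 < C + span_gauge u + 1 by rewrite ltr_wpDl// addr_ge0.
have [j hj] := hy (e / (C + span_gauge u + 1)) (divr_gt0 e0 D0).
rewrite ltr_pdivlMr// !mulrDr mulr1 in hj.
have h1 : `|u y| <= `|u (y - x_ j)| + `|u (x_ j)|.
  by rewrite -{1}(subrK (x_ j) y) (linear_onD lu)//; exact: ler_normD.
have h2 := uC (y - x_ j); have h3 := span_gauge_ub j hu.
have h4 : `|x_ j| <= `|y - x_ j| + `|y|.
  by rewrite -{1}(subrK y (x_ j)) (distrC y); exact: ler_normD.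
have h5 := ler_wpM2l g0 h4; rewrite mulrDr in h5.
have h6 := normr_ge0 (y - x_ j).
rewrite (mulrC `|y - x_ j| C) (mulrC `|y - x_ j|) in hj; lra.
Qed.

Lemma dual_extension (g : Y -> R^o) (c : R) : 0 <= c -> linear_on span_closure g ->
  (forall y, span_closure y -> `|g y| <= c * `|y|) ->
  exists u, [/\ bounded_dual u, (forall y, `|u y| <= c * `|y|) &
    forall y, span_closure y -> u y = g y].
Proof.
move=> c0 lg gc.
have hs : seminorm_on setT (fun y : Y => c * `|y|).
  split=> [x y _ _|a x _]; first by rewrite -mulrDr ler_wpM2l ?ler_normD.
  by rewrite normrZ mulrCA.
have [u [lu uc ug]] := seminorm_extension (@setT_subspace Y) hs
  span_closure_subspace (@subsetT _ _) lg gc.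
have ub y : `|u y| <= c * `|y| by exact: uc.
by exists u; split=> //; split=> //; exists c.
Qed.

(** A functional that separates [y] from the closed span would have gauge 0. *)
Lemma span_closure_of_gauge y (C : R) :
  (forall u, bounded_dual u -> `|u y| <= C * span_gauge u) -> span_closure y.
Proof.
move=> hC; apply/span_closureP; apply: contrapT => hn.
have [e e0 he] : exists2 e : R, 0 < e & forall j, e <= `|y - x_ j|.
  apply: contrapT => h; apply: hn => e e0; apply: contrapT => hj; apply: h.
  by exists e => // j; rewrite leNgt; apply/negP => hlt; apply: hj; exists j.
have hF v : span_closure v -> e <= `|y - v|.
  move=> /span_closureP hv; apply/ler_addgt0Pr => r r0; have [j hj] := hv r r0.
  apply: le_trans (he j) _; rewrite -{1}(subrK v y) -addrA.
  by apply: le_trans (ler_normD _ _) _; rewrite lerD2l// ltW.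
have [f [lf fb f0 fy]] := seminorm_separation (@setT_subspace Y) norm_seminorm
  span_closure_subspace (@subsetT _ _) (x := y) I (ltW e0) hF.
have hf : bounded_dual f.
  by split=> //; exists 1 => // z; rewrite mul1r; exact: fb.
have g0 : span_gauge f = 0.
  apply/eqP; rewrite eq_le span_gauge_ge0// andbT; apply: span_gauge_le => // j.
  by rewrite f0 ?normr0 ?mul0r//; exact: span_closure_gen.
have := hC f hf; rewrite g0 mulr0 normr_le0 => /eqP fy0.
by have := lt_le_trans e0 fy; rewrite fy0 ltxx.
Qed.

(** A functional on the dual that vanishes on the norming functionals [n j] of
    the [x_ j] and is bounded by the gauge is, by reflexivity, the evaluation
    at a point [y] of the closed span; choosing [x_ j] near [y] forces
    [y = 0].  Hence the rational span of the [n j] is dense for the gauge. *)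
Lemma reflexive_separable_dual : real_reflexive ->
  exists e : nat -> Y -> R^o, [/\ forall i, bounded_dual (e i), rat_closed e,
    forall u, bounded_dual u -> forall eps : R, 0 < eps ->
      exists i, span_gauge (u - e i) < eps &
    forall j, exists i, (forall y, `|e i y| <= `|y|) /\ e i (x_ j) = `|x_ j|].
Proof.
move=> hrefl.
have [n hn] := choice (fun j => dual_norming (x_ j)).
have nD j : bounded_dual (n j) by have [] := hn j.
have hD := bounded_dual_subspace; have hs := span_gauge_seminorm.
pose e := rat_span n.
have eD i : bounded_dual (e i) by exact: rat_span_sub.
have eQ : rat_closed e := rat_span_closed n.
exists e; split=> // [u hu eps eps0|j]; last first.
  by have [i ei] := rat_span_gen n j; exists i; rewrite /e ei; have [] := hn j.
pose F := seminorm_closure bounded_dual span_gauge e.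
suff : F u by move=> [_ /(_ _ eps0)].
apply: contrapT => nFu.
have hF : subspace_pred F := seminorm_closure_subspace hD hs eD eQ.
have FE : F `<=` bounded_dual by move=> v [].
have [r r0 hr] : exists2 r : R, 0 < r & forall i, r <= span_gauge (u - e i).
  apply: contrapT => h; apply: nFu; split=> // r r0; apply: contrapT => hi; apply: h.
  by exists r => // i; rewrite leNgt; apply/negP => hlt; apply: hi; exists i.
have hFr v : F v -> r <= span_gauge (u - v).
  move=> [hv vF]; apply/ler_addgt0Pr => t t0; have [i hi] := vF t t0.
  apply: le_trans (hr i) _.
  have -> : u - e i = (u - v) + (v - e i) by rewrite addrA subrK.
  apply: le_trans (hs.1 _ _ _ _) _; [exact: subspace_predB|exact: subspace_predB|].
  by rewrite lerD2l ltW.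
have [Phi [lP Pb PF Pu]] := seminorm_separation hD hs hF FE hu (ltW r0) hFr.
have [|y hy] := hrefl Phi lP.
  exists 1 => v t hv t0 vt; rewrite mul1r; apply: le_trans (Pb _ hv) _.
  by apply: span_gauge_le => // j.
have yS : span_closure y.
  by apply: (@span_closure_of_gauge _ 1) => v hv; rewrite mul1r -hy//; exact: Pb.
have ny j : n j y = 0.
  rewrite -hy//; apply: PF; have [i <-] := rat_span_gen n j.
  exact: (seminorm_closure_gen hD hs).
have y0 : y = 0.
  apply/eqP; rewrite -normr_le0; apply/ler_addgt0Pr => t t0; rewrite add0r.
  have t20 : 0 < t / 2 by rewrite divr_gt0.
  have [j hj] := (span_closureP y).1 yS _ t20.
  have [[lnj _] nb nj] := hn j.
  have h1 : `|x_ j| <= `|y - x_ j|.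
    rewrite -nj; apply: le_trans (ler_norm _) _; rewrite (distrC y).
    have -> : n j (x_ j) = n j (x_ j - y).
      by rewrite (linear_onB (@setT_subspace Y) lnj)// ny subr0.
    exact: nb.
  have h2 : `|y| <= `|y - x_ j| + `|x_ j| by rewrite -{1}(subrK (x_ j) y) ler_normD.
  lra.
have [lu _] := hu; have := lt_le_trans r0 Pu.
by rewrite hy// y0 (linear_on0 (@setT_subspace Y) lu) ltxx.
Qed.

End reflexive.

(** * Weak sequential compactness in function spaces over a reflexive space *)

Section weak_compactness.
Context d (T : measurableType d) (R : realType).
Variable mu : {finite_measure set T -> \bar R}.
Variable rho : (T -> R) -> \bar R.
Hypothesis hrho : function_norm mu rho.
Hypothesis rho_smooth : disjointly_smooth rho.

Local Notation fspace := (fspace rho).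
Local Notation fnorm := (fnorm rho).
Local Notation bounded_functional := (bounded_functional rho).

Section cutoff_lemmas.
Variable V : normedModType R.
Implicit Types (f g : T -> V) (A B : set T).

Lemma cutoff_in A f t : A t -> cutoff A f t = f t.
Proof. by move=> At; rewrite /cutoff indicE mem_set// scale1r. Qed.

Lemma cutoff_out A f t : ~ A t -> cutoff A f t = 0.
Proof. by move=> At; rewrite /cutoff indicE memNset// scale0r. Qed.

Lemma cutoffU A B f : A `&` B = set0 ->
  cutoff (A `|` B) f = cutoff A f + cutoff B f.
Proof.
move=> AB; apply/funext => t; rewrite -[RHS]/(cutoff A f t + cutoff B f t).
have [At|nAt] := pselect (A t).
  have nBt : ~ B t by move=> Bt; have : (A `&` B) t by []; rewrite AB.
  by rewrite (cutoff_out _ nBt) addr0 (cutoff_in _ At) cutoff_in//; left.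
rewrite (cutoff_out _ nAt) add0r; have [Bt|nBt] := pselect (B t).
  by rewrite (cutoff_in _ Bt) cutoff_in//; right.
by rewrite !cutoff_out// => -[].
Qed.

Lemma cutoff_setT f : cutoff setT f = f.
Proof. by apply/funext => t; rewrite cutoff_in. Qed.

Lemma cutoff_lin A (a : R) f g : cutoff A (a *: f + g) = a *: cutoff A f + cutoff A g.
Proof.
apply/funext => t; rewrite -[RHS]/(a *: cutoff A f t + cutoff A g t).
have [At|nAt] := pselect (A t); first by rewrite !cutoff_in.
by rewrite !cutoff_out// scaler0 addr0.
Qed.

Lemma cutoffB A f g : cutoff A (fun t => f t - g t) = (fun t => cutoff A f t - cutoff A g t).
Proof.
apply/funext => t; have [At|nAt] := pselect (A t); first by rewrite !cutoff_in.
by rewrite !cutoff_out// subr0.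
Qed.

End cutoff_lemmas.

(** If the supremum [s] of the values of [l] on pieces of arbitrarily small
    support were positive, two nearly optimal disjoint pieces would give a
    function of norm at most [kappa < 2] on which [l] is close to [2 * s]. *)
Lemma functional_small_sets (V : normedModType R) (l : (T -> V) -> R^o) (e : R) :
  bounded_functional l -> 0 < e -> exists2 dl : R, 0 < dl &
  forall A, measurable A -> (mu A < dl%:E)%E -> forall f, fspace f ->
    `|l (cutoff A f)| <= e * fnorm f.
Proof.
move=> hl e0; have [ll [C C0 lC]] := hl.
have hV := fspace_subspace hrho V.
pose small t dl := exists A f, [/\ measurable A, (mu A < dl%:E)%E, fspace f,
  fnorm f <= 1 & t <= l (cutoff A f)].
suff [dl dl0 hdl] : exists2 dl : R, 0 < dl & ~ small e dl.
  exists dl => // A mA muA.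
  have key f : fspace f -> l (cutoff A f) <= e * fnorm f.
    move=> hf; have [h1 h2] := fspace_cutoff hrho mA hf.
    have [f0|f0] := eqVneq (fnorm f) 0.
      apply: le_trans (ler_norm _) _; apply: le_trans (lC _ h1) _.
      have -> : fnorm (cutoff A f) = 0.
        by apply/eqP; rewrite eq_le (fnorm_ge0 hrho) andbT -f0.
      by rewrite f0 !mulr0.
    have fp : 0 < fnorm f by rewrite lt_neqAle eq_sym f0 (fnorm_ge0 hrho).
    rewrite -ler_pdivrMr// mulrC -[X in X <= _]/((fnorm f)^-1 *: (l (cutoff A f) : R^o)).
    rewrite -(linear_onZ _ hV ll)// leNgt; apply/negP => h; apply: hdl.
    exists A, (fun t => (fnorm f)^-1 *: f t); split=> //.
    - exact: (fspaceZ hrho _ hf).1.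
    - by rewrite (fspaceZ hrho _ hf).2 gtr0_norm ?invr_gt0// mulVf.
    - apply: le_trans (ltW h) _; rewrite le_eqVlt; apply/orP; left; apply/eqP.
      congr l; have := cutoff_lin A (fnorm f)^-1 f 0.
      rewrite addr0 => ->; rewrite -[LHS]addr0; congr (_ + _).
      by apply/funext => t; rewrite /cutoff -[0 t]/(0 : V) scaler0.
  move=> f hf; rewrite ler_norml key// andbT lerNl.
  have h1 := (fspace_cutoff hrho mA hf).1.
  rewrite -(linear_onN hV ll h1).
  have -> : - cutoff A f = cutoff A (- f).
    by apply/funext => t; rewrite /cutoff -[(- f) t]/(- f t) scalerN.
  have <- : fnorm (- f) = fnorm f := seminormN (fnorm_seminorm hrho V) hf.
  by apply: key; exact: subspace_predN.
apply: contrapT => hn.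
pose S := [set t | forall dl : R, 0 < dl -> small t dl].
have Se : S e by move=> dl dl0; apply: contrapT => h; apply: hn; exists dl.
have Sub : ubound S C.
  move=> t /(_ 1 ltr01)[A [f [mA _ hf f1 h]]]; apply: le_trans h _.
  have [h1 h2] := fspace_cutoff hrho mA hf.
  apply: le_trans (ler_norm _) _; apply: le_trans (lC _ h1) _.
  by rewrite -[leRHS]mulr1 ler_wpM2l// (le_trans h2).
have hasS : has_sup S by split; [exists e|exists C].
pose s := sup S.
have s0 : 0 < s by apply: lt_le_trans e0 _; apply: ub_le_sup => //; exists C.
have [kappa kappa2 hk] := rho_smooth.
pose k := Num.max kappa 1.
have k2 : k < 2 by rewrite /k gt_max kappa2 ltr1n.
have k1 : 1 <= k by rewrite /k le_max lexx orbT.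
(* The argument ends with [2 * s - 3 * eta < k * (s + eta)], which this value
   excludes as [k < 2]. *)
pose eta := (2 - k) * s / 5.
have eta0 : 0 < eta by rewrite divr_gt0// mulr_gt0// subr_gt0.
have [dl0 dl00 hdl0] : exists2 dl : R, 0 < dl & ~ small (s + eta) dl.
  apply: contrapT => h.
  have : S (s + eta) by move=> dl dlp; apply: contrapT => hs; apply: h; exists dl.
  move/(ub_le_sup (ex_intro _ C Sub)); rewrite -/s => ?; lra.
(* The first piece is nearly optimal; the support of the second is chosen after
   it, so small that removing it from the first piece costs at most [eta]. *)
have [t St tlt] := sup_adherent eta0 hasS.
have dl1 : 0 < dl0 / 2 by rewrite divr_gt0.
have [A1 [f1 [mA1 muA1 hf1 nf1 t1]]] := St _ dl1.
have C1 : 0 < C + 1 by rewrite ltr_wpDl.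
have [dl2 dl20 hdl2] := fnorm_abs_cont hrho hf1 (divr_gt0 eta0 C1).
have dl3 : 0 < Num.min (dl0 / 2) dl2 by rewrite lt_min dl1.
have [A2 [f2 [mA2 muA2 hf2 nf2 t2]]] := St _ dl3.
have muA21 : (mu A2 < (dl0 / 2)%:E)%E.
  by apply: lt_le_trans muA2 _; rewrite lee_fin ge_min lexx.
have muA22 : (mu A2 < dl2%:E)%E.
  by apply: lt_le_trans muA2 _; rewrite lee_fin ge_min lexx orbT.
have mD : measurable (A1 `\` A2) by exact: measurableD.
have mI : measurable (A1 `&` A2) by exact: measurableI.
pose g1 := cutoff (A1 `\` A2) f1; pose g2 := cutoff A2 f2.
have [hg1 ng1] := fspace_cutoff hrho mD hf1.
have [hg2 ng2] := fspace_cutoff hrho mA2 hf2.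
have [hgI _] := fspace_cutoff hrho mI hf1.
have lI : `|l (cutoff (A1 `&` A2) f1)| < eta.
  have h : fnorm (cutoff (A1 `&` A2) f1) < eta / (C + 1).
    apply: hdl2 => //; apply: le_lt_trans muA22; by apply: le_measure; rewrite ?inE.
  rewrite ltr_pdivlMr// mulrDr mulr1 in h.
  by have := lC _ hgI; have := fnorm_ge0 hrho (cutoff (A1 `&` A2) f1); lra.
have l1 : l (cutoff A1 f1) = l g1 + l (cutoff (A1 `&` A2) f1).
  rewrite -(linear_onD ll)// -cutoffU.
    by rewrite setUC setUIDK.
  by rewrite -subset0 => x [[_ nA2] [_ A2x]].
have hg : fspace (g1 + g2) by exact: subspace_predD.
have ng : fnorm (g1 + g2) <= k.
  apply: (@le_trans _ _ kappa); last by rewrite /k le_max lexx.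
  apply: (fnorm_le hrho).
  have -> : (fun x => `|(g1 + g2) x|) = (fun x => `|g1 x| + `|g2 x|).
    apply/funext => x; rewrite -[(g1 + g2) x]/(g1 x + g2 x).
    have [A2x|nA2x] := pselect (A2 x).
      by rewrite /g1 cutoff_out ?add0r ?normr0 ?add0r// => -[].
    by rewrite /g2 (cutoff_out _ nA2x) addr0 normr0 addr0.
  apply: hk => //; [exact: smeas_measurable_norm hg1.1|
    exact: smeas_measurable_norm hg2.1| | |].
  - move=> x; have [A2x|nA2x] := pselect (A2 x).
      by left; rewrite /g1 cutoff_out ?normr0// => -[].
    by right; rewrite /g2 (cutoff_out _ nA2x) normr0.
  - by rewrite (fspace_fnormE hrho hg1) lee_fin (le_trans ng1).
  - by rewrite (fspace_fnormE hrho hg2) lee_fin (le_trans ng2).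
have kp : 0 < k by apply: lt_le_trans k1.
have lg : l (g1 + g2) < k * (s + eta).
  rewrite ltNge; apply/negP => h; apply: hdl0.
  exists (A1 `|` A2), (k^-1 *: (g1 + g2)); split.
  - exact: measurableU.
  - apply: (@le_lt_trans _ _ (mu A1 + mu A2)%E).
      by apply: measureU2.
    by rewrite [dl0]splitr EFinD; apply: lteD.
  - exact: subspace_predZ.
  - rewrite (fspaceZ hrho _ hg).2 gtr0_norm ?invr_gt0//.
    by rewrite mulrC ler_pdivrMr// mul1r.
  - have -> : cutoff (A1 `|` A2) (k^-1 *: (g1 + g2)) = k^-1 *: (g1 + g2).
      apply/funext => x; have [h12|h12] := pselect ((A1 `|` A2) x).
        by rewrite cutoff_in.
      rewrite cutoff_out// -[RHS]/(k^-1 *: (g1 x + g2 x)) /g1 /g2 !cutoff_out.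
      + by rewrite addr0 scaler0.
      + by move=> A2x; apply: h12; right.
      + by move=> [A1x _]; apply: h12; left.
    rewrite (linear_onZ _ hV ll)// -[leRHS]/(k^-1 * l (g1 + g2)).
    by rewrite mulrC ler_pdivlMr// mulrC.
rewrite (linear_onD ll) in lg => //.
have h1 : l g1 + l g2 > 2 * s - 3 * eta.
  rewrite -/s in tlt; have := ler_norm (l (cutoff (A1 `&` A2) f1)); lra.
have h2 : k * (s + eta) <= k * s + 2 * eta by rewrite mulrDr lerD2l ler_wpM2r// ltW.
have h3 : 5 * eta = 2 * s - k * s.
  by rewrite /eta mulrC divfK ?pnatr_eq0// mulrBl.
lra.
Qed.

End weak_compactness.

Section real_sequences.
Context (R : realType).

Lemma eq_seq_cvg (u v : nat -> R) (a : R) : u =1 v ->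
  v n @[n --> \oo] --> a -> u n @[n --> \oo] --> a.
Proof. by move=> /funext ->. Qed.

Lemma cvg_sub_zero (u : nat -> R) (a : R) :
  u n @[n --> \oo] --> a <-> u n - a @[n --> \oo] --> (0 : R).
Proof.
split=> /cvgrPdist_lt h; apply/cvgrPdist_lt => e /h [N _ hN]; exists N => // n Nn.
  by rewrite sub0r normrN distrC; exact: hN.
by have := hN n Nn; rewrite sub0r normrN distrC.
Qed.

Lemma cvg_sum0 n (a : nat -> nat -> R) : (forall i, a i k @[k --> \oo] --> (0 : R)) ->
  \sum_(i < n) a i k @[k --> \oo] --> (0 : R).
Proof.
move=> ha; elim: n => [|n IH].
  by apply: (@eq_seq_cvg _ (fun=> 0)); [move=> k; rewrite big_ord0|exact: cvg_cst].
apply: (@eq_seq_cvg _ (fun k => \sum_(i < n) a i k + a n k)).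
  by move=> k; rewrite big_ord_recr.
have h : (fun k => \sum_(i < n) a i k) k + a n k @[k --> \oo] --> (0 + 0 : R).
  by apply: cvgD => //; exact: ha.
by rewrite addr0 in h.
Qed.

End real_sequences.

Section weak_convergence.
Context d (T : measurableType d) (R : realType).
Variable mu : {finite_measure set T -> \bar R}.
Variable rho : (T -> R) -> \bar R.
Hypothesis hrho : function_norm mu rho.
Hypothesis rho_smooth : disjointly_smooth rho.

Local Notation fspace := (fspace rho).
Local Notation fnorm := (fnorm rho).
Local Notation bounded_functional := (bounded_functional rho).

Lemma Rintegral_cutoff A (g : T -> R^o) :
  \int[mu]_t cutoff A g t = \int[mu]_(t in A) g t.
Proof.
rewrite [RHS]Rintegral_mkcond; congr Rintegral; apply/funext => t.
rewrite /patch; case: ifPn => [/set_mem At|/negP At]; first by rewrite cutoff_in.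
by rewrite cutoff_out// => /mem_set.
Qed.

Lemma fspace_norm (V : normedModType R) (f : T -> V) : fspace f ->
  fspace (fun t => `|f t| : R^o) /\ fnorm (fun t => `|f t| : R^o) = fnorm f.
Proof.
move=> hf; have E : (fun t => `|(`|f t| : R^o)|) = (fun t => `|f t|).
  by apply/funext => t; rewrite normr_id.
split; last by rewrite /fnorm E.
split; last by rewrite E; exact: hf.2.
by apply: smeas_comp hf.1; exact: norm_continuous.
Qed.

Lemma fspace_integrable (f : T -> R^o) : fspace f -> integrable_fun mu f.
Proof.
move=> hf; have [c c0 hc] := fspace_L1 hrho.
apply: (@integrable_fun_le _ _ _ mu f (fun t => `|f t|)) => //.
  exact: smeas_measurable hf.1.
exact: (hc _ f hf).1.
Qed.

Lemma integral_functional :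
  bounded_functional (fun f : T -> R^o => \int[mu]_t f t : R^o).
Proof.
split=> [a f g hf hg|].
  exact: (Rintegral_lin a measurableT (fspace_integrable hf) (fspace_integrable hg)).
have [c c0 hc] := fspace_L1 hrho; exists c; first exact: ltW.
move=> f hf; have [h1 h2] := hc _ f hf.
apply: le_trans h2; apply: le_normr_Rintegral => //.
exact: fspace_integrable.
Qed.

(** Uniform integrability of the unit ball: this is [functional_small_sets] for
    the functional that integrates norms. *)
Lemma small_set_integral (e : R) : 0 < e -> exists2 dl : R, 0 < dl &
  forall A, measurable A -> (mu A < dl%:E)%E ->
  forall (V : normedModType R) (f : T -> V), fspace f ->
    \int[mu]_(t in A) `|f t| <= e * fnorm f.
Proof.
move=> e0; have [dl dl0 h] := functional_small_sets hrho rho_smooth integral_functional e0.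
exists dl => // A mA muA V f hf; have [h1 h2] := fspace_norm hf.
rewrite -h2 -Rintegral_cutoff; apply: le_trans (h A mA muA _ h1).
exact: ler_norm.
Qed.

Section dual.
Variable Y : normedModType R.

Lemma dual_continuous (u : Y -> R^o) : bounded_dual u -> continuous u.
Proof.
move=> [lu [C C0 hC]] y; apply/cvgrPdist_lt => e e0.
have C1 : 0 < C + 1 by rewrite ltr_wpDl.
have e1 : 0 < e / (C + 1) by rewrite divr_gt0.
near=> z.
have h : `|y - z| < e / (C + 1).
  by near: z; apply: cvgr_dist_lt => //; exact: cvg_id.
rewrite ltr_pdivlMr// mulrDr mulr1 in h.
rewrite -(linear_onB (@setT_subspace _ Y) lu)//.
by apply: le_lt_trans (hC _) _; have := normr_ge0 (y - z); lra.
Unshelve. all: by end_near. Qed.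

Lemma dual_integrable (u : Y -> R^o) (g : T -> Y) : bounded_dual u -> fspace g ->
  integrable_fun mu (fun t => u (g t)).
Proof.
move=> hu hg; have [_ [C C0 hC]] := hu.
have [c c0 hc] := fspace_L1 hrho.
apply: (@integrable_fun_le _ _ _ mu _ (fun t => C * `|g t|)) => //.
  apply: smeas_measurable; apply: smeas_comp hg.1; exact: dual_continuous.
by apply: integrable_funZ; exact: (hc _ g hg).1.
Qed.

Lemma norm_integrable (g : T -> Y) : fspace g -> integrable_fun mu (fun t => `|g t|).
Proof. by move=> hg; have [c _ hc] := fspace_L1 hrho; exact: (hc _ g hg).1. Qed.

Lemma dual_integral_le (u : Y -> R^o) (g : T -> Y) A M : measurable A ->
  bounded_dual u -> fspace g -> (forall t, A t -> `|u (g t)| <= M * `|g t|) ->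
  `|\int[mu]_(t in A) u (g t)| <= M * \int[mu]_(t in A) `|g t|.
Proof.
move=> mA hu hg hM; have ig := norm_integrable hg.
rewrite -RintegralZl//; last exact: integrable_fun_on.
apply: Rintegral_norm_le => //; first exact: dual_integrable.
exact: integrable_funZ.
Qed.

Lemma dual_integralB (u : Y -> R^o) (f g : T -> Y) A : measurable A ->
  bounded_dual u -> fspace f -> fspace g ->
  \int[mu]_(t in A) u (f t - g t) =
  \int[mu]_(t in A) u (f t) - \int[mu]_(t in A) u (g t).
Proof.
move=> mA hu hf hg.
rewrite -RintegralB//; try by apply: integrable_fun_on => //; exact: dual_integrable.
by apply: eq_Rintegral => t _; rewrite (linear_onB (@setT_subspace _ Y) hu.1).
Qed.

End dual.

Lemma linear_on_sum (X W : lmodType R) (E : set X) (f : X -> W) n (z : nat -> X) :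
  subspace_pred E -> linear_on E f -> (forall j, E (z j)) ->
  E (\sum_(j < n) z j) /\ f (\sum_(j < n) z j) = \sum_(j < n) f (z j).
Proof.
move=> hE lf hz; elim: n => [|n [IH1 IH2]].
  by rewrite !big_ord0; split; [exact: hE.1|exact: linear_on0 hE lf].
rewrite !big_ord_recr/=; split; first exact: subspace_predD.
by rewrite (linear_onD lf)// IH2.
Qed.

Lemma sum_fct_apply (V : normedModType R) n (z : nat -> T -> V) t :
  (\sum_(j < n) z j) t = \sum_(j < n) z j t.
Proof.
elim: n => [|n IH]; first by rewrite !big_ord0.
by rewrite !big_ord_recr/= -IH.
Qed.

Lemma selector_cutoff_sum (V : normedModType R) m (p : T -> nat) (A : set T) (z : nat -> V) : selector m p ->
  \sum_(j < m.+1) cutoff (A `&` p @^-1` [set val j]) (fun=> z j) =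
  cutoff A (fun t => z (p t)).
Proof.
move=> [pm _]; apply/funext => t.
rewrite (sum_fct_apply m.+1 (fun j => cutoff (A `&` p @^-1` [set j]) (fun=> z j))).
have jm : (p t < m.+1)%N by rewrite ltnS.
rewrite (bigD1 (Ordinal jm))//= big1 ?addr0 => [|i ij].
  have [At|nAt] := pselect (A t); first by rewrite !cutoff_in.
  by rewrite !cutoff_out// => -[].
rewrite cutoff_out// => -[_ /= e]; move/eqP: ij; apply.
by apply: val_inj; rewrite /= e.
Qed.

Lemma functional_selector_sum (V : normedModType R) (l : (T -> V) -> R^o) m
  (p : T -> nat) (A : set T)
  (z : nat -> V) : bounded_functional l -> selector m p -> measurable A ->
  l (cutoff A (fun t => z (p t))) =
  \sum_(j < m.+1) l (cutoff (A `&` p @^-1` [set val j]) (fun=> z j)).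
Proof.
move=> [ll _] sp mA; rewrite -(selector_cutoff_sum A z sp).
apply: (linear_on_sum m.+1 (fspace_subspace hrho V) ll
  (z := fun j => cutoff (A `&` p @^-1` [set j]) (fun=> z j)) _).2 => j.
by apply: (fspace_cutoff hrho _ (fspace_cst hrho _)).1; apply: measurableI => //; exact: sp.2.
Qed.

Section reflexive_target.
Variable Y : normedModType R.
Variables (x_ : nat -> Y) (e_ : nat -> Y -> R^o).
Hypothesis xQ : rat_closed x_.
Hypothesis eD : forall i, bounded_dual (e_ i).
Hypothesis e_dense : forall u, bounded_dual u -> forall eps : R, 0 < eps ->
  exists i, span_gauge x_ (u - e_ i) < eps.

(** By [functional_small_sets] the map from [A] and [x] to the value of [l] at
    [cutoff A (fun=> x)] satisfies the hypotheses of [integral_kernel] on the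
    closed span of the [x_ j]; the functionals on this span extend to [Y]. *)
Lemma functional_kernel (l : (T -> Y) -> R^o) : bounded_functional l ->
  exists L : T -> Y -> R^o,
    [/\ forall t, exists2 u, bounded_dual u & forall j, u (x_ j) = L t (x_ j),
      forall j, measurable_fun setT (fun t => L t (x_ j)) &
      forall j, integrable_fun mu (fun t => L t (x_ j)) /\ forall A, measurable A ->
        l (cutoff A (fun=> x_ j)) = \int[mu]_(t in A) L t (x_ j)].
Proof.
move=> hl; have [ll [C C0 lC]] := hl.
have hsp := span_closure_subspace xQ.
have hsn : seminorm_on (span_closure x_) (fun y : Y => `|y|).
  by split=> [x y _ _|a x _]; [exact: ler_normD|exact: normrZ].
have hcst A (y : Y) : measurable A -> fspace (cutoff A (fun=> y)).
  by move=> mA; exact: (fspace_cutoff hrho mA (fspace_cst hrho y)).1.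
pose lam A (y : Y) : R^o := l (cutoff A (fun=> y)).
have [||||L [L1 L2 L3 L4]] := @integral_kernel _ _ _ mu Y (span_closure x_)
  (fun y => `|y|) x_ lam (C * fnorm (fun=> 1 : R^o)) hsp hsn
  (@span_closure_gen _ _ x_) xQ (fun y hy => (span_closureP x_ y).1 hy)
  _ _ _ _.
- move=> A mA a x y _ _; rewrite /lam.
  rewrite -ll; [|exact: hcst|exact: hcst].
  by congr l; exact: (cutoff_lin A a (fun=> x) (fun=> y)).
- move=> x _ A B mA mB AB; rewrite /lam cutoffU// (linear_onD ll)//; exact: hcst.
- move=> x _ e e0; have n0 : 0 < fnorm (fun=> x) + 1.
    by rewrite ltr_wpDl// (fnorm_ge0 hrho).
  have [dl dl0 hdl] := functional_small_sets hrho rho_smooth hl (divr_gt0 e0 n0).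
  exists dl => // A mA muA; apply: le_trans (hdl A mA muA _ (fspace_cst hrho x)) _.
  by rewrite mulrAC ler_pdivrMr// ler_wpM2l ?(ltW e0)// lerDl.
- move=> m p A z sp mA hz.
  rewrite -[X in X <= _](functional_selector_sum z hl sp mA).
  apply: le_trans (ler_norm _) _.
  have [||h1 h2] := @fspace_bounded _ _ _ _ _ hrho Y (cutoff A (fun t => z (p t))) 1.
  + apply: smeas_cutoff => //; apply: smeas_simple.
    exact: (simple_map_comp z (selector_simple sp)).
  + by move=> t; apply: le_trans (cutoff_le _ _ _) _; exact: (hz _).2.
  rewrite mul1r in h2; apply: le_trans (lC _ h1) _; exact: ler_wpM2l.
- exists L; split=> [t|j|j].
  + have [c c0 Lc] := L2 t.
    have [u [hu _ uL]] := dual_extension xQ c0 (L1 t) Lc.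
    by exists u => // j; apply: uL; exact: span_closure_gen.
  + by apply: smeas_measurable; apply: L3; exact: span_closure_gen.
  + by apply: L4; exact: span_closure_gen.
Qed.

(** For a selection from the [x_ j] both sides are finite sums of integrals over
    pieces on which the index is constant; these selections are dense among the
    functions with values in the closed span. *)
Lemma functional_near_dual (l : (T -> Y) -> R^o) (L : T -> Y -> R^o)
  (u : Y -> R^o) (eps : R) A (g : T -> Y) :
  bounded_functional l ->
  (forall j, integrable_fun mu (fun t => L t (x_ j)) /\ forall A, measurable A ->
     l (cutoff A (fun=> x_ j)) = \int[mu]_(t in A) L t (x_ j)) ->
  bounded_dual u -> 0 <= eps -> measurable A ->
  (forall t j, A t -> `|L t (x_ j) - u (x_ j)| <= eps * `|x_ j|) ->
  fspace g -> (forall t, span_closure x_ (g t)) ->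
  `|l (cutoff A g) - \int[mu]_(t in A) u (g t)| <= eps * \int[mu]_(t in A) `|g t|.
Proof.
move=> hl hL hu eps0 mA Lu hg gS; have [ll [C C0 lC]] := hl.
have hV := fspace_subspace hrho Y.
have simple m p : selector m p -> fspace (fun t => x_ (p t)) ->
    `|l (cutoff A (fun t => x_ (p t))) - \int[mu]_(t in A) u (x_ (p t))| <=
    eps * \int[mu]_(t in A) `|x_ (p t)|.
  move=> sp hp; have ip := norm_integrable hp.
  have mAp j : measurable (A `&` p @^-1` [set j]).
    by apply: measurableI => //; exact: sp.2.
  rewrite (functional_selector_sum x_ hl sp mA).
  rewrite (Rintegral_selector sp mA (dual_integrable hu hp)) -sumrB.
  rewrite (Rintegral_selector sp mA ip) mulr_sumr.
  apply: le_trans (ler_norm_sum _ _ _) _; apply: ler_sum => j _.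
  have -> : \int[mu]_(t in A `&` p @^-1` [set val j]) u (x_ (p t)) =
      \int[mu]_(t in A `&` p @^-1` [set val j]) (fun=> u (x_ j)) t.
    by apply: eq_Rintegral => t /set_mem [_ /= ->].
  have -> : \int[mu]_(t in A `&` p @^-1` [set val j]) `|x_ (p t)| =
      \int[mu]_(t in A `&` p @^-1` [set val j]) (fun=> `|x_ j|) t.
    by apply: eq_Rintegral => t /set_mem [_ /= ->].
  rewrite (hL j).2//.
  have ic (c : R) : integrable_fun mu (fun=> c) by exact: integrable_fun_cst.
  rewrite -RintegralB//; [|by apply: integrable_fun_on => //; exact: (hL j).1
    |by apply: integrable_fun_on].
  rewrite -RintegralZl//; last exact: integrable_fun_on.
  apply: Rintegral_norm_le => //.
  - apply: integrable_funD; first exact: (hL j).1.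
    exact: (ic (- u (x_ j))).
  - by move=> t [At _]; exact: Lu.
have [s [ss hs _ cs]] := dense_approx hrho hg
  (fun t => (span_closureP x_ (g t)).1 (gS t)) (rat_closed0 xQ).
have [c c0 hc] := fspace_L1 hrho; have [_ [M M0 uM]] := hu.
pose K := C + M * c + eps * c.
have K0 : 0 <= K by rewrite /K !addr_ge0// mulr_ge0// ltW.
apply/ler_addgt0Pr => r r0.
have K1 : 0 < K + 1 by rewrite ltr_wpDl.
have [N /(_ N (leqnn N))] := cvg_real_lt cs (divr_gt0 r0 K1).
set q := fun t => x_ (s N t); set del := fnorm _ => hdel.
have hq : fspace q by exact: hs.
have hgq := (fspaceB hrho hg hq).1.
have del0 : 0 <= del by exact: (fnorm_ge0 hrho).
rewrite ger0_norm// ltr_pdivlMr// mulrDr mulr1 in hdel.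
have h1 : `|l (cutoff A g) - l (cutoff A q)| <= C * del.
  rewrite -(linear_onB hV ll (fspace_cutoff hrho mA hg).1 (fspace_cutoff hrho mA hq).1).
  have [k1 k2] := fspace_cutoff hrho mA hgq.
  have := lC _ k1; rewrite cutoffB => /le_trans; apply; apply: ler_wpM2l => //.
  by rewrite -cutoffB.
have h2 : `|\int[mu]_(t in A) u (g t) - \int[mu]_(t in A) u (q t)| <= M * (c * del).
  rewrite -dual_integralB//; apply: le_trans (dual_integral_le mA hu hgq _) _.
    by move=> t _; exact: uM.
  apply: ler_wpM2l => //; apply: le_trans (hc _ _ hgq).2.
  by apply: Rintegral_subset_le => //; exact: norm_integrable.
have h3 : \int[mu]_(t in A) `|q t| <= \int[mu]_(t in A) `|g t| + c * del.
  apply: (@le_trans _ _ (\int[mu]_(t in A) (`|g t| + `|g t - q t|))).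
    apply: le_Rintegral => //.
    - by apply: integrable_fun_on => //; exact: norm_integrable.
    - apply: integrable_fun_on => //; apply: integrable_funD; exact: norm_integrable.
    - move=> t _; rewrite [leRHS]addrC (distrC (g t)) -{1}(subrK (g t) (q t)).
      exact: ler_normD.
  rewrite RintegralD//; try by apply: integrable_fun_on => //; exact: norm_integrable.
  rewrite lerD2l; apply: le_trans (hc _ _ hgq).2.
  by apply: Rintegral_subset_le => //; exact: norm_integrable.
have h4 := simple _ _ (ss N) hq; rewrite -/q in h4.
have h5 := ler_wpM2l eps0 h3; rewrite mulrDr in h5.
have E : l (cutoff A g) - \int[mu]_(t in A) u (g t) =
    (l (cutoff A g) - l (cutoff A q)) +
    ((l (cutoff A q) - \int[mu]_(t in A) u (q t)) -
     (\int[mu]_(t in A) u (g t) - \int[mu]_(t in A) u (q t))) by lra.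
rewrite E; apply: le_trans (ler_normD _ _) _.
have h6 := ler_normB (l (cutoff A q) - \int[mu]_(t in A) u (q t))
     (\int[mu]_(t in A) u (g t) - \int[mu]_(t in A) u (q t)).
have h7 : C * del + M * (c * del) + eps * (c * del) = del * K by rewrite /K; ring.
rewrite /q in h1 h2 h4 h5 h6 *; lra.
Qed.

Lemma nat_tail_small (I : T -> nat) (e : R) : (forall m, measurable [set t | (m <= I t)%N]) ->
  0 < e -> exists m, (mu [set t | (m <= I t)%N] < e%:E)%E.
Proof.
move=> mI e0; pose B m := [set t | (m <= I t)%N].
have : mu (B m) @[m --> \oo] --> mu (\bigcap_m B m).
  apply: nonincreasing_cvg_mu => //.
  - by rewrite ltey_eq fin_num_measure//; exact: mI.
  - by apply: bigcap_measurable => // m _; exact: mI.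
  - by move=> m n mn; apply/subsetPset => t /=; exact: leq_trans.
rewrite [X in mu X](_ : _ = set0) ?measure0; last first.
  by rewrite -subset0 => t /(_ (I t).+1 Logic.I); rewrite /B /= ltnn.
move=> h; have : \forall m \near \oo, (mu (B m) < e%:E)%E.
  by apply: (h [set x | (x < e%:E)%E]); exact: nbhs_open_ereal_lt.
by move=> [m _ /(_ m (leqnn m)) hm]; exists m.
Qed.

(** The density of [l] is approximated by a function with countably many values:
    at [t] by the first [e_ i] within [e] of it.  The points of large index form a
    set of small measure, to which [functional_small_sets] applies, and on each
    of the finitely many other pieces [l] is close to the integration against
    [e_ i]. *)
Lemma setwise_weak_null (g : nat -> T -> Y) (C : R) :
  (forall n, fspace (g n)) -> (forall n, fnorm (g n) <= C) ->
  (forall n t, span_closure x_ (g n t)) ->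
  (forall A i, measurable A -> \int[mu]_(t in A) e_ i (g n t) @[n --> \oo] --> (0 : R)) ->
  forall l, bounded_functional l -> l (g n) @[n --> \oo] --> (0 : R).
Proof.
move=> hg gC gS gA l hl; have [ll [Cl Cl0 lC]] := hl.
have hV := fspace_subspace hrho Y.
have C0 : 0 <= C by apply: le_trans (gC 0%N); exact: (fnorm_ge0 hrho).
have [L [Lu Lm Li]] := functional_kernel hl.
have [c c0 hc] := fspace_L1 hrho.
suff key (e : R) : 0 < e -> exists N, forall n, (N <= n)%N ->
    `|l (g n)| <= e * (C + c * C + 1).
  have K0 : 0 < C + c * C + 1 by rewrite ltr_wpDl// addr_ge0// mulr_ge0// ltW.
  apply/cvgrPdist_le => e e0; have [N hN] := key _ (divr_gt0 e0 K0).
  exists N => // n /= Nn; rewrite sub0r normrN.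
  by have := hN n Nn; rewrite divfK// gt_eqF.
move=> e0.
pose B i := [set t | forall j, `|L t (x_ j) - e_ i (x_ j)| <= e * `|x_ j|].
have mB i : measurable (B i).
  rewrite (_ : B i = \bigcap_j [set t | `|L t (x_ j) - e_ i (x_ j)| <= e * `|x_ j|]).
    apply: bigcap_measurable => // j _; apply: measurable_le_set => //.
    by apply: measurableT_comp => //; apply: measurable_funB.
  by apply/seteqP; split=> [t h j _|t h j]; [exact: h|exact: (h j)].
have Bex t : exists i, `[< B i t >].
  have [u hu uL] := Lu t; have [i hi] := e_dense hu e0.
  exists i; apply/asboolP => j; rewrite -uL.
  have hD := subspace_predB (bounded_dual_subspace Y) hu (eD i).
  apply: le_trans (span_gauge_ub x_ j hD) _.
  by rewrite ler_wpM2r// ltW.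
pose I t := ex_minn (Bex t).
have IB t : B (I t) t by rewrite /I; case: ex_minnP => i /asboolP.
have mI m : measurable [set t | (m <= I t)%N].
  rewrite (_ : [set t | (m <= I t)%N] = ~` \bigcup_(i in [set i | (i < m)%N]) B i).
    by apply: measurableC; apply: bigcup_measurable => i _.
  apply/seteqP; split=> t /=.
    move=> mI [i /= im Bit]; move: mI; rewrite /I; case: ex_minnP => k _ /(_ i).
    by move/asboolP: Bit => /[swap] /[apply] ki /leq_trans/(_ ki); rewrite leqNgt im.
  move=> h; rewrite leqNgt; apply/negP => Im; apply: h.
  by exists (I t) => //; exact: IB.
have mIe m : measurable [set t | I t = m].
  rewrite (_ : [set t | I t = m] = [set t | (m <= I t)%N] `\` [set t | (m.+1 <= I t)%N]).
    exact: measurableD.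
  apply/seteqP; split=> t /=; first by move=> ->; rewrite leqnn ltnn.
  by move=> [h1 /negP]; rewrite -leqNgt => h2; apply/eqP; rewrite eqn_leq h2.
have split_l m f : fspace f -> l f =
    \sum_(i < m) l (cutoff [set t | I t = i] f) + l (cutoff [set t | (m <= I t)%N] f).
  move=> hf; elim: m => [|m ->].
    rewrite big_ord0 add0r (_ : [set t | (0 <= I t)%N] = setT) ?cutoff_setT//.
    by apply/seteqP; split.
  rewrite big_ord_recr/= -addrA; congr (_ + _).
  rewrite -(linear_onD ll); [|exact: (fspace_cutoff hrho _ hf).1..].
  rewrite -cutoffU.
    congr (l (cutoff _ f)); apply/seteqP; split=> t /=.
      by rewrite leq_eqVlt => /predU1P[->|]; [left|right].
    by case=> [->//|]; exact: ltnW.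
  by rewrite -subset0 => t [/= ->]; rewrite ltnn.
have [dl dl0 hdl] := functional_small_sets hrho rho_smooth hl e0.
have [m hm] := nat_tail_small mI dl0.
have hfin : \sum_(i < m) `|\int[mu]_(t in [set t | I t = i]) e_ i (g n t)|
    @[n --> \oo] --> (0 : R).
  apply: (cvg_sum0 m (a := fun i n => `|\int[mu]_(t in [set t | I t = i]) e_ i (g n t)|)).
  by move=> i; rewrite -(@normr0 _ R); apply: cvg_norm; exact: gA.
have [N hN] := cvg_real_lt hfin e0.
exists N => n Nn; rewrite (split_l m (g n) (hg n)).
apply: le_trans (ler_normD _ _) _.
have k1 : `|l (cutoff [set t | (m <= I t)%N] (g n))| <= e * C.
  by apply: le_trans (hdl _ (mI m) hm _ (hg n)) _; apply: ler_wpM2l => //; exact: ltW.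
have k2 i : `|l (cutoff [set t | I t = i] (g n))| <=
    `|\int[mu]_(t in [set t | I t = i]) e_ i (g n t)| +
    e * \int[mu]_(t in [set t | I t = i]) `|g n t|.
  have Li' t j : [set t | I t = i] t -> `|L t (x_ j) - e_ i (x_ j)| <= e * `|x_ j|.
    by move=> /= <-; exact: IB.
  have h := functional_near_dual hl Li (eD i) (ltW e0) (mIe i) Li' (hg n) (gS n).
  by rewrite -lerBlDl; apply: le_trans h; exact: lerB_dist.
have k3 : \sum_(i < m) (e * \int[mu]_(t in [set t | I t = i]) `|g n t|) <= e * (c * C).
  rewrite -mulr_sumr; apply: ler_wpM2l; first exact: ltW.
  have ig := norm_integrable (hg n).
  apply: (@le_trans _ _ (\int[mu]_(t in [set t | (I t < m)%N]) `|g n t|)).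
    elim: m {hm hfin hN k1} => [|m IH].
      by rewrite big_ord0; apply: Rintegral_ge0.
    rewrite big_ord_recr/= (_ : [set t | (I t < m.+1)%N] =
      [set t | (I t < m)%N] `|` [set t | I t = m]).
      rewrite Rintegral_disjointU//; first by rewrite lerD2r.
        rewrite (_ : [set t | (I t < m)%N] = ~` [set t | (m <= I t)%N]).
          exact: measurableC.
        by apply/seteqP; split=> t /=; rewrite ltnNge => /negP.
      by rewrite -subset0 => t [/= + It]; rewrite It ltnn.
    apply/seteqP; split=> t /=.
      by rewrite ltnS leq_eqVlt => /predU1P[->|]; [right|left].
    by case=> [/ltnW//|->].
  apply: (@le_trans _ _ (\int[mu]_t `|g n t|)).
    apply: Rintegral_subset_le => //.
    rewrite (_ : [set t | (I t < m)%N] = ~` [set t | (m <= I t)%N]).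
      exact: measurableC.
    by apply/seteqP; split=> t /=; rewrite ltnNge => /negP.
  by apply: le_trans (hc _ _ (hg n)).2 _; rewrite ler_wpM2l// ltW.
have k4 : `|\sum_(i < m) l (cutoff [set t | I t = i] (g n))| <=
    \sum_(i < m) `|\int[mu]_(t in [set t | I t = i]) e_ i (g n t)| + e * (c * C).
  apply: le_trans (ler_norm_sum _ _ _) _; apply: le_trans (ler_sum _ (fun i _ => k2 (val i))) _.
  by rewrite big_split/= lerD2l.
have k5 := le_lt_trans (ler_norm _) (hN n Nn).
have -> : e * (C + c * C + 1) = e * C + e * (c * C) + e by ring.
lra.
Qed.

Lemma setwise_weak_cvg (f : nat -> T -> Y) (h : T -> Y) (C : R) :
  (forall n, fspace (f n)) -> (forall n, fnorm (f n) <= C) -> fspace h ->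
  (forall n t, span_closure x_ (f n t)) -> (forall t, span_closure x_ (h t)) ->
  (forall A i, measurable A ->
     \int[mu]_(t in A) e_ i (f n t) @[n --> \oo] --> \int[mu]_(t in A) e_ i (h t)) ->
  forall l, bounded_functional l -> l (f n) @[n --> \oo] --> l h.
Proof.
move=> hf fC hh fS hS fA l hl; have [ll _] := hl.
apply: (cvg_sub_zero (fun n => l (f n)) _).2.
apply: (@eq_seq_cvg _ _ (fun n => l (f n - h))).
  by move=> n; rewrite (linear_onB (fspace_subspace hrho Y) ll).
apply: (@setwise_weak_null (fun n => f n - h) (C + fnorm h)) => // [n|n|n t|A i mA].
- exact: (fspaceB hrho (hf n) hh).1.
- by apply: le_trans (fspaceB hrho (hf n) hh).2 _; rewrite lerD2r.
- exact: (subspace_predB (span_closure_subspace xQ)).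
- apply: (@eq_seq_cvg _ _ (fun n => \int[mu]_(t in A) e_ i (f n t) -
      \int[mu]_(t in A) e_ i (h t))).
    by move=> n; rewrite -dual_integralB.
  exact: ((cvg_sub_zero (fun n => \int[mu]_(t in A) e_ i (f n t)) _).1 (fA A i mA)).
Qed.

End reflexive_target.
End weak_convergence.

Section weak_compactness_theorem.
Context d (T : measurableType d) (R : realType).
Variable mu : {finite_measure set T -> \bar R}.
Variable rho : (T -> R) -> \bar R.
Hypothesis hrho : function_norm mu rho.
Hypothesis rho_smooth : disjointly_smooth rho.

Local Notation fspace := (fspace rho).
Local Notation fnorm := (fnorm rho).
Local Notation bounded_functional := (bounded_functional rho).

Lemma seq_cvg_of_approx (u : nat -> R) : (forall e : R, 0 < e ->
    exists v : nat -> R, (exists a : R, v n @[n --> \oo] --> a) /\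
      forall n, `|u n - v n| <= e) ->
  exists a : R, u n @[n --> \oo] --> a.
Proof.
move=> hu; have cR : seq_complete (R^o : normedModType R).
  exact: (@complete_seq_complete R R^o).
apply: (cR u) => e e0; have e40 : 0 < e / 4 by rewrite divr_gt0.
have [v [[a /cvgrPdist_lt/(_ _ e40)[N _ hN]] huv]] := hu _ e40.
exists N => n m Nn Nm.
have h1 := hN n Nn; have h2 := hN m Nm; have h3 := huv n; have h4 := huv m.
have -> : u n - u m = (u n - v n) + (((v n - a) + (a - v m)) - (u m - v m)) by ring.
have k1 := ler_normD (u n - v n) (((v n - a) + (a - v m)) - (u m - v m)).
have k2 := ler_normB ((v n - a) + (a - v m)) (u m - v m).
have k3 := ler_normD (v n - a) (a - v m).
rewrite /= distrC in h1; rewrite /= in h2; lra.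
Qed.

Lemma cvg_abs_le (u : nat -> R) (a c : R) : u n @[n --> \oo] --> a ->
  (forall n, `|u n| <= c) -> `|a| <= c.
Proof.
move=> ua uc; rewrite -[a]subr0.
apply: (@cvg_normr_le _ R^o u a 0 c ua) => e e0; exists 0%N => n _.
by rewrite subr0; apply: le_trans (uc n) _; rewrite lerDl ltW.
Qed.

Variable Y : normedModType R.
Variables (x_ : nat -> Y) (e_ : nat -> Y -> R^o).
Hypothesis xQ : rat_closed x_.
Hypothesis eD : forall i, bounded_dual (e_ i).
Hypothesis eQ : rat_closed e_.
Hypothesis e_dense : forall u, bounded_dual u -> forall eps : R, 0 < eps ->
  exists i, span_gauge x_ (u - e_ i) < eps.
Hypothesis e_norming : forall j, exists i,
  (forall y, `|e_ i y| <= `|y|) /\ e_ i (x_ j) = `|x_ j|.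
Variables (f : nat -> T -> Y) (C : R).
Hypothesis hf : forall n, fspace (f n).
Hypothesis fC : forall n, fnorm (f n) <= C.
Hypothesis fS : forall n t, span_closure x_ (f n t).

Let C0 : 0 <= C. Proof. by apply: le_trans (fC 0%N); exact: (fnorm_ge0 hrho). Qed.

Let hD := bounded_dual_subspace Y.

Lemma dual_integral_gauge u n A : measurable A -> bounded_dual u ->
  `|\int[mu]_(t in A) u (f n t)| <=
  span_gauge x_ u * \int[mu]_(t in A) `|f n t|.
Proof.
by move=> mA hu; apply: (dual_integral_le hrho) => // t _; exact: span_gauge_closure.
Qed.

(** Two steps of approximation: from the sets [A_ j] to all sets by uniform
    integrability, and from the [e_ i] to the whole dual by density. *)
Lemma setwise_limit (A_ : nat -> set T) : (forall j, measurable (A_ j)) ->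
  (forall A, measurable A -> forall e : R, 0 < e -> exists j,
     (mu ((A `\` A_ j) `|` (A_ j `\` A)) < e%:E)%E) ->
  (forall i j, exists a : R, \int[mu]_(t in A_ j) e_ i (f n t) @[n --> \oo] --> a) ->
  forall A u, measurable A -> bounded_dual u ->
    exists a : R, \int[mu]_(t in A) u (f n t) @[n --> \oo] --> a.
Proof.
move=> mA_ Ad hcv.
have step1 A i : measurable A ->
    exists a : R, \int[mu]_(t in A) e_ i (f n t) @[n --> \oo] --> a.
  move=> mA; apply: seq_cvg_of_approx => e e0.
  have g0 := span_gauge_ge0 x_ (eD i).
  have D0 : 0 < 2 * (span_gauge x_ (e_ i) * C) + 1.
    by rewrite ltr_wpDl// mulr_ge0// mulr_ge0.
  have [dl dl0 hdl] := small_set_integral hrho rho_smooth (divr_gt0 e0 D0).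
  have [j hj] := Ad A mA dl dl0.
  exists (fun n => \int[mu]_(t in A_ j) e_ i (f n t)); split=> // n.
  have mD1 : measurable (A `\` A_ j) by exact: measurableD.
  have mD2 : measurable (A_ j `\` A) by exact: measurableD.
  have mI : measurable (A `&` A_ j) by exact: measurableI.
  have ie := dual_integrable hrho (eD i) (hf n).
  have -> : \int[mu]_(t in A) e_ i (f n t) = \int[mu]_(t in A `&` A_ j) e_ i (f n t) +
      \int[mu]_(t in A `\` A_ j) e_ i (f n t).
    by rewrite -Rintegral_disjointU ?setUIDK// -subset0 => t [[_ h] [_ /(_ h)]].
  have -> : \int[mu]_(t in A_ j) e_ i (f n t) = \int[mu]_(t in A `&` A_ j) e_ i (f n t) +
      \int[mu]_(t in A_ j `\` A) e_ i (f n t).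
    rewrite setIC -Rintegral_disjointU ?setUIDK//; first exact: measurableI.
    by rewrite -subset0 => t [[_ h] [_ /(_ h)]].
  rewrite opprD addrACA subrr add0r.
  have sm B : measurable B -> B `<=` (A `\` A_ j) `|` (A_ j `\` A) ->
      `|\int[mu]_(t in B) e_ i (f n t)| <=
      span_gauge x_ (e_ i) * (e / (2 * (span_gauge x_ (e_ i) * C) + 1) * C).
    move=> mB BA; apply: le_trans (dual_integral_gauge n mB (eD i)) _.
    apply: ler_wpM2l => //; apply: le_trans (hdl B mB _ _ _ (hf n)) _.
      apply: le_lt_trans hj; apply: le_measure; rewrite ?inE//.
      exact: measurableU.
    by apply: ler_wpM2l => //; rewrite divr_ge0// ltW.
  apply: le_trans (ler_normB _ _) _.
  have s1 := sm _ mD1 (@subsetUl _ _ _); have s2 := sm _ mD2 (@subsetUr _ _ _).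
  apply: le_trans (lerD s1 s2) _.
  set g := span_gauge x_ (e_ i) in g0 D0 *.
  have -> : g * (e / (2 * (g * C) + 1) * C) + g * (e / (2 * (g * C) + 1) * C) =
    (2 * (g * C) * e) / (2 * (g * C) + 1) by ring.
  rewrite ler_pdivrMr// mulrC ler_wpM2l ?(ltW e0)// lerDl//.
move=> A u mA hu; apply: seq_cvg_of_approx => e e0.
have [c c0 hc] := fspace_L1 hrho.
have D0 : 0 < c * C + 1 by rewrite ltr_wpDl// mulr_ge0// ltW.
have [i hi] := e_dense hu (divr_gt0 e0 D0).
have hui := subspace_predB hD hu (eD i).
exists (fun n => \int[mu]_(t in A) e_ i (f n t)); split; first exact: step1.
move=> n.
have -> : \int[mu]_(t in A) u (f n t) - \int[mu]_(t in A) e_ i (f n t) =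
    \int[mu]_(t in A) (u - e_ i) (f n t).
  by rewrite -RintegralB//; apply: integrable_fun_on => //; exact: (dual_integrable hrho).
apply: le_trans (dual_integral_gauge n mA hui) _.
apply: (@le_trans _ _ (e / (c * C + 1) * (c * C))).
  apply: ler_pM; [exact: span_gauge_ge0|by apply: Rintegral_ge0|exact: ltW|].
  have ifn := norm_integrable hrho (hf n).
  apply: le_trans (Rintegral_subset_le mA ifn _) _ => //.
  by apply: le_trans (hc _ _ (hf n)).2 _; rewrite ler_wpM2l// ltW.
by rewrite mulrAC ler_pdivrMr// ler_wpM2l ?(ltW e0)// lerDl.
Qed.

Hypothesis f_cvg : forall A u, measurable A -> bounded_dual u ->
  exists a : R, \int[mu]_(t in A) u (f n t) @[n --> \oo] --> a.
Hypothesis Y_refl : real_reflexive Y.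

(** The limits of the integrals define a measure with values in the bidual of
    [Y]; [integral_kernel], applied to the dual of [Y] with the gauge, gives it a
    density, which takes values in [Y] by reflexivity. *)
Lemma setwise_limit_density : exists h : T -> Y, [/\ smeas h,
  forall t, span_closure x_ (h t) &
  forall A i, measurable A -> \int[mu]_(t in A) e_ i (f n t) @[n --> \oo] -->
    \int[mu]_(t in A) e_ i (h t)].
Proof.
have /choice[lam' hlam'] : forall p : set T * (Y -> R^o), exists a : R,
    measurable p.1 -> bounded_dual p.2 ->
    \int[mu]_(t in p.1) p.2 (f n t) @[n --> \oo] --> a.
  move=> [A u]; have [mA|nmA] := pselect (measurable A); last by exists 0.
  have [hu|nhu] := pselect (bounded_dual u); last by exists 0.
  by have [a ha] := f_cvg mA hu; exists a.
pose lam A u : R^o := lam' (A, u).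
have hlam A u : measurable A -> bounded_dual u ->
    \int[mu]_(t in A) u (f n t) @[n --> \oo] --> (lam A u : R).
  exact: (hlam' (A, u)).
have [c c0 hc] := fspace_L1 hrho.
have iu n (u : Y -> R^o) (hu : bounded_dual u) := dual_integrable hrho hu (hf n).
have uniq (v : nat -> R) (a b : R) : v n @[n --> \oo] --> a ->
    v n @[n --> \oo] --> b -> a = b.
  by move=> va vb; exact: (cvg_unique _ va vb).
have [||||L [L1 L2 L3 L4]] := @integral_kernel _ _ _ mu (Y -> R^o) (@bounded_dual R Y)
  (span_gauge x_) e_ lam (c * C) hD (span_gauge_seminorm x_) eD eQ e_dense.
- move=> A mA a u v hu hv; have hauv := hD.2 a u v hu hv.
  apply: (uniq _ _ _ (hlam _ _ mA hauv)).
  apply: (@eq_seq_cvg _ _ (fun n => a * (\int[mu]_(t in A) u (f n t)) +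
      \int[mu]_(t in A) v (f n t))).
    by move=> n; rewrite -Rintegral_lin//; exact: iu.
  by apply: cvgD; [apply: cvgMr|]; exact: hlam.
- move=> u hu A B mA mB AB; have mAB := measurableU A B mA mB.
  apply: (uniq _ _ _ (hlam _ _ mAB hu)).
  apply: (@eq_seq_cvg _ _ (fun n => \int[mu]_(t in A) u (f n t) +
      \int[mu]_(t in B) u (f n t))).
    by move=> n; rewrite -Rintegral_disjointU//; exact: iu.
  by apply: cvgD; exact: hlam.
- move=> u hu e e0; have g0 := span_gauge_ge0 x_ hu.
  have D0 : 0 < span_gauge x_ u * C + 1 by rewrite ltr_wpDl// mulr_ge0.
  have [dl dl0 hdl] := small_set_integral hrho rho_smooth (divr_gt0 e0 D0).
  exists dl => // A mA muA; apply: (cvg_abs_le (hlam _ _ mA hu)) => n.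
  apply: le_trans (dual_integral_gauge n mA hu) _.
  apply: (@le_trans _ _ (span_gauge x_ u * (e / (span_gauge x_ u * C + 1) * C))).
    apply: ler_wpM2l => //; apply: le_trans (hdl A mA muA _ _ (hf n)) _.
    by apply: ler_wpM2l => //; rewrite divr_ge0// ltW.
  set g := span_gauge x_ u in g0 D0 *.
  have -> : g * (e / (g * C + 1) * C) = (e * (g * C)) / (g * C + 1) by ring.
  by rewrite ler_pdivrMr// ler_wpM2l ?(ltW e0)// lerDl.
- move=> m p A z sp mA hz; have mAp j : measurable (A `&` p @^-1` [set j]).
    by apply: measurableI => //; exact: sp.2.
  have hsum : \sum_(j < m.+1) \int[mu]_(t in A `&` p @^-1` [set val j]) z j (f n t)
      @[n --> \oo] --> (\sum_(j < m.+1) lam (A `&` p @^-1` [set val j]) (z j) : R).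
    elim: m.+1 => [|k IH].
      rewrite big_ord0; apply: (@eq_seq_cvg _ _ (fun=> 0)); last exact: cvg_cst.
      by move=> n; rewrite big_ord0.
    rewrite big_ord_recr/=.
    apply: (@eq_seq_cvg _ _ (fun n =>
      \sum_(j < k) \int[mu]_(t in A `&` p @^-1` [set val j]) z j (f n t) +
      \int[mu]_(t in A `&` p @^-1` [set k]) z k (f n t))).
      by move=> n; rewrite big_ord_recr.
    by apply: cvgD => //; apply: hlam => //; exact: (hz k).1.
  apply: le_trans (ler_norm _) _; apply: (cvg_abs_le hsum) => n.
  have ifn := norm_integrable hrho (hf n).
  apply: (@le_trans _ _ (\int[mu]_(t in A) `|f n t|)); last first.
    apply: le_trans (Rintegral_subset_le mA ifn _) _ => //.
    by apply: le_trans (hc _ _ (hf n)).2 _; rewrite ler_wpM2l// ltW.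
  rewrite (Rintegral_selector sp mA ifn).
  apply: le_trans (ler_norm_sum _ _ _) _; apply: ler_sum => j _.
  apply: le_trans (dual_integral_gauge n (mAp j) (hz j).1) _.
  rewrite ler_piMl//; last exact: (hz j).2.
  exact: Rintegral_ge0.
have /choice[h hh] : forall t, exists y, forall u, bounded_dual u -> L t u = u y.
  move=> t; apply: Y_refl; first exact: L1.
  have [a a0 La] := L2 t; exists a => u r hu r0 ur.
  apply: le_trans (La u hu) _; rewrite ler_wpM2l//.
  by apply: span_gauge_le.
have hS t : span_closure x_ (h t).
  have [a a0 La] := L2 t; apply: (@span_closure_of_gauge _ _ x_ xQ _ a) => u hu.
  by rewrite -hh//; exact: La.
exists h; split=> //; last first.
  move=> A i mA; have [_ /(_ A mA) hA] := L4 _ (eD i).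
  have <- : lam A (e_ i) = \int[mu]_(t in A) e_ i (h t).
    by rewrite hA; apply: eq_Rintegral => t _; rewrite hh.
  exact: hlam.
(* The distance of [h] to [x_ j] is measurable, being the supremum of the
   functions [e_ i (h t) - e_ i (x_ j)] over the [e_ i] of norm at most 1. *)
apply: (@nearest_point_smeas _ _ _ _ h x_) => [t e e0|j].
  by have /span_closureP := hS t; exact.
pose good i := `[< forall y, `|e_ i y| <= `|y| >].
pose v i t : R := if good i then e_ i (h t) - e_ i (x_ j) else 0.
have mv i : measurable_fun setT (v i).
  rewrite /v; case: (good i); last exact: measurable_cst.
  apply: measurable_funB; last exact: measurable_cst.
  have := smeas_measurable (L3 _ (eD i)).
  by under [X in measurable_fun _ X]eq_fun do rewrite (hh _ _ (eD i)).
have /choice[s hs] := fun m => argmax_selector m mv.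
have lse (y : Y) i : good i -> e_ i y <= `|y|.
  by move/asboolP => gi; apply: le_trans (gi y); exact: ler_norm.
have eB i (y z : Y) : e_ i (y - z) = e_ i y - e_ i z.
  by rewrite (linear_onB (@setT_subspace _ Y) (eD i).1).
apply: (@measurable_fun_cvg _ _ _ _ (fun m t => v (s m t) t)) => [m|t _].
  by have [] := hs m.
have vle i : v i t <= `|h t - x_ j|.
  rewrite /v; case: ifP => // gi; rewrite -eB; exact: lse.
apply/cvgrPdist_le => e e0; have e40 : 0 < e / 4 by rewrite divr_gt0.
have hzS : span_closure x_ (h t - x_ j).
  exact: (subspace_predB (span_closure_subspace xQ) (hS t) (span_closure_gen x_ j)).
have [k hk] := (span_closureP x_ _).1 hzS _ e40.
have [i [gi ei]] := e_norming k.
exists i => // m /= im; have [_ _ /(_ i t im) him] := hs m.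
rewrite ger0_norm ?subr_ge0//.
have vi : v i t = e_ i (h t - x_ j) by rewrite /v /good asboolT// eB.
have k1 : `|h t - x_ j| <= `|h t - x_ j - x_ k| + `|x_ k|.
  by rewrite -{1}(subrK (x_ k) (h t - x_ j)) ler_normD.
have k2 := gi (h t - x_ j - x_ k); rewrite eB ei in k2.
have k3 := ler_norm (- (e_ i (h t - x_ j) - `|x_ k|)).
rewrite normrN in k3; rewrite vi in him; lra.
Qed.

(** The density of the setwise limit is first cut off to the sets where it is
    bounded by [k]: there it is a weak limit, so its norm is at most [C].  Monotone
    convergence in [k] puts the density in the function space. *)
Lemma weak_limit_exists : exists h : T -> Y, fspace h /\
  forall l, bounded_functional l -> l (f n) @[n --> \oo] --> l h.
Proof.
have [h [mh hS hA]] := setwise_limit_density.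
pose D k := [set t | `|h t| <= k%:R].
have mD k : measurable (D k).
  apply: measurable_le_set; first exact: smeas_measurable_norm.
  exact: measurable_cst.
have hk k : fspace (cutoff (D k) h).
  apply: (@fspace_bounded _ _ _ _ _ hrho _ _ k%:R _ _).1; first exact: smeas_cutoff.
  move=> t; have [Dt|nDt] := pselect (D k t); first by rewrite cutoff_in.
  by rewrite cutoff_out// normr0.
have zS : span_closure x_ 0 := (span_closure_subspace xQ).1.
have cS k (g : T -> Y) : (forall t, span_closure x_ (g t)) ->
    forall t, span_closure x_ (cutoff (D k) g t).
  move=> gS t; have [Dt|nDt] := pselect (D k t); first by rewrite cutoff_in.
  by rewrite cutoff_out.
have ecut k i (g : T -> Y) A : \int[mu]_(t in A) e_ i (cutoff (D k) g t) =
    \int[mu]_(t in A `&` D k) e_ i (g t).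
  rewrite Rintegral_mkcondr; apply: eq_Rintegral => t _; rewrite /patch.
  case: ifPn => [/set_mem Dt|/negP Dt]; first by rewrite cutoff_in.
  rewrite cutoff_out; last by move=> /mem_set.
  exact: (linear_on0 (@setT_subspace _ Y) (eD i).1).
have hfk k n := (fspace_cutoff hrho (mD k) (hf n)).
have wk k l : bounded_functional l ->
    l (cutoff (D k) (f n)) @[n --> \oo] --> l (cutoff (D k) h).
  move=> hl; apply: (@setwise_weak_cvg _ _ _ _ _ hrho rho_smooth _ x_ e_ xQ eD
    e_dense (fun n => cutoff (D k) (f n)) _ C _ _ _ _ _ _ l hl) => //.
  - by move=> n; exact: (hfk k n).1.
  - by move=> n; exact: le_trans (hfk k n).2 (fC n).
  - by move=> n; exact: cS.
  - exact: cS.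
  - move=> A i mA; rewrite ecut.
    apply: (@eq_seq_cvg _ _ (fun n => \int[mu]_(t in A `&` D k) e_ i (f n t))).
      by move=> n; exact: ecut.
    by apply: hA; exact: measurableI.
have nk k : fnorm (cutoff (D k) h) <= C.
  have [l [hl lb lh]] := fspace_norming hrho (hk k).
  rewrite -lh; apply: le_trans (ler_norm _) _.
  apply: (cvg_abs_le (wk k l hl)) => n.
  by apply: le_trans (lb _ (hfk k n).1) _; exact: le_trans (hfk k n).2 (fC n).
have hh : fspace h.
  split=> //; apply: (@le_lt_trans _ _ C%:E); last exact: ltry.
  apply: (@fn_monotone _ _ _ _ _ hrho (fun k t => `|cutoff (D k) h t|)) => //.
  - by move=> k; apply: smeas_measurable_norm; exact: (hk k).1.
  - exact: smeas_measurable_norm.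
  - move=> t k m km; have [Dt|nDt] := pselect (D k t); last first.
      by rewrite (cutoff_out _ nDt) normr0.
    rewrite !cutoff_in//; apply: le_trans Dt _; by rewrite ler_nat.
  - move=> t; apply: cvg_near_cst.
    exists (Num.bound `|h t|) => // k /= bk; rewrite cutoff_in//.
    apply: le_trans (ltW (archi_boundP _)) _; rewrite ?ler_nat//.
  - by move=> k; rewrite (fspace_fnormE hrho (hk k)) lee_fin.
exists h; split=> // l hl.
exact: (@setwise_weak_cvg _ _ _ _ _ hrho rho_smooth _ x_ e_ xQ eD
    e_dense f h C).
Qed.

End weak_compactness_theorem.

Section weak_compactness_main.
Context d (T : measurableType d) (R : realType).
Variable mu : {finite_measure set T -> \bar R}.
Variable rho : (T -> R) -> \bar R.
Hypothesis hrho : function_norm mu rho.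
Hypothesis rho_smooth : disjointly_smooth rho.

Lemma cvg_reindex (a b : nat -> R) (l : R) (r : nat -> nat) j :
  a n @[n --> \oo] --> l -> (forall n, (n <= r n)%N) ->
  (forall n, (j <= n)%N -> b n = a (r n)) -> b n @[n --> \oo] --> l.
Proof.
move=> /cvgrPdist_lt al rn ba; apply/cvgrPdist_lt => e /al [N _ hN].
exists (maxn N j) => // n /=; rewrite geq_max => /andP[Nn jn].
by rewrite ba//; apply: hN; exact: leq_trans (rn n).
Qed.

Lemma bounded_subsequence (a : nat -> R) (C : R) : (forall n, `|a n| <= C) ->
  exists2 t, subsequence t & exists l : R, a (t n) @[n --> \oo] --> l.
Proof.
move=> aC; have [|t ti] := @bolzano_weierstrass R a.
  exists C; split; first exact: num_real.
  by move=> x Cx n _; apply: le_trans (aC n) (ltW Cx).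
move=> /cvg_ex[l tl]; exists t; last by exists l.
move=> i j ij; rewrite ltn_neqAle -leEnat.
have := ti i j; have := ti j i; rewrite -!leEnat => h1 h2.
have h3 : (j <= i)%O = false by rewrite leEnat leqNgt ij.
have h4 : (i <= j)%O by rewrite leEnat ltnW.
rewrite h2 h4 andbT; apply/eqP => e.
by have := h1; rewrite -e lexx h3.
Qed.

(** All the [f n] take their values in one separable closed subspace, whose dual
    is separable by reflexivity.  A diagonal extraction makes the integrals over
    the [A_ j] of the functionals of a countable dense set converge. *)
Theorem weak_sequential_compactness (Y : normedModType R) (A_ : nat -> set T)
  (f : nat -> T -> Y) (C : R) : real_reflexive Y ->
  (forall j, measurable (A_ j)) ->
  (forall A, measurable A -> forall e : R, 0 < e -> exists j,
     (mu ((A `\` A_ j) `|` (A_ j `\` A)) < e%:E)%E) ->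
  (forall n, fspace rho (f n)) -> (forall n, fnorm rho (f n) <= C) ->
  exists t, subsequence t /\ exists h : T -> Y, fspace rho h /\
    forall l, bounded_functional rho l -> l (f (t n)) @[n --> \oo] --> l h.
Proof.
move=> hrefl mA_ Ad hf fC.
have [y hy] := smeas_separable_seq (fun n => (hf n).1).
pose x_ := rat_span y; have xQ : rat_closed x_ := rat_span_closed y.
have fS n t : span_closure x_ (f n t).
  apply/span_closureP => e e0; have [j hj] := hy n t e e0.
  by have [k xk] := rat_span_gen y j; exists k; rewrite /x_ xk.
have [e_ [eD eQ e_dense e_norming]] := reflexive_separable_dual xQ hrefl.
pose P k (t : nat -> nat) := if @unpickle (nat * nat)%type k is Some p then
  exists a : R, \int[mu]_(w in A_ p.2) e_ p.1 (f (t n) w) @[n --> \oo] --> a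
  else True.
have [k t st|k t u r|t st Pt] := @diagonal_subsequence P.
- rewrite /P; case: unpickle => [[i j]|] /=; last by exists id.
  have g0 := span_gauge_ge0 x_ (eD i).
  have [c c0 hc] := fspace_L1 hrho.
  have [|u su [a ha]] := @bounded_subsequence
    (fun n => \int[mu]_(w in A_ j) e_ i (f (t n) w)) (span_gauge x_ (e_ i) * (c * C)).
    move=> n; apply: le_trans (dual_integral_gauge hrho hf fS (t n) (mA_ j) (eD i)) _.
    apply: ler_wpM2l => //.
    apply: le_trans (Rintegral_subset_le (mA_ j) (norm_integrable hrho (hf (t n))) _) _ => //.
    by apply: le_trans (hc _ _ (hf (t n))).2 _; rewrite ler_wpM2l// ltW.
  by exists u => //; exists a.
- rewrite /P; case: unpickle => [[i j]|] //= [a ha] rn ut; exists a.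
  apply: (cvg_reindex (j := k) ha rn) => n kn.
  by rewrite ut.
exists t; split=> //.
apply: (@weak_limit_exists _ _ _ _ _ hrho rho_smooth Y x_ e_ xQ eD eQ e_dense
  e_norming (fun n => f (t n)) C) => //.
apply: (@setwise_limit _ _ _ _ _ hrho rho_smooth Y x_ e_ eD e_dense
  (fun n => f (t n)) C _ _ _ A_) => // i j.
by have := Pt (pickle (i, j)); rewrite /P pickleK.
Qed.

Lemma weak_limit_unique (Y : normedModType R) (g h : T -> Y) : fspace rho g ->
  fspace rho h -> (forall l, bounded_functional rho l -> l g = l h) ->
  {ae mu, forall t, g t = h t}.
Proof.
move=> hg hh gh; have hgh := (fspaceB hrho hg hh).1.
have [l [hl _ lE]] := fspace_norming hrho hgh.
have : {ae mu, forall t, g t - h t = 0}.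
  apply: (fnorm0_ae hrho hgh); rewrite -lE.
  by rewrite (linear_onB (fspace_subspace hrho Y) hl.1)// gh// subrr.
by apply: filterS => t /eqP; rewrite subr_eq0 => /eqP.
Qed.

Lemma fnorm_weak_le (Y : normedModType R) (f : nat -> T -> Y) h (C : R) :
  (forall n, fspace rho (f n)) -> (forall n, fnorm rho (f n) <= C) -> fspace rho h ->
  (forall l, bounded_functional rho l -> l (f n) @[n --> \oo] --> l h) ->
  fnorm rho h <= C.
Proof.
move=> hf fC hh fh; have [l [hl lb lE]] := fspace_norming hrho hh.
rewrite -lE; apply: le_trans (ler_norm _) _; apply: (cvg_abs_le (fh l hl)) => n.
exact: le_trans (lb _ (hf n)) (fC n).
Qed.

End weak_compactness_main.

(** * Separability of function spaces *)

Section separability.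
Context d (T : measurableType d) (R : realType).
Variable mu : {finite_measure set T -> \bar R}.
Variable rho : (T -> R) -> \bar R.
Hypothesis hrho : function_norm mu rho.
Variable phi : nat -> T -> R^o.
Hypothesis phi_in : forall i, fspace rho (phi i).
Hypothesis phi_dense : forall f : T -> R^o, fspace rho f -> forall e : R, 0 < e ->
  exists i, fnorm rho (fun t => f t - phi i t) < e.

Lemma chebyshev_measure (B : set T) (f : T -> R) (a : R) : 0 < a -> measurable B ->
  (forall t, B t -> a <= `|f t|) -> mu.-integrable setT (fun t => (`|f t|)%:E) ->
  (mu B <= (a^-1 * \int[mu]_t `|f t|)%:E)%E.
Proof.
move=> a0 mB Bf fi; rewrite EFinM.
have : (a%:E * mu B <= (\int[mu]_t `|f t|)%:E)%E.
  rewrite -integral_cst// /Rintegral fineK; last exact: integrable_fin_num.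
  have mf := measurable_int _ fi.
  apply: (@le_trans _ _ (\int[mu]_(t in B) (`|f t|)%:E)%E).
    apply: ge0_le_integral => //; first by move=> t _; rewrite lee_fin ltW.
    by apply: measurable_funS mf.
  by apply: ge0_subset_integral.
have fB : mu B \is a fin_num by apply: fin_num_measure.
rewrite -(fineK fB) -!EFinM !lee_fin => h.
by rewrite -(ler_pM2l a0) mulrA mulfV ?lt0r_neq0// mul1r.
Qed.

(** A set [A] differs little, by Chebyshev's inequality, from the set where a
    function close to the indicator of [A] is at least 1/2. *)
Lemma measure_algebra_separable : exists A_ : nat -> set T,
  (forall j, measurable (A_ j)) /\
  forall A, measurable A -> forall e : R, 0 < e -> exists j,
     (mu ((A `\` A_ j) `|` (A_ j `\` A)) < e%:E)%E.
Proof.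
pose A_ j := [set t | 2^-1 <= phi j t].
have mA_ j : measurable (A_ j).
  have mp := smeas_measurable (phi_in j).1.
  rewrite (_ : A_ j = setT `&` (phi j @^-1` `[2^-1, +oo[)).
    by apply: mp => //.
  by rewrite setTI; apply/seteqP; split=> t /=; rewrite in_itv/= andbT.
exists A_; split=> // A mA e e0.
have [c c0 hc] := fspace_L1 hrho.
have hA : fspace rho (fun t => \1_A t : R^o).
  by apply: (fspace_bounded hrho (c := 1) _ _).1 => [|t];
    [apply: measurable_smeas; exact: measurable_indic
    |rewrite indicE; case: (t \in A); rewrite ?normr1 ?normr0].
have e1 : 0 < e / (2 * c) by rewrite divr_gt0// mulr_gt0.
have [j hj] := phi_dense hA e1; exists j.
have [ig Ig] := hc _ _ (fspaceB hrho hA (phi_in j)).1.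
apply: le_lt_trans (chebyshev_measure (a := 2^-1) _ _ _ ig) _ => //.
- by apply: measurableU; apply: measurableD.
- move=> t [[At nAt]|[At nAt]].
    rewrite indicE mem_set//= ; move: nAt => /negP; rewrite -ltNge => h.
    by rewrite ger0_norm; lra.
  rewrite indicE memNset//= sub0r normrN.
  by apply: le_trans (ler_norm _); exact: At.
rewrite lte_fin invrK.
apply: le_lt_trans (ler_wpM2l _ Ig) _ => //.
by rewrite mulrA mulrC -ltr_pdivlMr// mulr_gt0.
Qed.

(** The rational combinations of the functions [phi i] times [xs j] approximate
    the functions that take finitely many of the values [xs j]. *)
Lemma fspace_separable (X : normedModType R) (xs : nat -> X) :
  (forall x (e : R), 0 < e -> exists j, `|x - xs j| < e) -> (exists j, xs j = 0) ->
  exists D : nat -> T -> X, (forall k, fspace rho (D k)) /\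
    forall f, fspace rho f -> forall e : R, 0 < e ->
      exists k, fnorm rho (fun t => f t - D k t) < e.
Proof.
move=> xd x0.
pose psi n : T -> X := if unpickle n is Some p then fun t => phi p.1 t *: xs p.2 else 0.
have hpsi n : fspace rho (psi n).
  rewrite /psi; case: unpickle => [[i j]/=|]; last exact: (fspace0 hrho X).
  have h := (fspaceZ hrho `|xs j| (phi_in i)).1.
  apply: (fspace_le hrho _ h _).1 => [|t].
    apply: smeasZ; [exact: (phi_in i).1|exact: smeas_cst].
  by rewrite normrZ normrM normr_id mulrC.
have hE := fspace_subspace hrho X.
have hs := fnorm_seminorm hrho X.
pose D := rat_span psi.
have DE k : fspace rho (D k) by exact: rat_span_sub.
exists D; split=> // f hf e e0.
have e2 : 0 < e / 2 by rewrite divr_gt0.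
have [s [ss hsel _ /cvgrPdist_lt/(_ _ e2)[n _ /(_ n (leqnn n))]]] :=
  dense_approx hrho hf (fun t => xd (f t)) x0.
rewrite sub0r normrN ger0_norm ?(fnorm_ge0 hrho)// => hn.
have clA j A : measurable A ->
    seminorm_closure (@fspace _ _ _ rho X) (@fnorm _ _ _ rho X) D (cutoff A (fun=> xs j)).
  move=> mA; split=> [|a a0]; first exact: (fspace_cutoff hrho mA (fspace_cst hrho _)).1.
  have hA : fspace rho (fun t => \1_A t : R^o).
    by apply: (fspace_bounded hrho (c := 1) _ _).1 => [|t];
      [apply: measurable_smeas; exact: measurable_indic
      |rewrite indicE; case: (t \in A); rewrite ?normr1 ?normr0].
  have c0 : 0 < `|xs j| + 1 by rewrite ltr_wpDl.
  have [i hi] := phi_dense hA (divr_gt0 a0 c0).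
  have [k kE] := rat_span_gen psi (pickle (i, j)); exists k.
  rewrite /D kE /psi pickleK /=.
  have hB := (fspaceB hrho hA (phi_in i)).1.
  have [h1 h2] := fspaceZ hrho (`|xs j| + 1) hB.
  apply: (@le_lt_trans _ _ ((`|xs j| + 1) * fnorm rho (fun t => (\1_A t - phi i t) : R^o))).
    rewrite -[X in X * _]ger0_norm; last exact: ltW.
    rewrite -h2; apply: (fspace_le hrho _ h1 _).2 => [|t].
      apply: smeasB; first by apply: smeas_cutoff => //; exact: smeas_cst.
      by apply: smeasZ; [exact: (phi_in i).1|exact: smeas_cst].
    rewrite -[(cutoff _ _ - _) t]/(\1_A t *: xs j - phi i t *: xs j).
    rewrite -scalerBl !normrZ mulrC ler_wpM2r//.
    by rewrite ger0_norm ?lerDl//; exact: ltW.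
  by rewrite mulrC -ltr_pdivlMr.
have csub := seminorm_closure_subspace hE hs DE (rat_span_closed psi).
have [_ h2] : seminorm_closure (@fspace _ _ _ rho X) (@fnorm _ _ _ rho X) D
    (fun t => xs (s n t)).
  rewrite -(cutoff_setT (fun t => xs (s n t))) -(selector_cutoff_sum setT xs (ss n)).
  have h0 : linear_on (@fspace _ _ _ rho X) (fun=> 0 : R^o).
    by move=> a x y _ _; rewrite scaler0 addr0.
  apply: (linear_on_sum _ csub (f := fun=> 0 : R^o) (z := fun j => cutoff (setT `&` s n @^-1` [set j]) (fun=> xs j)) _ _).1.
    by move=> a x y _ _; rewrite scaler0 addr0.
  by move=> j; apply: clA; rewrite setTI; exact: (ss n).2.
have [k hk] := h2 _ e2; exists k.
rewrite (splitr e); apply: le_lt_trans (ltrD hn hk).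
apply: le_trans _ (fspaceD hrho (fspaceB hrho hf (hsel n)).1 (fspaceB hrho (hsel n) (DE k)).1).2.
by rewrite (_ : (fun t => f t - D k t) = fun t => f t - xs (s n t) + (xs (s n t) - D k t))//;
  apply/funext => t; rewrite addrA subrK.
Qed.

End separability.

(** * Local operators between function spaces *)

Section local_operators.
Context d (T : measurableType d) (R : realType).
Variable mu : {finite_measure set T -> \bar R}.
Variables rhoP rhoQ : (T -> R) -> \bar R.
Hypotheses (hP : function_norm mu rhoP) (hQ : function_norm mu rhoQ).

(** An operator that is given pointwise commutes with the multiplication by
    indicator functions; conversely this locality, unlike the pointwise form,
    passes at once to weak limits. *)
Record local_operator (X Y : normedModType R) (C : R) (G : (T -> X) -> T -> Y) :
    Prop := LocalOperator {
  lo_in : forall u, fspace rhoP u -> fspace rhoQ (G u);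
  lo_lin : forall a u v, fspace rhoP u -> fspace rhoP v ->
    {ae mu, forall t, G (fun t => a *: u t + v t) t = a *: G u t + G v t};
  lo_bound : forall u, fspace rhoP u -> fnorm rhoQ (G u) <= C * fnorm rhoP u;
  lo_local : forall A u, measurable A -> fspace rhoP u ->
    {ae mu, forall t, G (cutoff A u) t = cutoff A (G u) t} }.

Lemma local_operatorB (X Y : normedModType R) C (G : (T -> X) -> T -> Y) u v :
  local_operator C G -> fspace rhoP u -> fspace rhoP v ->
  {ae mu, forall t, G (fun t => u t - v t) t = G u t - G v t}.
Proof.
move=> hG hu hv; have := lo_lin hG (-1) hv hu; apply: filterS => w.
by rewrite (_ : (fun t => _) = (fun t => u t - v t)) => [->|];
  [|apply/funext => z]; rewrite scaleN1r addrC.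
Qed.

Lemma local_operator_lipschitz (X Y : normedModType R) C (G : (T -> X) -> T -> Y) u v :
  local_operator C G -> fspace rhoP u -> fspace rhoP v ->
  fnorm rhoQ (fun t => G u t - G v t) <= C * fnorm rhoP (fun t => u t - v t).
Proof.
move=> hG hu hv; have huv := (fspaceB hP hu hv).1.
apply: le_trans (lo_bound hG huv).
apply: (fspace_le_ae hQ _ (lo_in hG huv) _).2.
  exact: (fspaceB hQ (lo_in hG hu) (lo_in hG hv)).1.1.
by apply: filterS (local_operatorB hG hu hv) => t ->.
Qed.

Lemma functional_lin (V : normedModType R) rho (hrho : function_norm mu rho) (l : (T -> V) -> R^o)
    (g f h : T -> V) (a : R) : bounded_functional rho l ->
  fspace rho g -> fspace rho f -> fspace rho h ->
  {ae mu, forall t, g t = a *: f t + h t} -> l g = a *: l f + l h.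
Proof.
move=> hl hg hf hh gE.
rewrite -hl.1//; apply: (functional_ae hrho hl hg) => //.
exact: ((fspace_subspace hrho V).2 a f h hf hh).1.
Qed.

Section limit.
Variables (X Y : normedModType R) (C : R) (G_ : nat -> (T -> X) -> T -> Y).
Hypothesis G_loc : forall n, local_operator C (G_ n).
Hypothesis rhoQ_smooth : disjointly_smooth rhoQ.
Hypothesis Y_refl : real_reflexive Y.

(** Weak sequential compactness and a diagonal extraction give the convergence
    on a countable dense set of arguments; the uniform bound extends it to all
    arguments. *)
Theorem local_operator_compactness (A_ : nat -> set T) (D : nat -> T -> X) :
  (forall j, measurable (A_ j)) ->
  (forall A, measurable A -> forall e : R, 0 < e -> exists j,
     (mu ((A `\` A_ j) `|` (A_ j `\` A)) < e%:E)%E) ->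
  (forall k, fspace rhoP (D k)) ->
  (forall u, fspace rhoP u -> forall e : R, 0 < e ->
     exists k, fnorm rhoP (fun t => u t - D k t) < e) ->
  exists2 t, subsequence t & exists G, local_operator C G /\
    forall u l, fspace rhoP u -> bounded_functional rhoQ l ->
      l (G_ (t n) u) @[n --> \oo] --> l (G u).
Proof.
move=> mA_ A_d D_in D_d.
have wsc (t : nat -> nat) u : fspace rhoP u -> exists s, subsequence s /\
    exists h : T -> Y, fspace rhoQ h /\
    forall l, bounded_functional rhoQ l -> l (G_ (t (s n)) u) @[n --> \oo] --> l h.
  move=> hu; apply: (weak_sequential_compactness hQ rhoQ_smooth
    (f := fun n => G_ (t n) u) (C := C * fnorm rhoP u) Y_refl mA_ A_d) => n.
    exact: (lo_in (G_loc _)).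
  exact: (lo_bound (G_loc _)).
pose P k (t : nat -> nat) := exists h : T -> Y, fspace rhoQ h /\
    forall l, bounded_functional rhoQ l -> l (G_ (t n) (D k)) @[n --> \oo] --> l h.
have [k t st|k t u r [h [hh th]] rn ut|t st Pt] := @diagonal_subsequence P.
- by have [s [ss hs]] := wsc t _ (D_in k); exists s.
- exists h; split=> // l hl; apply: (cvg_reindex (j := k) (th l hl) rn) => n kn.
  by rewrite ut.
have Gcvg u l : fspace rhoP u -> bounded_functional rhoQ l ->
    exists a : R, l (G_ (t n) u) @[n --> \oo] --> a.
  move=> hu hl; have [C1 C10 hC1] := hl.2.
  apply: seq_cvg_of_approx => e e0.
  have c0 : 0 < C1 * `|C| + 1 by rewrite ltr_wpDl// mulr_ge0.
  have [k hk] := D_d u hu _ (divr_gt0 e0 c0).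
  exists (fun n => l (G_ (t n) (D k))); split=> [|n].
    by have [h [_ hh]] := Pt k; exists (l h); exact: hh.
  have hd := (fspaceB hP hu (D_in k)).1.
  have hGu := lo_in (G_loc (t n)) hu; have hGd := lo_in (G_loc (t n)) (D_in k).
  have hG := lo_in (G_loc (t n)) hd.
  have -> : l (G_ (t n) u) - l (G_ (t n) (D k)) =
      l (G_ (t n) (fun w => u w - D k w)).
    rewrite -(linear_onB (fspace_subspace hQ Y) hl.1)//; apply/esym.
    by apply: (functional_ae hQ hl hG _ (local_operatorB (G_loc _) hu (D_in k)));
      exact: (fspaceB hQ hGu hGd).1.1.
  apply: le_trans (hC1 _ hG) _.
  apply: (@le_trans _ _ (C1 * (`|C| * fnorm rhoP (fun w => u w - D k w)))).
    apply: ler_wpM2l => //; apply: le_trans (lo_bound (G_loc _) hd) _.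
    by apply: ler_wpM2r (ler_norm _); exact: fnorm_ge0 hP _ _.
  move: hk; rewrite ltr_pdivlMr// => /ltW; apply: le_trans.
  by rewrite mulrA mulrC ler_wpM2l ?(fnorm_ge0 hP)// lerDl.
have /choice[G hG] : forall u, exists h : T -> Y, fspace rhoP u -> fspace rhoQ h /\
    forall l, bounded_functional rhoQ l -> l (G_ (t n) u) @[n --> \oo] --> l h.
  move=> u; have [hu|nu] := pselect (fspace rhoP u); last by exists 0.
  have [s [ss [h [hh sh]]]] := wsc t u hu; exists h => _; split=> // l hl.
  have [a ta] := Gcvg u l hu hl.
  have sa := cvg_reindex (b := fun n => l (G_ (t (s n)) u)) (j := 0%N) ta
    (fun n => subsequence_ge n ss) (fun n _ => erefl).
  by rewrite (cvg_unique _ (sh l hl) sa).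
exists t => //; exists G; split; last by move=> u l /hG[_ h] /h.
split.
- by move=> u /hG[].
- move=> a u v hu hv; have huv := (fspace_subspace hP X).2 a u v hu hv.
  have [hGu cu] := hG u hu; have [hGv cv] := hG v hv; have [hGuv cuv] := hG _ huv.
  apply: (weak_limit_unique hQ) => //.
    exact: ((fspace_subspace hQ Y).2 a _ _ hGu hGv).
  move=> l hl; rewrite hl.1//.
  apply: (cvg_unique _ (cuv l hl)) => //.
  have -> : (fun n => l (G_ (t n) (a *: u + v))) =
            (fun n => a *: l (G_ (t n) u) + l (G_ (t n) v)).
    apply/funext => n.
    by apply: (functional_lin hQ hl _ _ _ (lo_lin (G_loc _) a hu hv));
      exact: lo_in (G_loc _) _ _.
  by apply: cvgD; [apply: cvgZr; exact: cu|exact: cv].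
- move=> u hu; have [hGu cu] := hG u hu.
  apply: (fnorm_weak_le hQ (f := fun n => G_ (t n) u)) => // n.
    exact: lo_in (G_loc _) _ hu.
  exact: lo_bound (G_loc _) _ hu.
- move=> A u mA hu; have [hGu cu] := hG u hu.
  have hA := (fspace_cutoff hP mA hu).1; have [hGA cA] := hG _ hA.
  apply: (weak_limit_unique hQ) => //; first exact: (fspace_cutoff hQ mA hGu).1.
  move=> l hl; apply: (cvg_unique _ (cA l hl)) => //.
  have -> : (fun n => l (G_ (t n) (cutoff A u))) =
            (fun n => (l \o cutoff A) (G_ (t n) u)).
    apply/funext => n; apply: (functional_ae hQ hl _ _ (lo_local (G_loc _) mA hu)).
      exact: lo_in (G_loc _) _ hA.
    exact: (smeas_cutoff mA (lo_in (G_loc _) hu).1).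
  exact: cu (functional_cutoff hQ mA hl).
Qed.

End limit.
End local_operators.

(** * Pointwise form of a local operator *)

Section pointwise_form.
Context d (T : measurableType d) (R : realType).
Variable mu : {finite_measure set T -> \bar R}.

Lemma cvg0_dominated (u v : nat -> R) (c : R) : (forall n, `|u n| <= c * v n) ->
  v n @[n --> \oo] --> (0 : R) -> u n @[n --> \oo] --> (0 : R).
Proof.
move=> uv v0; have cv0 : c * v n @[n --> \oo] --> (0 : R).
  by rewrite -(mulr0 c); apply: cvgZr.
have h n : - (c * v n) <= u n <= c * v n by rewrite -ler_norml.
apply: (squeeze_cvgr (f := fun n => - (c * v n)) _ _ cv0); first exact: nearW.
by rewrite -[X in _ --> X]oppr0; exact: cvgN.
Qed.

(** Convergence in norm implies convergence in [L^1], and Fatou's lemma shows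
    that the lower limit of the distances of [g] to [h_ n] is 0 almost
    everywhere. *)
Lemma norm_pointwise_limit rho (hrho : function_norm mu rho) (V : normedModType R)
    (g h : T -> V) (h_ : nat -> T -> V) :
  fspace rho g -> (forall n, fspace rho (h_ n)) ->
  fnorm rho (fun t => g t - h_ n t) @[n --> \oo] --> (0 : R) ->
  {ae mu, forall t, `|h t - h_ n t| @[n --> \oo] --> (0 : R)} ->
  {ae mu, forall t, g t = h t}.
Proof.
move=> hg hh_ gh_ hh.
pose f n t := (`|g t - h_ n t|)%:E.
have hd n := (fspaceB hrho hg (hh_ n)).1.
have mf n : measurable_fun setT (f n).
  by apply/measurable_EFinP; exact: smeas_measurable_norm (hd n).1.
have f0 n t : setT t -> (0 <= f n t)%E by rewrite lee_fin.
have mF : measurable_fun setT (fun t => limn_einf (f ^~ t)).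
  rewrite (_ : (fun t => _) = (fun t => - limn_esup (fun n => - f n t))%E).
    by apply: measurableT_comp => //; apply: measurable_fun_limn_esup => n; exact: measurableT_comp.
  by apply/funext => t; rewrite -[in RHS]/(limn_esup (-%E \o (f ^~ t))) limn_esupN oppeK.
have F0 t : (0 <= limn_einf (f ^~ t))%E.
  rewrite limn_einf_lim; apply: lime_ge; first exact: is_cvg_einfs.
  by apply: nearW => n; apply: le_ereal_inf_tmp => _ [m _ <-]; exact: f0.
have IF : (\int[mu]_t limn_einf (f ^~ t) = 0)%E.
  apply/eqP; rewrite eq_le integral_ge0// andbT.
  apply: le_trans (fatou mu measurableT mf f0) _.
  have [c c0 hc] := fspace_L1 hrho.
  rewrite (_ : (0%E : \bar R) = limn_einf (fun n => (\int[mu]_t f n t)%E)) //; apply/esym.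
  apply: (cvg_limn_einf_sup _).1.
  have -> : (fun n => \int[mu]_t f n t)%E =
      (fun n => (\int[mu]_t `|g t - h_ n t|)%:E).
    by apply/funext => n; rewrite /Rintegral fineK//; apply: integrable_fin_num => //; exact: (hc _ _ (hd n)).1.
  apply: cvg_EFin; first exact: nearW.
  apply: (cvg0_dominated (c := c) _ gh_) => n.
  rewrite ger0_norm; first exact: (hc _ _ (hd n)).2.
  exact: Rintegral_ge0.
have := (ae_eq_integral_abs mu measurableT mF).1.
under eq_integral do rewrite gee0_abs//.
move=> /(_ IF); apply: filterS2 hh => t ht /(_ Logic.I) => /= e.
have fgh : f n t @[n --> \oo] --> (`|g t - h t|)%:E.
  apply: cvg_EFin; first exact: nearW.
  apply/cvg_sub_zero; apply: (cvg0_dominated (c := 1) _ ht) => n.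
  rewrite mul1r; apply: le_trans (ler_dist_dist _ _) _.
  by rewrite opprB addrC addrA subrK.
have := (cvg_limn_einf_sup fgh).1; rewrite e => -[] /esym/normr0_eq0/eqP.
by rewrite subr_eq0 => /eqP.
Qed.

Variables rhoP rhoQ : (T -> R) -> \bar R.
Hypotheses (hP : function_norm mu rhoP) (hQ : function_norm mu rhoQ).
Variables (X Y : normedModType R) (C : R) (G : (T -> X) -> T -> Y).
Hypothesis G_loc : local_operator mu rhoP rhoQ C G.

Local Notation S := (fun x : X => G (fun=> x)).

(** On the set where the index is [j] the argument coincides with the constant
    [z j], and locality applies to this set. *)
Lemma local_selector m s (z : nat -> X) : selector m s ->
  {ae mu, forall t, G (fun t => z (s t)) t = S (z (s t)) t}.
Proof.
move=> [sm ms].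
have hu : fspace rhoP (fun t => z (s t)).
  apply: (fspace_bounded hP (c := \sum_(j < m.+1) `|z j|) _ _).1 => [|t].
    by apply: smeas_simple; apply: simple_map_comp; apply: (@selector_simple _ _ m).
  have jm : (s t < m.+1)%N by rewrite ltnS.
  by rewrite (bigD1 (Ordinal jm))//= lerDl sumr_ge0.
have : {ae mu, forall t, forall j : nat, s t = j -> G (fun t => z (s t)) t = S (z j) t}.
  apply: ae_forall_countable => j.
  have h1 := lo_local G_loc (ms j) hu.
  have h2 := lo_local G_loc (ms j) (fspace_cst hP (z j)).
  apply: filterS2 h1 h2 => t h1 h2 st.
  have e : cutoff (s @^-1` [set j]) (fun t => z (s t)) = cutoff (s @^-1` [set j]) (fun=> z j).
    apply/funext => w; have [sw|nsw] := pselect ((s @^-1` [set j]) w).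
      by rewrite !cutoff_in// sw.
    by rewrite !cutoff_out.
  have At : (s @^-1` [set j]) t := st.
  by rewrite e cutoff_in// in h1; rewrite cutoff_in// in h2; rewrite -h1 h2.
by apply: filterS => t /(_ _ erefl).
Qed.

(** By [local_selector] the selections from the norms of the images of constants
    of norm at most 1 are norms of images of bounded functions; so they have
    bounded integrals, and [pointwise_kernel] applies.  The resulting kernel
    represents [G] on functions with finitely many values, hence on all by
    density. *)
Theorem local_operator_pointwise (xs : nat -> X) : seq_complete Y ->
  (forall x (e : R), 0 < e -> exists j, `|x - xs j| < e) -> (exists j, xs j = 0) ->
  exists L : T -> X -> Y, [/\ forall t, linear_on setT (L t),
    forall t, exists2 c, 0 <= c & forall x, `|L t x| <= c * `|x| &
    forall u, fspace rhoP u -> {ae mu, forall t, G u t = L t (u t)}].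
Proof.
move=> cY xd x0.
have hS x : fspace rhoQ (S x) by apply: (lo_in G_loc); exact: (fspace_cst hP).
have Sl a x z : setT x -> setT z ->
    {ae mu, forall t, S (a *: x + z) t = a *: S x t + S z t}.
  by move=> _ _; apply: (lo_lin G_loc); exact: (fspace_cst hP).
have Sb (z : nat -> X) : (forall j, setT (z j)) ->
    {ae mu, forall t, exists c, forall j, `|S (z j) t| <= c * `|z j|}.
  apply: (ae_bounded_normalize (setT_subspace X) (norm_seminorm X) Sl) => {}z hz.
  have [c c0 hc] := fspace_L1 hQ.
  apply: (@ae_bounded_of_selectors _ _ _ mu _
    (c * (`|C| * (1 * fnorm rhoP (fun=> 1 : R^o))))) => [j|m s A ss mA _ mp].
    exact: smeas_measurable_norm (hS _).1.
  have sz : smeas (fun t => z (s t)).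
    by apply: smeas_simple; apply: simple_map_comp; exact: (selector_simple ss).
  have [hu bu] := fspace_bounded hP sz (fun t => (hz (s t)).2).
  have hGu := lo_in G_loc hu.
  have [ig Ig] := hc _ _ hGu.
  apply: (@le_trans _ _ (\int[mu]_t (`|G (fun t => z (s t)) t|)%:E)%E).
    apply: (@le_trans _ _ (\int[mu]_t (`|S (z (s t)) t|)%:E)%E).
      apply: ge0_subset_integral => //; first exact/measurable_EFinP.
    apply: ae_ge0_le_integral => //.
    - exact/measurable_EFinP.
    - by apply/measurable_EFinP; exact: smeas_measurable_norm hGu.1.
    by apply: filterS (local_selector z ss) => t -> _.
  rewrite -[leLHS]fineK; last exact: integrable_fin_num.
  rewrite lee_fin; apply: le_trans Ig _; apply: ler_wpM2l; first exact: ltW.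
  apply: le_trans (lo_bound G_loc hu) _.
  apply: (@le_trans _ _ (`|C| * fnorm rhoP (fun t => z (s t)))).
    by apply: ler_wpM2r (ler_norm _); exact: fnorm_ge0 hP _ _.
  exact: ler_wpM2l.
have [L [L1 L2 L3 L4]] := @pointwise_kernel _ X Y cY setT Num.norm (rat_span xs)
  (setT_subspace X) (norm_seminorm X) (fun=> Logic.I) (rat_span_closed xs)
  (fun x _ e e0 => let: ex_intro j hj := xd x e e0 in
     let: ex_intro k hk := rat_span_gen xs j in
     ex_intro _ k (eq_ind_r (fun v => `|x - v| < e) hj hk))
  _ _ mu S (fun x _ => (hS x).1) Sl Sb.
have Lb t : exists2 c, 0 <= c & forall x, `|L t x| <= c * `|x|.
  by have [c c0 hc] := L2 t; exists c => // x; exact: hc.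
exists L; split=> // u hu.
have [s [ss hsel hpt hnm]] := dense_approx hP hu (fun t => xd (u t)) x0.
apply: (norm_pointwise_limit hQ (h_ := fun n => G (fun t => xs (s n t)))).
- exact: lo_in G_loc _ hu.
- by move=> n; exact: lo_in G_loc _ (hsel n).
- by apply: (cvg0_dominated (c := C) _ hnm) => n; rewrite ger0_norm ?(fnorm_ge0 hQ)//;
    exact: (local_operator_lipschitz hP hQ G_loc hu (hsel n)).
have h1 : {ae mu, forall t, forall j, S (xs j) t = L t (xs j)}.
  by apply: ae_forall_countable => j; exact: L4.
have h2 : {ae mu, forall t, forall n, G (fun t => xs (s n t)) t = S (xs (s n t)) t}.
  by apply: ae_forall_countable => n; exact: local_selector (ss n).
apply: filterS2 h1 h2 => t h1 h2.
have [c c0 hc] := Lb t.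
apply: (cvg0_dominated (c := c) _ (hpt t)) => n.
rewrite normr_id h2 h1 -(linear_onB (setT_subspace X) (L1 t))//; exact: hc.
Qed.

End pointwise_form.

(** * Operators that commute with isometries *)

Section intertwining.
Context d (T : measurableType d) (R : realType).
Variable mu : {finite_measure set T -> \bar R}.

(** The multiplication by the imaginary unit is such a map; commutation with it
    expresses complex linearity. *)
Definition isometry_on_vectors (V : normedModType R) (J : V -> V) :=
  linear_on setT J /\ forall v, `|J v| = `|v|.

Lemma isometry_dist (V : normedModType R) (J : V -> V) v w :
  isometry_on_vectors J -> `|J v - J w| = `|v - w|.
Proof. by move=> [lJ nJ]; rewrite -(linear_onB (setT_subspace V) lJ)// nJ. Qed.

Lemma short_map_continuous (U V : normedModType R) (h : U -> V) :
  (forall u v, `|h u - h v| <= `|u - v|) -> continuous h.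
Proof.
move=> hd v; apply/cvgrPdist_lt => e e0.
apply: filterS (nbhsx_ballx v e e0) => w; rewrite -ball_normE /=.
exact: le_lt_trans (hd _ _).
Qed.

Lemma isometry_continuous (V : normedModType R) (J : V -> V) :
  isometry_on_vectors J -> continuous J.
Proof. by move=> hJ; apply: short_map_continuous => u v; rewrite isometry_dist. Qed.

Lemma fspace_isometry rho (hrho : function_norm mu rho) (V : normedModType R) (J : V -> V)
  (u : T -> V) : isometry_on_vectors J -> fspace rho u ->
  fspace rho (fun t => J (u t)) /\ fnorm rho (fun t => J (u t)) <= fnorm rho u.
Proof.
move=> hJ hu; apply: (fspace_le hrho _ hu) => [|t]; last by rewrite hJ.2.
exact: smeas_comp (isometry_continuous hJ) hu.1.
Qed.

Variables rhoP rhoQ : (T -> R) -> \bar R.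
Hypotheses (hP : function_norm mu rhoP) (hQ : function_norm mu rhoQ).
Variables (X Y : normedModType R) (JX : X -> X) (JY : Y -> Y).
Hypotheses (hJX : isometry_on_vectors JX) (hJY : isometry_on_vectors JY).

Definition intertwining (G : (T -> X) -> T -> Y) := forall u, fspace rhoP u ->
  {ae mu, forall t, G (fun t => JX (u t)) t = JY (G u t)}.

(** The composition of a functional with [JY] is again a bounded functional. *)
Lemma intertwining_limit C (G_ : nat -> (T -> X) -> T -> Y) G :
  (forall n, local_operator mu rhoP rhoQ C (G_ n)) -> local_operator mu rhoP rhoQ C G ->
  (forall u l, fspace rhoP u -> bounded_functional rhoQ l ->
      l (G_ n u) @[n --> \oo] --> l (G u)) ->
  (forall n, intertwining (G_ n)) -> intertwining G.
Proof.
move=> hG_ hG GG iG u hu.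
have hJu := (fspace_isometry hP hJX hu).1.
have hGu := lo_in hG hu.
have [hJG _] := fspace_isometry hQ hJY hGu.
apply: (weak_limit_unique hQ (lo_in hG hJu) hJG) => l hl.
have hl' : bounded_functional rhoQ (fun g => l (fun t => JY (g t))).
  split=> [a f g hf hg|].
    rewrite -hl.1; [|exact: (fspace_isometry hQ hJY hf).1|exact: (fspace_isometry hQ hJY hg).1].
    by congr l; apply/funext => t; rewrite hJY.1.
  have [c c0 hc] := hl.2; exists c => // f hf.
  have [h1 h2] := fspace_isometry hQ hJY hf.
  by apply: le_trans (hc _ h1) _; exact: ler_wpM2l.
apply: (cvg_unique _ (GG _ l hJu hl)) => //.
rewrite (_ : (fun n => l (G_ n _)) = (fun n => l (fun t => JY (G_ n u t)))).
  exact: GG hl'.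
apply/funext => n; apply: (functional_ae hQ hl _ _ (iG n u hu)).
  exact: lo_in (hG_ n) _ hJu.
exact: (fspace_isometry hQ hJY (lo_in (hG_ n) hu)).1.1.
Qed.

(** Outside one null set the identity holds on a countable dense set, hence
    everywhere by continuity; on the null set [L] is replaced by 0. *)
Lemma pointwise_intertwining (G : (T -> X) -> T -> Y) (L : T -> X -> Y) (xs : nat -> X) :
  intertwining G -> (forall t, linear_on setT (L t)) ->
  (forall t, exists2 c, 0 <= c & forall x, `|L t x| <= c * `|x|) ->
  (forall u, fspace rhoP u -> {ae mu, forall t, G u t = L t (u t)}) ->
  (forall x (e : R), 0 < e -> exists j, `|x - xs j| < e) ->
  exists L' : T -> X -> Y, [/\ forall t, linear_on setT (L' t),
    forall t, exists2 c, 0 <= c & forall x, `|L' t x| <= c * `|x|,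
    forall t x, L' t (JX x) = JY (L' t x) &
    forall u, fspace rhoP u -> {ae mu, forall t, G u t = L' t (u t)}].
Proof.
move=> iG lL bL GL xd.
pose good t := forall x, L t (JX x) = JY (L t x).
have aeg : {ae mu, forall t, good t}.
  have : {ae mu, forall t, forall j, L t (JX (xs j)) = JY (L t (xs j))}.
    apply: ae_forall_countable => j.
    have hx := fspace_cst hP (xs j).
    apply: filterS3 (iG _ hx) (GL _ hx) (GL _ (fspace_isometry hP hJX hx).1).
    by move=> t h1 h2 h3; rewrite -h3 h1 h2.
  apply: filterS => t ht x; apply/eqP; rewrite -subr_eq0 -normr_eq0.
  apply/eqP/le_anti/andP; split=> //; apply/ler_addgt0Pl => e e0; rewrite addr0.
  have [c c0 hc] := bL t.
  have c1 : 0 < c + c + 1 by rewrite ltr_wpDl// addr_ge0.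
  have [j hj] := xd x _ (divr_gt0 e0 c1).
  move: hj; rewrite ltr_pdivlMr// => /ltW; apply: le_trans.
  rewrite -(subrK (L t (JX (xs j))) (L t (JX x))) -addrA ht.
  apply: le_trans (ler_normD _ _) _; rewrite !mulrDr mulr1.
  apply: le_trans (_ : _ <= c * `|x - xs j| + c * `|x - xs j|) _.
    apply: lerD.
      rewrite -ht -(linear_onB (setT_subspace X) (lL t))//.
      by rewrite -(isometry_dist x (xs j) hJX).
    rewrite isometry_dist// -(linear_onB (setT_subspace X) (lL t))//.
    by apply: le_trans (hc _) _; rewrite distrC.
  by rewrite ![c * _]mulrC lerDl.
exists (fun t => if pselect (good t) then L t else fun=> 0); split.
- by move=> t; case: (pselect (good t)) => _ /=; [exact: lL|
    move=> a x y _ _; rewrite scaler0 addr0].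
- by move=> t; case: (pselect (good t)) => _ /=; [exact: bL|
    exists 0 => // x; rewrite normr0 mul0r].
- move=> t x; case: (pselect (good t)) => [gt|_] /=; first exact: gt.
  by apply/esym/normr0_eq0; rewrite hJY.2 normr0.
- by move=> u hu; apply: filterS2 aeg (GL u hu) => t gt ->; case: (pselect (good t)).
Qed.

End intertwining.

(** * Lebesgue norms of extended nonnegative functions *)

Section extended_lebesgue_norm.
Local Open Scope ereal_scope.
Context d (T : measurableType d) (R : realType).
Variable mu : {finite_measure set T -> \bar R}.
Variable p : R.
Hypothesis p_ge1 : (1 <= p)%R.
Implicit Types f g : T -> \bar R.

Let p_gt0 : (0 < p)%R. Proof. exact: lt_le_trans p_ge1. Qed.
Let p_neq0 : p != 0%R. Proof. exact: lt0r_neq0. Qed.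

Lemma poweR_le (r : R) (x y : \bar R) : (0 < r)%R -> 0 <= x -> x <= y ->
  x `^ r <= y `^ r.
Proof.
move=> r0 x0 xy; apply: gt0_ler_poweR => //; rewrite ?ltW// in_itv/= leey andbT//.
exact: le_trans xy.
Qed.

Lemma poweRK (r : R) (x : \bar R) : r != 0%R -> 0 <= x -> (x `^ r) `^ r^-1 = x.
Proof. by move=> r0 x0; rewrite -poweRrM mulfV// poweRe1. Qed.

Lemma poweRVK (r : R) (x : \bar R) : r != 0%R -> 0 <= x -> (x `^ r^-1) `^ r = x.
Proof. by move=> r0 x0; rewrite -poweRrM mulVf// poweRe1. Qed.

(** The norm of [L^p] of a nonnegative function that may take the value
    infinity; such functions arise as inner norms. *)
Definition enorm (f : T -> \bar R) : \bar R := (\int[mu]_t (f t) `^ p) `^ p^-1.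

Lemma enorm_ge0 f : 0 <= enorm f.
Proof. exact: poweR_ge0. Qed.

Lemma LnormE f : Lnorm mu p%:E f = enorm (fun t => `|f t|).
Proof. by rewrite unlock. Qed.

Lemma eq_enorm f g : (forall t, f t = g t) -> enorm f = enorm g.
Proof. by move=> fg; congr enorm; apply/funext. Qed.

Lemma measurable_pow f : measurable_fun setT f -> measurable_fun setT (fun t => f t `^ p).
Proof. by move=> mf; apply: (measurableT_comp (measurable_poweR p) mf). Qed.

Lemma integral_pow_ge0 f : 0 <= \int[mu]_t (f t) `^ p.
Proof. by apply: integral_ge0 => t _; exact: poweR_ge0. Qed.

Lemma poweR_enorm f : enorm f `^ p = \int[mu]_t (f t) `^ p.
Proof. by rewrite /enorm poweRVK// integral_pow_ge0. Qed.

Lemma enorm_le_pow f (C : \bar R) : 0 <= C ->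
  (enorm f <= C) = (\int[mu]_t (f t) `^ p <= C `^ p).
Proof.
move=> C0; apply/idP/idP => h.
  by rewrite -poweR_enorm; apply: poweR_le => //; exact: enorm_ge0.
rewrite -(poweRK p_neq0 C0); apply: poweR_le => //; first by rewrite invr_gt0.
exact: integral_pow_ge0.
Qed.

Lemma enorm_le f g : measurable_fun setT f -> measurable_fun setT g ->
  (forall t, 0 <= f t) -> (forall t, 0 <= g t) ->
  {ae mu, forall t, f t <= g t} -> enorm f <= enorm g.
Proof.
move=> mf mg f0 g0 fg; rewrite enorm_le_pow ?enorm_ge0// poweR_enorm.
apply: ae_ge0_le_integral => //; try exact: measurable_pow.
- by move=> t _; exact: poweR_ge0.
- by move=> t _; exact: poweR_ge0.
by apply: filterS fg => t fg _; exact: poweR_le.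
Qed.

Lemma enormZ (c : R) f : (0 <= c)%R -> measurable_fun setT f -> (forall t, 0 <= f t) ->
  enorm (fun t => c%:E * f t) = c%:E * enorm f.
Proof.
move=> c0 mf f0; rewrite /enorm.
under eq_integral => t _ do rewrite poweRM ?lee_fin//.
rewrite ge0_integralZl//; last 3 first.
- exact: measurable_pow.
- by move=> t _; exact: poweR_ge0.
- exact: poweR_ge0.
rewrite poweRM ?poweR_ge0 ?integral_pow_ge0// poweRK//.
Qed.

Lemma enorm_finite_ae f : measurable_fun setT f -> (forall t, 0 <= f t) ->
  enorm f < +oo -> {ae mu, forall t, f t < +oo}.
Proof.
move=> mf f0 /(poweR_lty p); rewrite poweR_enorm => h.
have /integrable_ae : mu.-integrable setT (fun t => f t `^ p).
  apply/integrableP; split; first exact: measurable_pow.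
  by under eq_integral do rewrite gee0_abs ?poweR_ge0//.
move=> /(_ measurableT); apply: filterS => t /(_ Logic.I).
rewrite ge0_fin_numE ?poweR_ge0//; exact: lty_poweRy.
Qed.

Lemma enormD f g : measurable_fun setT f -> measurable_fun setT g ->
  (forall t, 0 <= f t) -> (forall t, 0 <= g t) ->
  enorm (fun t => f t + g t) <= enorm f + enorm g.
Proof.
move=> mf mg f0 g0.
have [->|foo] := eqVneq (enorm f) +oo; first by rewrite addye ?leey// -ltNye (lt_le_trans _ (enorm_ge0 _)).
rewrite -ltey in foo.
have [->|goo] := eqVneq (enorm g) +oo; first by rewrite addey ?leey// -ltNye (lt_le_trans _ (enorm_ge0 _)).
rewrite -ltey in goo.
have mF : measurable_fun setT (fine \o f) by exact: measurableT_comp.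
have mG : measurable_fun setT (fine \o g) by exact: measurableT_comp.
have E h : measurable_fun setT h -> (forall t, 0 <= h t) -> enorm h < +oo ->
    Lnorm mu p%:E (EFin \o (fine \o h)) <= enorm h.
  move=> mh h0 hoo; rewrite LnormE; apply: enorm_le => //.
  - by apply: measurableT_comp => //; apply/measurable_EFinP; exact: measurableT_comp.
  by apply: aeW => t /=; rewrite ger0_norm ?fine_ge0//; case: (h t) (h0 t) => //= _; exact: leey.
apply: le_trans (leeD (E _ mf f0 foo) (E _ mg g0 goo)).
apply: le_trans (minkowski_EFin mu mF mG p_ge1).
rewrite LnormE; apply: enorm_le => //.
- exact: emeasurable_funD.
- apply: measurableT_comp => //; apply/measurable_EFinP; exact: measurable_funD.
- by move=> t; exact: adde_ge0.
apply: filterS2 (enorm_finite_ae mf f0 foo) (enorm_finite_ae mg g0 goo) => t ft gt.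
rewrite /= ger0_norm ?addr_ge0 ?fine_ge0// EFinD !fineK ?ge0_fin_numE//.
Qed.

Lemma enorm_cst1 : enorm (fun=> 1) < +oo.
Proof.
apply: poweR_lty; under eq_integral do rewrite poweR1r.
by rewrite integral_cst// mul1e -ge0_fin_numE//; exact: fin_num_measure.
Qed.

(** The inequality [x <= 1 + x ^ p] gives the case of norm at most 1, and the rest
    follows by homogeneity. *)
Lemma integral_le_enorm f : measurable_fun setT f -> (forall t, 0 <= f t) ->
  \int[mu]_t f t <= (fine (mu setT) + 1)%:E * enorm f.
Proof.
move=> mf f0.
have muT : mu setT \is a fin_num by exact: fin_num_measure.
have c0 : (0 < fine (mu setT) + 1)%R by rewrite ltr_wpDl// fine_ge0.
have key g : measurable_fun setT g -> (forall t, 0 <= g t) -> enorm g <= 1 ->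
    \int[mu]_t g t <= (fine (mu setT) + 1)%:E.
  move=> mg g0; rewrite enorm_le_pow// poweR1r => hg.
  apply: (@le_trans _ _ (\int[mu]_t (1 + g t `^ p))).
    apply: ge0_le_integral => //.
    - by apply: emeasurable_funD => //; exact: measurable_pow.
    move=> t _; have [g1|g1] := leP (g t) 1.
      by apply: le_trans g1 _; rewrite leeDl// poweR_ge0.
    apply: (@le_trans _ _ (g t `^ p)); last by rewrite leeDr.
    case: (g t) g1 => [x| |]//=.
      by rewrite lte_fin lee_fin => x1; apply: le1r_powR => //; exact: ltW.
    by rewrite (negbTE p_neq0).
  rewrite ge0_integralD//; last 2 first.
  - by move=> t _; exact: poweR_ge0.
  - exact: measurable_pow.
  by rewrite integral_cst// mul1e EFinD fineK// leeD2l.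
have [foo|foo] := ltP (enorm f) +oo; last first.
  by move: foo; rewrite leye_eq => /eqP ->; rewrite gt0_muley ?leey// lte_fin.
have fE : enorm f \is a fin_num by rewrite ge0_fin_numE ?enorm_ge0.
rewrite -(fineK fE) -EFinM.
apply/lee_addgt0Pr => e e0.
pose a := (fine (enorm f) + e / (fine (mu setT) + 1))%R.
have a0 : (0 < a)%R by rewrite ltr_wpDl ?divr_gt0// fine_ge0// enorm_ge0.
have ai0 : (0 <= a^-1)%R by rewrite invr_ge0 ltW.
have h := key (fun t => a^-1%:E * f t) (measurable_funeM _ mf).
rewrite enormZ// ge0_integralZl// in h.
have {h} : a^-1%:E * \int[mu]_t f t <= (fine (mu setT) + 1)%:E.
  apply: h => [t|]; first by rewrite mule_ge0.
  rewrite -(fineK fE) -EFinM lee_fin mulrC ler_pdivrMr// mul1r lerDl.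
  by rewrite divr_ge0// ltW.
rewrite lee_pdivrMl// => h; apply: le_trans h _.
by rewrite -EFinM -EFinD lee_fin mulrC mulrDr mulrCA mulfV ?lt0r_neq0// mulr1.
Qed.

(** The power function is an order isomorphism of the nonnegative extended
    reals. *)
Lemma poweR_sup (r : R) (u : nat -> \bar R) : (0 < r)%R -> (forall n, 0 <= u n) ->
  ereal_sup (range u) `^ r = ereal_sup (range (fun n => u n `^ r)).
Proof.
move=> r0 u0; have rn0 : r != 0%R by exact: lt0r_neq0.
have s0 : 0 <= ereal_sup (range u).
  by apply: le_trans (u0 0%N) _; apply: ereal_sup_ubound; exists 0%N.
have s0' : 0 <= ereal_sup (range (fun n => u n `^ r)).
  apply: (@le_trans _ _ (u 0%N `^ r)); first exact: poweR_ge0.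
  by apply: ereal_sup_ubound; exists 0%N.
apply/le_anti/andP; split.
  rewrite -[leRHS](poweRVK rn0)//; apply: poweR_le => //.
  apply: ge_ereal_sup => _ [n _ <-]; rewrite -(poweRK rn0 (u0 n)).
  apply: poweR_le; [by rewrite invr_gt0|exact: poweR_ge0|].
  by apply: ereal_sup_ubound; exists n.
apply: ge_ereal_sup => _ [n _ <-]; apply: poweR_le => //.
by apply: ereal_sup_ubound; exists n.
Qed.

Lemma enorm_sup (f_ : nat -> T -> \bar R) : (forall n, measurable_fun setT (f_ n)) ->
  (forall n t, 0 <= f_ n t) -> (forall t, nondecreasing_seq (f_ ^~ t)) ->
  enorm (fun t => ereal_sup (range (f_ ^~ t))) = ereal_sup (range (fun n => enorm (f_ n))).
Proof.
move=> mf f0 fm; rewrite /enorm -[RHS](@poweR_sup _ (fun n => \int[mu]_t f_ n t `^ p)); last 2 first.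
- by rewrite invr_gt0.
- by move=> n; exact: integral_pow_ge0.
congr (_ `^ _).
have pm t : nondecreasing_seq (fun n => f_ n t `^ p).
  by move=> n m nm; apply: poweR_le => //; exact: fm.
under eq_integral => t _ do rewrite poweR_sup// -(cvg_lim _ (ereal_nondecreasing_cvgn (pm t)))//.
rewrite (@monotone_convergence _ _ _ mu setT measurableT (fun n t => f_ n t `^ p)); last 3 first.
- by move=> n; exact: measurable_pow.
- by move=> n t _; exact: poweR_ge0.
- by move=> t _; exact: pm.
apply/cvg_lim => //; apply: ereal_nondecreasing_cvgn => n m nm.
apply: ge0_le_integral => //; try exact: measurable_pow.
  by move=> t _; exact: poweR_ge0.
by move=> t _; exact: pm.
Qed.

Lemma ecvg0P (u : nat -> \bar R) : (forall n, 0 <= u n) ->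
  (u n @[n --> \oo] --> 0 <-> forall e : R, (0 < e)%R -> \forall n \near \oo, u n < e%:E).
Proof.
move=> u0; split.
  move=> /fine_cvgP[uf /cvgrPdist_lt h] e e0.
  apply: filterS2 uf (h e e0) => n un; rewrite sub0r normrN /= ger0_norm ?fine_ge0//.
  by rewrite -lte_fin fineK.
move=> h; apply/fine_cvgP; split.
  by apply: filterS (h 1%R ltr01) => n un; rewrite ge0_fin_numE// (lt_trans un)// ltry.
apply/cvgrPdist_lt => e e0; apply: filterS (h e e0) => n un.
rewrite sub0r normrN /= ger0_norm ?fine_ge0// -lte_fin fineK//.
by rewrite ge0_fin_numE// (lt_trans un)// ltry.
Qed.

Lemma poweR_cvg0 (r : R) (u : nat -> \bar R) : (0 < r)%R -> (forall n, 0 <= u n) ->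
  u n @[n --> \oo] --> 0 -> u n `^ r @[n --> \oo] --> 0.
Proof.
move=> r0 u0 /(ecvg0P u0) h; have rn0 : r != 0%R by exact: lt0r_neq0.
apply/ecvg0P => [n|e e0]; first exact: poweR_ge0.
have e1 : (0 < e `^ r^-1)%R by exact: powR_gt0.
apply: filterS (h _ e1) => n un.
rewrite ltNge; apply/negP => /(poweR_le (r := r^-1)).
rewrite poweRK// poweR_EFin => /(_ _ _)/(lt_le_trans un).
by rewrite ltxx invr_gt0 lee_fin r0 (ltW e0) => /(_ isT isT).
Qed.

Lemma enorm_dominated (f_ : nat -> T -> \bar R) g :
  (forall n, measurable_fun setT (f_ n)) -> measurable_fun setT g ->
  (forall n t, 0 <= f_ n t <= g t) -> enorm g < +oo ->
  {ae mu, forall t, f_ n t @[n --> \oo] --> 0} -> enorm (f_ n) @[n --> \oo] --> 0.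
Proof.
move=> mf mg fg goo f0.
have g0 t : 0 <= g t by have /andP[a b] := fg 0%N t; exact: le_trans b.
apply: poweR_cvg0; first by rewrite invr_gt0.
  by move=> n; exact: integral_pow_ge0.
have [|||||_ _] := @dominated_convergence _ _ _ mu setT measurableT
  (fun n t => f_ n t `^ p) (cst 0) (fun t => g t `^ p).
- by move=> n; exact: measurable_pow.
- exact: measurable_cst.
- apply: filterS f0 => t ft _; apply: poweR_cvg0 => // n.
  by have /andP[] := fg n t.
- apply/integrableP; split; first exact: measurable_pow.
  under eq_integral do rewrite gee0_abs ?poweR_ge0//.
  by rewrite -poweR_enorm poweR_lty.
- apply: aeW => t n _; rewrite gee0_abs ?poweR_ge0//.
  by have /andP[f0' fg'] := fg n t; exact: poweR_le.
by rewrite integral0.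
Qed.

End extended_lebesgue_norm.

Section power_sums.
Local Open Scope ereal_scope.
Context d (T : measurableType d) (R : realType).

Lemma poweR_subadditive (r : R) (x y : \bar R) : (0 < r <= 1)%R -> 0 <= x -> 0 <= y ->
  (x + y) `^ r <= x `^ r + y `^ r.
Proof.
move=> /andP[r0 r1]; have rn0 : r != 0%R by exact: lt0r_neq0.
case: x => [x| |]// x0; last first.
  by move=> y0; rewrite [X in _ <= X + _]poweRyr// [X in _ <= X]addye ?leey// -ltNye (lt_le_trans _ (poweR_ge0 _ _)).
case: y => [y| |]// y0; last first.
  by rewrite [X in _ <= _ + X]poweRyr// [X in _ <= X]addey ?leey// -ltNye (lt_le_trans _ (poweR_ge0 _ _)).
rewrite !lee_fin in x0 y0; rewrite -EFinD !poweR_EFin -EFinD lee_fin.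
have [s0|] := ltP 0%R (x + y)%R; last first.
  move=> s0; have -> : x = 0%R by lra.
  by rewrite powR0// !add0r.
have s0' := ltW s0.
have H z : (0 <= z <= x + y)%R -> (z / (x + y) * (x + y) `^ r <= z `^ r)%R.
  move=> /andP[z0 zs]; have [->|zn0] := eqVneq z 0%R.
    by rewrite mul0r mul0r powR_ge0.
  rewrite -{2}(divfK (lt0r_neq0 s0) z) powRM ?divr_ge0//.
  apply: ler_wpM2r; first exact: powR_ge0.
  apply: ger1_powR => //; rewrite divr_gt0 ?lt_def ?zn0//=; last first.
    by rewrite s0' lt0r_neq0.
  by rewrite ler_pdivrMr// mul1r.
have -> : ((x + y) `^ r = x / (x + y) * (x + y) `^ r + y / (x + y) * (x + y) `^ r)%R.
  by rewrite -mulrDl -mulrDl mulfV ?lt0r_neq0// mul1r.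
by apply: lerD; apply: H; apply/andP; split; lra.
Qed.

Lemma powR2_lt2 (q : R) : (1 < q)%R -> (2 `^ q^-1 < 2)%R.
Proof.
move=> q1; have q0 : (0 < q)%R by exact: lt_trans q1.
have q1' : (0 < q - 1)%R by rewrite subr_gt0.
have h1 : (2 < 2 `^ q)%R.
  rewrite -mulr_powRB1// ltr_pMr//.
  have := gt0_ltr_powR q1' (x := 1%R) (y := 2%R).
  by rewrite powR1 !nnegrE; apply => //; rewrite ltr1n.
rewrite ltNge; apply/negP => /(ge0_ler_powR (ltW q0)).
rewrite !nnegrE powR_ge0 -powRrM mulVf ?lt0r_neq0// powRr1// => /(_ _ _)/(lt_le_trans h1).
by rewrite ltxx ler0n => /(_ isT isT).
Qed.

(** When [q1 <= q2] the power [q1] of the integrated function is at most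
    [a ^ q1 + b ^ q1]; when [q1 > q2] the triangle inequality with the exponent
    [q1 / q2] applies to [a ^ q2] and [b ^ q2].  By [powR2_lt2] the constant is
    smaller than 2. *)
Lemma enorm_power_sum (mu : {finite_measure set T -> \bar R}) (q1 q2 : R)
    (a b : T -> \bar R) : (1 < q1)%R -> (1 < q2)%R ->
  measurable_fun setT a -> measurable_fun setT b ->
  (forall t, 0 <= a t) -> (forall t, 0 <= b t) ->
  enorm mu q1 a <= 1 -> enorm mu q1 b <= 1 ->
  enorm mu q1 (fun t => (a t `^ q2 + b t `^ q2) `^ q2^-1) <=
  (Num.max (2 `^ q1^-1) (2 `^ q2^-1))%R%:E.
Proof.
move=> q1_gt1 q2_gt1 ma mb a0 b0 a1 b1.
have q10 : (0 < q1)%R by exact: lt_trans q1_gt1.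
have q20 : (0 < q2)%R by exact: lt_trans q2_gt1.
have [q1' q2'] := (ltW q1_gt1, ltW q2_gt1).
have le1 (F : T -> \bar R) : enorm mu q1 F <= 1 -> \int[mu]_t F t `^ q1 <= 1.
  by rewrite enorm_le_pow// poweR1r.
have ha := le1 _ a1; have hb := le1 _ b1.
have two (x y : \bar R) : x <= 1 -> y <= 1 -> x + y <= 2%:E.
  by move=> x1 y1; have -> : 2%:E = 1 + 1 :> \bar R by []; exact: leeD.
have [q12|q21] := leP q1 q2.
  apply: (@le_trans _ _ (2 `^ q1^-1)%R%:E); last by rewrite lee_fin le_max lexx.
  rewrite enorm_le_pow//.
  rewrite poweR_EFin -powRrM mulVf ?lt0r_neq0// powRr1//.
  apply: (@le_trans _ _ (\int[mu]_t (a t `^ q1 + b t `^ q1))).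
    apply: ge0_le_integral => //.
    - by move=> t _; exact: poweR_ge0.
    - apply: measurable_pow; apply: (measurableT_comp (measurable_poweR _)).
      by apply: emeasurable_funD; exact: measurable_pow.
    - by apply: emeasurable_funD; exact: measurable_pow.
    move=> t _; rewrite -poweRrM.
    have e z : z `^ q1 = (z `^ q2) `^ (q2^-1 * q1) :> \bar R.
      by rewrite -poweRrM mulrA mulfV ?mul1r// lt0r_neq0.
    rewrite (e (a t)) (e (b t)).
    apply: poweR_subadditive; rewrite ?poweR_ge0// mulr_gt0 ?invr_gt0//=.
    by rewrite mulrC ler_pdivrMr// mul1r.
  rewrite ge0_integralD//; last 4 first.
  - by move=> t _; exact: poweR_ge0.
  - exact: measurable_pow.
  - by move=> t _; exact: poweR_ge0.
  - exact: measurable_pow.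
  exact: two.
apply: (@le_trans _ _ (2 `^ q2^-1)%R%:E); last by rewrite lee_fin le_max lexx orbT.
have r1 : (1 <= q1 / q2)%R by rewrite ler_pdivlMr// mul1r ltW.
have r0 : (0 < q1 / q2)%R by exact: lt_le_trans r1.
have E (F : T -> \bar R) : (forall t, 0 <= F t) ->
    enorm mu q1 (fun t => F t `^ q2^-1) = enorm mu (q1 / q2) F `^ q2^-1.
  move=> F0; rewrite /enorm -poweRrM; congr (_ `^ _); last first.
    by rewrite invfM invrK -mulrA mulfV ?mulr1// lt0r_neq0.
  by apply: eq_integral => t _; rewrite -poweRrM mulrC.
rewrite E; last by move=> t; rewrite adde_ge0 ?poweR_ge0.
rewrite -poweR_EFin; apply: poweR_le; [by rewrite invr_gt0|exact: enorm_ge0|].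
have pow1 (F : T -> \bar R) : \int[mu]_t F t `^ q1 <= 1 ->
    enorm mu (q1 / q2) (fun t => F t `^ q2) <= 1.
  move=> F1; rewrite enorm_le_pow// poweR1r.
  rewrite (eq_integral (fun t => F t `^ q1))// => t _.
  by rewrite -poweRrM mulrCA mulfV ?mulr1// lt0r_neq0.
apply: le_trans (enormD mu r1 _ _ _ _) _; try exact: measurable_pow.
- by move=> t; exact: poweR_ge0.
- by move=> t; exact: poweR_ge0.
by apply: two; exact: pow1.
Qed.

End power_sums.

(** * Mixed norms *)

Section restricted_product_measure.
Context d1 d2 (T1 : measurableType d1) (T2 : measurableType d2) (R : realType).
Variables (mu1 : {finite_measure set T1 -> \bar R}) (mu2 : {finite_measure set T2 -> \bar R}).
Variable M : set (set (T1 * T2)).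

(** The inclusion is an argument so that it is available to the measure
    structure. *)
Definition restricted_product (h : M `<=` @measurable _ (T1 * T2)%type)
  (A : set (g_sigma_algebraType M)) : \bar R := (mu1 \x mu2)%E A.

Variable h : M `<=` @measurable _ (T1 * T2)%type.

Lemma sub_measurable (A : set (T1 * T2)) :
  measurable (A : set (g_sigma_algebraType M)) -> measurable A.
Proof.
by move: A; apply: smallest_sub h; exact: sigma_algebra_measurable.
Qed.

Let restricted0 : restricted_product h set0 = 0%E.
Proof. exact: measure0. Qed.

Let restricted_ge0 A : (0 <= restricted_product h A)%E.
Proof. exact: measure_ge0. Qed.

Let restricted_sigma_additive : semi_sigma_additive (restricted_product h).
Proof.
move=> F mF tF mUF; apply: measure_semi_sigma_additive => //.
  by move=> n; exact: (sub_measurable (mF n)).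
exact: (sub_measurable mUF).
Qed.

HB.instance Definition _ := isMeasure.Build _ _ _ (restricted_product h)
  restricted0 restricted_ge0 restricted_sigma_additive.

Let restricted_finite : fin_num_fun (restricted_product h).
Proof.
move=> A mA; rewrite ge0_fin_numE ?restricted_ge0//.
apply: (@le_lt_trans _ _ ((mu1 \x mu2)%E setT)).
  apply: (@le_measure _ _ _ (mu1 \x mu2)%E) => //; rewrite inE; last exact: measurableT.
  exact: (sub_measurable mA).
rewrite -setXTT product_measure1E// lte_mul_pinfty//.
  by rewrite fin_num_measure.
by rewrite -ge0_fin_numE// fin_num_measure.
Qed.

HB.instance Definition _ := Measure_isFinite.Build _ _ _ (restricted_product h)
  restricted_finite.

Lemma restricted_ae (P : T1 * T2 -> Prop) :
  {ae restricted_product h, forall w, P w} -> {ae (mu1 \x mu2)%E, forall w, P w}.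
Proof.
by move=> [N [mN N0 hN]]; exists N; split=> //; exact: sub_measurable.
Qed.

Lemma product_ae (P : T1 * T2 -> Prop) : {ae (mu1 \x mu2)%E, forall w, P w} ->
  {ae mu1, forall w1, {ae mu2, forall w2, P (w1, w2)}}.
Proof.
move=> [N [mN N0 hN]].
have mx := @measurable_fun_xsection _ _ _ _ _ mu2 N mN.
have : (\int[mu1]_x `|(mu2 \o xsection N) x| = 0)%E.
  by under eq_integral do rewrite gee0_abs//; exact: N0.
move=> /(ae_eq_integral_abs mu1 measurableT mx); apply: filterS => w1 /(_ Logic.I) h1.
exists (xsection N w1); split=> //; first exact: measurable_xsection.
by move=> w2 nP; rewrite /xsection /= inE; exact: hN.
Qed.

End restricted_product_measure.

Section mixed_norm_theory.
Local Open Scope ereal_scope.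
Context d1 d2 (T1 : measurableType d1) (T2 : measurableType d2) (R : realType).
Variables (mu1 : {finite_measure set T1 -> \bar R}) (mu2 : {finite_measure set T2 -> \bar R}).
Variable M : set (set (T1 * T2)).
Variable h : M `<=` @measurable _ (T1 * T2)%type.
Local Notation T := (g_sigma_algebraType M).
Local Notation mu := (restricted_product mu1 mu2 h).
Implicit Types f g : T1 * T2 -> R.

Lemma restricted_measurable_fun f :
  measurable_fun setT (f : T -> R) -> measurable_fun setT f.
Proof.
by move=> mf _ A mA; rewrite setTI; apply: (sub_measurable h); rewrite -[X in measurable X]setTI; exact: mf.
Qed.

Section fixed_exponents.
Variables p1 p2 : R.
Hypotheses (p1_ge1 : (1 <= p1)%R) (p2_ge1 : (1 <= p2)%R).

Definition inner_norm f w1 : \bar R := enorm mu2 p2 (fun w2 => `|f (w1, w2)|%:E).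
Definition mixed f : \bar R := enorm mu1 p1 (inner_norm f).

Lemma inner_norm_ge0 f w1 : 0 <= inner_norm f w1.
Proof. exact: enorm_ge0. Qed.

Lemma measurable_section f w1 : measurable_fun setT f ->
  measurable_fun setT (fun w2 => `|f (w1, w2)|%:E).
Proof.
move=> mf; apply/measurable_EFinP; apply: measurableT_comp => //.
by apply: (measurableT_comp mf); exact: measurable_pair1.
Qed.

Lemma measurable_inner_norm f : measurable_fun setT f ->
  measurable_fun setT (inner_norm f).
Proof.
move=> mf; apply: (measurableT_comp (measurable_poweR _)).
apply: (measurable_fun_fubini_tonelli_F (fun w => `|f w|%:E `^ p2)).
  apply: measurable_pow; apply/measurable_EFinP; exact: measurableT_comp.
by move=> w; exact: poweR_ge0.
Qed.

Lemma inner_norm_le f g w1 : measurable_fun setT f -> measurable_fun setT g ->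
  {ae mu2, forall w2, (`|f (w1, w2)| <= `|g (w1, w2)|)%R} -> inner_norm f w1 <= inner_norm g w1.
Proof.
by move=> mf mg fg; apply: enorm_le => //; try exact: measurable_section.
Qed.

Lemma mixed_ge0 f : 0 <= mixed f. Proof. exact: enorm_ge0. Qed.

Lemma mixed_le f g : measurable_fun setT f -> measurable_fun setT g ->
  {ae (mu1 \x mu2), forall w, (`|f w| <= `|g w|)%R} -> mixed f <= mixed g.
Proof.
move=> mf mg /product_ae fg.
apply: enorm_le => //; try exact: measurable_inner_norm; try exact: inner_norm_ge0.
by apply: filterS fg => w1 fg; exact: inner_norm_le.
Qed.

Lemma inner_normD f g w1 : measurable_fun setT f -> measurable_fun setT g ->
  inner_norm (fun w => f w + g w)%R w1 <= inner_norm f w1 + inner_norm g w1.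
Proof.
move=> mf mg; have mfg : measurable_fun setT (fun w => f w + g w)%R by exact: measurable_funD.
apply: le_trans (enormD mu2 p2_ge1 (measurable_section w1 mf) (measurable_section w1 mg) _ _) => //.
apply: (enorm_le p2_ge1 (measurable_section w1 mfg)) => //.
  by apply: emeasurable_funD; exact: measurable_section.
  by move=> w2; rewrite adde_ge0.
by apply: aeW => w2; rewrite -EFinD lee_fin ler_normD.
Qed.

Lemma mixedD f g : measurable_fun setT f -> measurable_fun setT g ->
  mixed (fun w => f w + g w)%R <= mixed f + mixed g.
Proof.
move=> mf mg; have mfg : measurable_fun setT (fun w => f w + g w)%R by exact: measurable_funD.
apply: le_trans (enormD mu1 p1_ge1 (measurable_inner_norm mf) (measurable_inner_norm mg)
  (inner_norm_ge0 f) (inner_norm_ge0 g)).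
apply: enorm_le => //; try exact: measurable_inner_norm; try exact: inner_norm_ge0.
- exact: emeasurable_funD (measurable_inner_norm mf) (measurable_inner_norm mg).
- by move=> w1; rewrite adde_ge0 ?inner_norm_ge0.
by apply: aeW => w1; exact: inner_normD.
Qed.

Lemma mixedZ (c : R) f : measurable_fun setT f ->
  mixed (fun w => c * f w)%R = `|c|%:E * mixed f.
Proof.
move=> mf; rewrite /mixed -enormZ//; last 2 first.
- exact: measurable_inner_norm.
- exact: inner_norm_ge0.
apply: eq_enorm => w1; rewrite /inner_norm -enormZ//; last exact: measurable_section.
by apply: eq_enorm => w2; rewrite normrM.
Qed.

Lemma mixed_one : mixed (fun=> 1%R : R) < +oo.
Proof.
rewrite /mixed; have c2 := enorm_cst1 mu2 p2.
have -> : inner_norm (fun=> 1%R : R) = fun=> (fine (enorm mu2 p2 (fun=> 1%:E)))%:E * 1%:E.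
  apply/funext => w1; rewrite mule1 fineK ?ge0_fin_numE ?enorm_ge0//.
  by apply: eq_enorm => w2; rewrite normr1.
rewrite enormZ ?fine_ge0 ?enorm_ge0//.
by rewrite lte_mul_pinfty ?lee_fin ?fine_ge0 ?enorm_ge0 ?enorm_cst1.
Qed.

Lemma integral_le_mixed f : measurable_fun setT f -> (forall w, 0 <= f w)%R ->
  \int[mu1 \x mu2]_w (f w)%:E <=
  ((fine (mu2 setT) + 1) * (fine (mu1 setT) + 1))%:E * mixed f.
Proof.
move=> mf f0; rewrite fubini_tonelli1//; last exact/measurable_EFinP.
rewrite EFinM -muleA.
apply: (@le_trans _ _ (\int[mu1]_w1 ((fine (mu2 setT) + 1)%:E * inner_norm f w1))).
  apply: ge0_le_integral => //.
  - by move=> w1 _; apply: integral_ge0 => w2 _; rewrite lee_fin.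
  - apply: measurable_fun_fubini_tonelli_F => [|w]; last by rewrite lee_fin.
    exact/measurable_EFinP.
  - by apply: measurable_funeM; exact: measurable_inner_norm.
  move=> w1 _; apply: le_trans (integral_le_enorm mu2 p2_ge1 (measurable_section w1 mf) _) => //.
  by under [leRHS]eq_integral do rewrite ger0_norm//.
rewrite ge0_integralZl//; last 3 first.
- exact: measurable_inner_norm.
- by move=> w1 _; exact: inner_norm_ge0.
- by rewrite lee_fin addr_ge0// fine_ge0.
apply: lee_wpmul2l; first by rewrite lee_fin addr_ge0// fine_ge0.
by apply: integral_le_enorm => //; [exact: measurable_inner_norm|exact: inner_norm_ge0].
Qed.

Lemma mixed_dominated (f_ : nat -> T1 * T2 -> R) g :
  (forall n, measurable_fun setT (f_ n)) -> measurable_fun setT g ->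
  (forall n w, 0 <= f_ n w <= g w)%R -> mixed g < +oo ->
  (forall w, f_ n w @[n --> \oo] --> (0 : R)%R) -> mixed (f_ n) @[n --> \oo] --> 0.
Proof.
move=> mf mg fg goo f0.
have g0 w : (0 <= g w)%R by have /andP[a b] := fg 0%N w; exact: le_trans b.
have fgn n w : (`|f_ n w| <= `|g w|)%R.
  by have /andP[a b] := fg n w; rewrite !ger0_norm.
apply: (enorm_dominated p1_ge1 (g := inner_norm g)) => //.
- by move=> n; exact: measurable_inner_norm.
- exact: measurable_inner_norm.
- by move=> n w1; rewrite inner_norm_ge0/=; apply: inner_norm_le => //; exact: aeW.
have := enorm_finite_ae p1_ge1 (measurable_inner_norm mg) (inner_norm_ge0 g) goo.
apply: filterS => w1 gw1.
apply: (enorm_dominated p2_ge1 (g := fun w2 => `|g (w1, w2)|%:E)) => //.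
- by move=> n; exact: measurable_section.
- exact: measurable_section.
- by move=> n w2; rewrite !lee_fin normr_ge0/=.
apply: aeW => w2; apply: cvg_EFin; first exact: nearW.
by rewrite -[X in _ --> X](normr0 R); apply: cvg_norm; exact: f0.
Qed.

Lemma mixed_monotone (f_ : nat -> T1 * T2 -> R) f (C : \bar R) :
  (forall n, measurable_fun setT (f_ n)) -> (forall n w, 0 <= f_ n w)%R ->
  (forall w, {homo f_ ^~ w : n m / (n <= m)%N >-> (n <= m)%R}) ->
  (forall w, f_ n w @[n --> \oo] --> f w) ->
  (forall n, mixed (f_ n) <= C) -> mixed f <= C.
Proof.
move=> mfn f0 fm ff fC.
have nd w : nondecreasing_seq (fun n => `|f_ n w|%:E).
  by move=> n m nm; rewrite lee_fin !ger0_norm//; exact: fm.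
have fE w : `|f w|%:E = ereal_sup (range (fun n => `|f_ n w|%:E)).
  rewrite -(cvg_lim _ (ereal_nondecreasing_cvgn (nd w)))//.
  apply/esym/cvg_lim => //; apply: cvg_EFin; first exact: nearW.
  by apply: cvg_norm; exact: ff.
have iE w1 : inner_norm f w1 = ereal_sup (range (fun n => inner_norm (f_ n) w1)).
  rewrite /inner_norm -enorm_sup//; first by apply: eq_enorm => w2; rewrite fE.
  by move=> n; exact: measurable_section.
rewrite /mixed (eq_enorm mu1 p1 iE) enorm_sup//.
- by apply: ge_ereal_sup => _ [n _ <-]; exact: fC.
- by move=> n; exact: measurable_inner_norm.
- by move=> n w1; exact: inner_norm_ge0.
move=> w1 n m nm; apply: inner_norm_le => //; apply: aeW => w2.
by rewrite !ger0_norm//; exact: fm.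
Qed.

Lemma restricted_integral f : measurable_fun setT (f : T -> R) -> (forall w, 0 <= f w)%R ->
  \int[mu]_t (f t)%:E = \int[mu1 \x mu2]_w (f w)%:E.
Proof.
move=> mf f0.
have mid : measurable_fun setT (id : T1 * T2 -> T).
  by move=> _ A mA; rewrite setTI; exact: (sub_measurable h mA).
have := @ge0_integral_pushforward _ _ _ _ _ (id : T1 * T2 -> T) mid (mu1 \x mu2) setT (EFin \o f).
rewrite preimage_setT; apply => //; first exact/measurable_EFinP.
by move=> w _; rewrite lee_fin.
Qed.

Lemma mixed_function_norm : function_norm mu (mixed : (T -> R) -> \bar R).
Proof.
have m := restricted_measurable_fun.
split.
- by move=> f; exact: mixed_ge0.
- move=> f g /m mf /m mg fg; apply: mixed_le => //; apply: (@restricted_ae _ _ _ _ _ _ _ _ h).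
  apply: filterS fg => w /andP[f0 fg]; rewrite !ger0_norm//; exact: le_trans fg.
- by move=> f g /m mf /m mg _ _; exact: mixedD.
- by move=> c f c0 /m mf _; rewrite -[X in X%:E * _]ger0_norm//; exact: mixedZ.
- exact: mixed_one.
- exists ((fine (mu2 setT) + 1) * (fine (mu1 setT) + 1))%R.
    by rewrite mulr_gt0// ltr_wpDl// fine_ge0.
  by move=> f mf f0; rewrite restricted_integral//; apply: integral_le_mixed => //; exact: m.
- move=> f_ g mf /m mg; apply: mixed_dominated => // n; exact: m.
- move=> f_ f C mf _ f0 fm ff fC; apply: (mixed_monotone (f_ := f_)) => // n; exact: m.
Qed.

End fixed_exponents.

(** The inner norms of disjoint functions combine as in [enorm_power_sum]. *)
Lemma mixed_disjointly_smooth (q1 q2 : R) : (1 < q1)%R -> (1 < q2)%R ->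
  disjointly_smooth (mixed q1 q2 : (T -> R) -> \bar R).
Proof.
move=> q1_gt1 q2_gt1; have [q1' q2'] := (ltW q1_gt1, ltW q2_gt1).
exists (Num.max (2 `^ q1^-1) (2 `^ q2^-1))%R; first by rewrite gt_max !powR2_lt2.
move=> f g /restricted_measurable_fun mf /restricted_measurable_fun mg f0 g0 fg0 f1 g1.
have iE w1 : inner_norm q2 (fun w => f w + g w)%R w1 =
    (inner_norm q2 f w1 `^ q2 + inner_norm q2 g w1 `^ q2) `^ q2^-1.
  rewrite /inner_norm !poweR_enorm// -ge0_integralD//; last 4 first.
  - by move=> w2 _; exact: poweR_ge0.
  - by apply: measurable_pow; exact: measurable_section.
  - by move=> w2 _; exact: poweR_ge0.
  - by apply: measurable_pow; exact: measurable_section.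
  congr (_ `^ _); apply: eq_integral => w2 _.
  have z : 0%:E `^ q2 = 0 :> \bar R by rewrite poweR0r// lt0r_neq0// (lt_trans _ q2_gt1).
  by case: (fg0 (w1, w2)) => ->; rewrite normr0 z ?add0e ?adde0 ?add0r ?addr0.
rewrite /mixed (eq_enorm mu1 q1 iE).
exact: (enorm_power_sum q1_gt1 q2_gt1 (measurable_inner_norm q2 mf) (measurable_inner_norm q2 mg)
  (inner_norm_ge0 q2 f) (inner_norm_ge0 q2 g) f1 g1).
Qed.

End mixed_norm_theory.

(** * Real and complex scalars *)

Section embedding.
Context (R : realType) (k : scalar_kind).

Definition emb : R -> scalar_field R k :=
  match k with RealScalars => fun x => x | ComplexScalars => fun x => x%:C%C end.

Lemma embD : {morph emb : x y / x + y}.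
Proof. by rewrite /emb; case: k => //= x y; exact: rmorphD. Qed.

Lemma embM : {morph emb : x y / x * y}.
Proof. by rewrite /emb; case: k => //= x y; exact: rmorphM. Qed.

Lemma emb1 : emb 1 = 1. Proof. by rewrite /emb; case: k. Qed.

Lemma emb0 : emb 0 = 0. Proof. by rewrite /emb; case: k. Qed.

Lemma embB : {morph emb : x y / x - y}.
Proof. by rewrite /emb; case: k => //= x y; exact: rmorphB. Qed.

Lemma emb_le x y : (emb x <= emb y) = (x <= y).
Proof. by rewrite /emb; case: k => //=; rewrite lecR. Qed.

Lemma emb_lt x y : (emb x < emb y) = (x < y).
Proof. by rewrite /emb; case: k => //=; rewrite ltcR. Qed.

Lemma emb_gt0 x : (0 < emb x) = (0 < x).
Proof. by rewrite -emb0 emb_lt. Qed.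

Lemma emb_inj : injective emb.
Proof. by rewrite /emb; case: k => //=; exact: complexI. Qed.

Lemma emb_norm x : `|emb x| = emb `|x|.
Proof. by rewrite /emb; case: k => //=; rewrite normc_def /= expr0n addr0 sqrtr_sqr. Qed.

Lemma scalar_re_emb (z : scalar_field R k) : 0 <= z -> emb (scalar_re z) = z.
Proof.
rewrite /emb; case: k z => //= -[a b] /=.
by rewrite lecE /= => /andP[/eqP -> _].
Qed.

Variable V : normedModType (scalar_field R k).

Lemma rnormE (v : V) : emb (rnorm v) = `|v|.
Proof. exact: scalar_re_emb. Qed.

Lemma rnormD (v w : V) : rnorm (v + w) <= rnorm v + rnorm w.
Proof. by rewrite -emb_le embD !rnormE ler_normD. Qed.

Lemma rnormZ (a : R) (v : V) : rnorm (emb a *: v) = `|a| * rnorm v.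
Proof. by apply: emb_inj; rewrite embM !rnormE normrZ emb_norm. Qed.

Lemma rnorm0_eq0 (v : V) : rnorm v = 0 -> v = 0.
Proof. by move=> v0; apply: normr0_eq0; rewrite -rnormE v0 emb0. Qed.

(** The real normed space underlying [V]; an alias keeps its structures apart
    from those over the original scalars. *)
Definition realified : Type := V.

HB.instance Definition _ := GRing.Zmodule.on realified.

Definition real_scale (a : R) (v : realified) : realified := emb a *: (v : V).

Lemma real_scaleA a b v : real_scale a (real_scale b v) = real_scale (a * b) v.
Proof. by rewrite /real_scale scalerA embM. Qed.

Lemma real_scale1 : left_id 1 real_scale.
Proof. by move=> v; rewrite /real_scale emb1 scale1r. Qed.

Lemma real_scaleDr : right_distributive real_scale +%R.
Proof. by move=> a v w; rewrite /real_scale scalerDr. Qed.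

Lemma real_scaleDl v : {morph real_scale^~ v : a b / a + b}.
Proof. by move=> a b; rewrite /real_scale embD scalerDl. Qed.

HB.instance Definition _ := GRing.Zmodule_isLmodule.Build R realified
  real_scaleA real_scale1 real_scaleDr real_scaleDl.

Definition real_norm (v : realified) : R := rnorm (v : V).

Lemma real_normD v w : real_norm (v + w) <= real_norm v + real_norm w.
Proof. exact: rnormD. Qed.

Lemma real_normZ (a : R) (v : realified) : real_norm (a *: v) = `|a| * real_norm v.
Proof. exact: rnormZ. Qed.

Lemma real_norm0_eq0 v : real_norm v = 0 -> v = 0.
Proof. exact: rnorm0_eq0. Qed.

HB.instance Definition _ := Lmodule_isNormed.Build R realified
  real_normD real_normZ real_norm0_eq0.

End embedding.

Section realified_topology.
Context (R : realType) (k : scalar_kind) (V : normedModType (scalar_field R k)).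
Local Notation K := (scalar_field R k).
Local Notation rV := (realified V).

Lemma rnorm_ge0 (v : V) : 0 <= rnorm v.
Proof. exact: (normr_ge0 (v : rV)). Qed.

Lemma scalar_pos (e : K) : 0 < e -> exists2 e' : R, 0 < e' & e = emb k e'.
Proof.
move=> e0; exists (scalar_re e); last by rewrite scalar_re_emb// ltW.
by rewrite -(emb_gt0 k) scalar_re_emb// ltW.
Qed.

Lemma rnorm_lt (v : V) (e : R) : (`|v| < emb k e) = (rnorm v < e).
Proof. by rewrite -rnormE emb_lt. Qed.

Lemma realified_cvg (u : nat -> V) (l : V) :
  (u n @[n --> \oo] --> l) <-> ((u : nat -> rV) n @[n --> \oo] --> (l : rV)).
Proof.
split=> /cvgrPdist_lt h; apply/cvgrPdist_lt.
  move=> e e0; have e0' : 0 < emb k e by rewrite emb_gt0.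
  by apply: filterS (h _ e0') => n; rewrite rnorm_lt.
move=> _ /scalar_pos[e e0 ->]; apply: filterS (h e e0) => n.
by rewrite rnorm_lt.
Qed.

Lemma realified_separable : separable_space V -> exists xs : nat -> rV,
  (forall (x : rV) (e : R), 0 < e -> exists j, `|x - xs j| < e) /\ exists j, xs j = 0.
Proof.
move=> [D cD dD].
have D0 : D !=set0.
  by have [|x [_ Dx]] := dD setT _ openT; [exists 0|exists x].
have [y [yD Dy]] := countable_enum cD D0.
exists (fun n => if n is m.+1 then y m else 0); split; last by exists 0%N.
move=> x e e0; have e0' : 0 < emb k e by rewrite emb_gt0.
have [|z [/= xz Dz]] := dD (ball (x : V) (emb k e)) _ (ball_open (x : V) (emb k e)).
  by exists x; exact: ballxx.
have [m _ ym] := Dy z Dz; exists m.+1; rewrite ym.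
by move: xz; rewrite -ball_normE /= rnorm_lt.
Qed.

End realified_topology.

Lemma realified_complete (R : realType) (k : scalar_kind)
  (V : completeNormedModType (scalar_field R k)) : seq_complete (realified V).
Proof.
move=> u hu; suff [l ul] : exists l : V, (u : nat -> V) n @[n --> \oo] --> l.
  by exists l; apply/realified_cvg.
apply/cvg_ex; apply: cauchy_cvg; apply/cauchy_exP => _ /scalar_pos[e e0 ->].
have [N hN] := hu e e0; exists (u N : V).
by exists N => // n /= Nn; rewrite -ball_normE /ball_/= rnorm_lt; exact: hN.
Qed.

(** * Complex linearity in real terms *)

Section complex_scalars.
Context (R : realType).
Local Notation C := (scalar_field R ComplexScalars).

Definition imag : C := (Complex 0 1 : R[i]).

Lemma complexE (p q : R) : (Complex p q : C) = emb ComplexScalars p + emb ComplexScalars q * imag.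
Proof. by apply/eqP; rewrite eq_complex /=; apply/andP; split; apply/eqP; ring. Qed.

Lemma complex_scale (V : normedModType C) (p q : R) (v : V) :
  (Complex p q : C) *: v = emb ComplexScalars p *: v + emb ComplexScalars q *: (imag *: v).
Proof. by rewrite complexE scalerDl scalerA. Qed.

Lemma imag_imag (V : normedModType C) (v : V) : imag *: (imag *: v) = - v.
Proof.
rewrite scalerA (_ : imag * imag = -1) ?scaleN1r//.
by apply/eqP; rewrite eq_complex /=; apply/andP; split; apply/eqP; ring.
Qed.

Lemma rnorm_imag (V : normedModType C) (v : V) : rnorm (imag *: v) = rnorm v.
Proof.
apply: (@emb_inj R ComplexScalars); rewrite !rnormE normrZ.
rewrite (_ : `|imag| = 1) ?mul1r//.
by rewrite [LHS]normc_def /= expr0n expr1n add0r sqrtr1.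
Qed.

Lemma complex_norm_le (z : C^o) : rnorm z <= `|complex.Re z| + `|complex.Im z|.
Proof.
case: z => a b; rewrite -(emb_le ComplexScalars) rnormE [leLHS]normc_def /= lecR.
rewrite -[leRHS]ger0_norm ?addr_ge0// -sqrtr_sqr ler_wsqrtr// sqrrD.
by rewrite !real_normK ?num_real// lerD2r lerDl mulrn_wge0// mulr_ge0.
Qed.

Lemma Re_norm_le (z : C^o) : `|complex.Re z| <= rnorm z.
Proof.
case: z => a b; rewrite -(emb_le ComplexScalars) rnormE [leRHS]normc_def /= lecR.
by rewrite -sqrtr_sqr ler_wsqrtr// lerDl sqr_ge0.
Qed.

Lemma Im_norm_le (z : C^o) : `|complex.Im z| <= rnorm z.
Proof.
case: z => a b; rewrite -(emb_le ComplexScalars) rnormE [leRHS]normc_def /= lecR.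
by rewrite -sqrtr_sqr ler_wsqrtr// lerDr sqr_ge0.
Qed.

Lemma ReB (z w : C^o) : complex.Re (z - w) = complex.Re z - complex.Re w.
Proof. by case: z w => a b []. Qed.

Lemma Re_linear (p q : R) (z w : C^o) : complex.Re ((Complex p q : C) *: z + w) =
  p * complex.Re z + (q * - complex.Im z + complex.Re w).
Proof. by case: z w => a b [c e] /=; ring. Qed.

Lemma Im_linear (p q : R) (z w : C^o) : complex.Im ((Complex p q : C) *: z + w) =
  p * complex.Im z + (q * complex.Re z + complex.Im w).
Proof. by case: z w => a b [c e] /=; ring. Qed.

End complex_scalars.

Section continuous_functionals.
Context (R : realType) (k : scalar_kind).
Local Notation K := (scalar_field R k).
Variables (U V : normedModType K).

Lemma bounded_continuous (f : U -> V) (c : R) : linear f ->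
  (forall u, rnorm (f u) <= c * rnorm u) -> continuous f.
Proof.
move=> lf fc u; apply/cvgrPdist_lt => _ /scalar_pos[e e0 ->].
have fB x y : f x - f y = f (x - y).
  by have := lf (-1) y x; rewrite !scaleN1r ![- _ + _]addrC => ->.
have c0 : 0 < `|c| + 1 by rewrite ltr_wpDl.
have d0 : 0 < emb k (e / (`|c| + 1)) by rewrite emb_gt0 divr_gt0.
apply: filterS (nbhsx_ballx u _ d0) => w; rewrite -ball_normE /= rnorm_lt => uw.
rewrite rnorm_lt fB; apply: le_lt_trans (fc _) _.
move: uw; rewrite ltr_pdivlMr//; apply: le_lt_trans.
rewrite mulrC ler_wpM2l ?rnorm_ge0//.
by apply: le_trans (ler_norm _) _; rewrite lerDl.
Qed.

Lemma linear_emb (f : U -> V) a u : linear f -> f (emb k a *: u) = emb k a *: f u.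
Proof.
move=> lf; have f0 : f 0 = 0.
  by have := lf (-1) 0 0; rewrite scaler0 add0r scaleN1r addNr.
by have := lf (emb k a) u 0; rewrite f0 !addr0.
Qed.

Lemma continuous_bounded (f : U -> V) : linear f -> continuous f ->
  exists2 c : R, 0 <= c & forall u, rnorm (f u) <= c * rnorm u.
Proof.
move=> lf cf; have f0 : f 0 = 0.
  by have := lf (-1) 0 0; rewrite scaler0 add0r scaleN1r addNr.
have e0 : 0 < emb k (1 : R) by rewrite emb_gt0.
have /cvgrPdist_lt/(_ _ e0)/nbhs_ballP[_ /scalar_pos[d d0 ->] hd] := cf 0.
exists (2 / d) => [|u]; first by rewrite divr_ge0// ltW.
have [u0|un0] := eqVneq (rnorm u) 0.
  by rewrite (rnorm0_eq0 u0) f0 -[rnorm 0]/(`|0 : realified V|) normr0 mulr_ge0 ?rnorm_ge0// divr_ge0// ltW.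
have u0 : 0 < rnorm u by rewrite lt_def un0 rnorm_ge0.
pose a := d / (2 * rnorm u).
have a0 : 0 < a by rewrite divr_gt0// mulr_gt0.
have : rnorm (f (emb k a *: u)) < 1.
  have := hd (emb k a *: u); rewrite -ball_normE /= f0 !sub0r !normrN !rnorm_lt; apply.
  rewrite rnormZ (ger0_norm (ltW a0)) /a.
  rewrite (_ : d / (2 * rnorm u) * rnorm u = d / 2); last by field.
  by rewrite ltr_pdivrMr// ltr_pMr// ltr1n.
rewrite linear_emb// rnormZ (ger0_norm (ltW a0)) => h.
rewrite (_ : 2 / d * rnorm u = a^-1); last by rewrite /a; field; rewrite un0 lt0r_neq0.
by rewrite -[leRHS]mul1r ler_pdivlMr// mulrC ltW.
Qed.

End continuous_functionals.

Section reflexivity_transfer.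
Context (R : realType).

Lemma dual_norm_bound (k : scalar_kind) (Y : normedModType (scalar_field R k))
    (f : Y -> (scalar_field R k)^o) : continuous_dual f ->
  0 <= dual_norm f /\ forall y, rnorm (f y) <= dual_norm f * rnorm y.
Proof.
move=> [lf cf]; have [c c0 hc] := continuous_bounded lf cf.
have f0 : f 0 = 0.
  by have := lf (-1) 0 0; rewrite scaler0 add0r scaleN1r addNr.
have ub : has_ubound [set rnorm (f y) | y in [set y : Y | rnorm y <= 1]].
  exists c => _ [y /= y1 <-]; apply: le_trans (hc y) _.
  by rewrite -[leRHS]mulr1 ler_wpM2l.
have r0 (W : normedModType (scalar_field R k)) : rnorm (0 : W) = 0 by exact: (@normr0 R (realified W)).
have d0 : 0 <= dual_norm f.
  apply: ub_le_sup => //; exists 0; first by rewrite /= r0.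
  by rewrite f0 r0.
split=> // y; have [y0|yn0] := eqVneq (rnorm y) 0.
  by rewrite (rnorm0_eq0 y0) f0 !r0 mulr0.
have y0 : 0 < rnorm y by rewrite lt_def yn0 rnorm_ge0.
have : rnorm (f (emb k (rnorm y)^-1 *: y)) <= dual_norm f.
  apply: ub_le_sup => //; exists (emb k (rnorm y)^-1 *: y) => //=.
  by rewrite rnormZ ger0_norm ?invr_ge0 ?rnorm_ge0// mulVf.
rewrite linear_emb// rnormZ ger0_norm ?invr_ge0 ?rnorm_ge0//.
by rewrite mulrC ler_pdivrMr.
Qed.

Lemma real_reflexive_of_real (Y : normedModType (scalar_field R RealScalars)) :
  reflexive_space Y -> real_reflexive (realified Y).
Proof.
move=> hY Psi lP [C hC].
have bd (f : Y -> (scalar_field R RealScalars)^o) : continuous_dual f ->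
    bounded_dual (f : realified Y -> R^o).
  move=> hf; have [c c0 hc] := continuous_bounded hf.1 hf.2.
  by split; [move=> a x y _ _; exact: hf.1|exists c].
have cd (f : realified Y -> R^o) : bounded_dual f ->
    continuous_dual (f : Y -> (scalar_field R RealScalars)^o).
  move=> [lf [c c0 hc]].
  have lf' : linear (f : Y -> (scalar_field R RealScalars)^o) by move=> a x y; exact: lf.
  by split=> //; exact: (bounded_continuous lf' hc).
have [||y hy] := hY (Psi : (Y -> (scalar_field R RealScalars)^o) -> (scalar_field R RealScalars)^o).
- by move=> a f g hf hg; apply: lP; exact: bd.
- exists C => f hf; have [d0 hd] := dual_norm_bound hf.
  by apply: hC => //; exact: bd.
by exists y => f hf; apply: hy; exact: cd.
Qed.

(** A functional [Psi] on the real dual gives the functional on the complex dual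
    that maps [f] to [Psi (Re f) - i * Psi (Re (i * f))]; the point that represents
    it represents [Psi] too, as a real functional [u] is the real part of the
    complex one that maps [v] to [u v - i * u (i * v)]. *)
Lemma real_reflexive_of_complex (Y : normedModType (scalar_field R ComplexScalars)) :
  reflexive_space Y -> real_reflexive (realified Y).
Proof.
move=> hY Psi lP [C hC]; pose K := scalar_field R ComplexScalars.
pose re (f : Y -> K^o) : realified Y -> R^o := fun y => complex.Re (f y).
pose ire (f : Y -> K^o) : realified Y -> R^o := fun y => - complex.Im (f y).
have bd (f : Y -> K^o) : continuous_dual f -> bounded_dual (re f) /\ bounded_dual (ire f).
  move=> hf; have [c c0 hc] := continuous_bounded hf.1 hf.2.
  have e a : (Complex a 0 : K) = emb ComplexScalars a by [].
  split; split.
  - move=> a x y _ _; rewrite /re -[a *: x + y]/((Complex a 0 : K) *: (x : Y) + (y : Y)).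
    by rewrite hf.1 Re_linear mul0r add0r.
  - by exists c => // v; exact: le_trans (Re_norm_le _) (hc v).
  - move=> a x y _ _; rewrite /ire -[a *: x + y]/((Complex a 0 : K) *: (x : Y) + (y : Y)).
    by rewrite hf.1 Im_linear mul0r add0r opprD -mulrN.
  - by exists c => // v; rewrite normrN; exact: le_trans (Im_norm_le _) (hc v).
pose Phi (f : Y -> K^o) : K^o := (Complex (Psi (re f)) (- Psi (ire f)) : R[i]).
have [||y hy] := hY Phi.
- move=> [p q] f g hf hg; have [r1 i1] := bd f hf; have [r2 i2] := bd g hg.
  have e1 : re (fun y => (Complex p q : K) *: f y + g y) = p *: re f + (q *: ire f + re g).
    by apply/funext => v; rewrite /re Re_linear.
  have e2 : ire (fun y => (Complex p q : K) *: f y + g y) = p *: ire f + ((- q) *: re f + ire g).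
    apply/funext => v; rewrite /ire Im_linear !opprD -mulrN -mulNr.
    by [].
  have hD := bounded_dual_subspace (realified Y).
  have l1 : Psi (p *: re f + (q *: ire f + re g)) = p * Psi (re f) + (q * Psi (ire f) + Psi (re g)).
    by rewrite !lP//; exact: hD.2.
  have l2 : Psi (p *: ire f + (- q *: re f + ire g)) = p * Psi (ire f) + (- q * Psi (re f) + Psi (ire g)).
    by rewrite !lP//; exact: hD.2.
  rewrite /Phi e1 e2 l1 l2; apply/eqP; rewrite eq_complex /=.
  by apply/andP; split; apply/eqP; ring.
- exists (C + C) => f hf; have [d0 hd] := dual_norm_bound hf.
  have [r1 i1] := bd f hf.
  apply: le_trans (complex_norm_le _) _; rewrite /Phi /= normrN mulrDl.
  apply: lerD; apply: hC => // v.
    exact: le_trans (Re_norm_le _) (hd v).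
  by rewrite /ire normrN; exact: le_trans (Im_norm_le _) (hd v).
exists y => u hu.
pose f (v : Y) : K^o := (Complex (u v) (- u (imag R *: v)) : R[i]).
have hf : continuous_dual (f : Y -> K^o).
  have [lu [c c0 hc]] := hu.
  have lf : linear f.
    move=> [p q] v w.
    have l1 : u (emb ComplexScalars p *: v + emb ComplexScalars q *: (imag R *: v) + w) =
        p * u v + (q * u (imag R *: v) + u w).
      by rewrite -addrA -[emb _ p *: _ + _]/((p *: (v : realified Y)) +
        (q *: ((imag R *: v) : realified Y) + (w : realified Y))) !lu.
    have l2 : u (imag R *: (emb ComplexScalars p *: v + emb ComplexScalars q *: (imag R *: v) + w)) =
        p * u (imag R *: v) + (- q * u v + u (imag R *: w)).
      have -> : imag R *: (emb ComplexScalars p *: v + emb ComplexScalars q *: (imag R *: v) + w) =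
          emb ComplexScalars p *: (imag R *: v) + (emb ComplexScalars (- q) *: v + imag R *: w).
        rewrite !scalerDr !scalerA -addrA mulrC; congr (_ + (_ + _)).
        rewrite mulrAC mulrC -scalerA -(scalerA (imag R)) imag_imag scalerN -scaleNr.
        by rewrite /emb rmorphN.
      by rewrite -[emb _ p *: _ + _]/((p *: ((imag R *: v) : realified Y)) +
        (- q *: (v : realified Y) + ((imag R *: w) : realified Y))) !lu.
    have -> : f ((Complex p q : K) *: v + w) =
        f (emb ComplexScalars p *: v + emb ComplexScalars q *: (imag R *: v) + w).
      by rewrite (complex_scale p q v).
    rewrite {1}/f l1 l2 /f; apply/eqP; rewrite eq_complex.
    rewrite -[X in _ && (_ == X)]/(complex.Im ((Complex p q : K) *: f v + f w)).
    rewrite -[X in (_ == X) && _]/(complex.Re ((Complex p q : K) *: f v + f w)).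
    rewrite Re_linear Im_linear /f /=.
    by apply/andP; split; apply/eqP; ring.
  split=> //; apply: (bounded_continuous (c := c + c) lf) => v.
  apply: le_trans (complex_norm_le _) _; rewrite /= normrN mulrDl.
  apply: lerD; first exact: hc.
  by apply: le_trans (hc _) _; rewrite -[X in c * X]/(rnorm (imag R *: (v : Y))) rnorm_imag.
by have := hy f hf; rewrite /Phi /f => -[<- _].
Qed.
End reflexivity_transfer.

Section scalar_parts.
Context (R : realType) (k : scalar_kind).
Local Notation K := (scalar_field R k).

(** The imaginary unit, or 1 when the scalars are real: in both cases a real
    linear map is linear when it commutes with this scalar. *)
Definition unit_scalar : K :=
  match k with RealScalars => 1 | ComplexScalars => imag R end.

Definition im_part (z : K) : R :=
  match k return scalar_field R k -> R with
  | RealScalars => fun=> 0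
  | ComplexScalars => fun z => complex.Im z
  end z.

Lemma scalar_decomposition (a : K) : exists p q, a = emb k p + emb k q * unit_scalar.
Proof.
rewrite /unit_scalar; case: k a => [a|[p q]]; first by exists a, 0; rewrite /= mul0r addr0.
by exists p, q; exact: complexE.
Qed.

Lemma rnorm_unit_scalar (V : normedModType K) (v : V) : rnorm (unit_scalar *: v) = rnorm v.
Proof.
rewrite /unit_scalar; case: k V v => V v; first by rewrite scale1r.
exact: rnorm_imag.
Qed.

Lemma scalar_re_linear a (z w : K^o) :
  scalar_re (emb k a *: z + w) = a * scalar_re z + scalar_re w.
Proof.
case: k z w => //= z w.
rewrite -[(a%:C)%C]/(Complex a 0 : scalar_field R ComplexScalars) Re_linear.
by rewrite mul0r add0r.
Qed.

Lemma im_part_linear a (z w : K^o) :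
  im_part (emb k a *: z + w) = a * im_part z + im_part w.
Proof.
rewrite /im_part; case: k z w => [_ _|z w]; first by rewrite mulr0 addr0.
rewrite -[emb _ a]/(Complex a 0 : scalar_field R ComplexScalars) Im_linear.
by rewrite mul0r add0r.
Qed.

Lemma scalar_re_le (z : K^o) : `|scalar_re z| <= rnorm z.
Proof. by case: k z => [z|z]; [|exact: Re_norm_le]. Qed.

Lemma im_part_le (z : K^o) : `|im_part z| <= rnorm z.
Proof.
rewrite /im_part; case: k z => [z|z]; last exact: Im_norm_le.
by rewrite normr0 rnorm_ge0.
Qed.

Lemma rnorm_le_parts (z : K^o) : rnorm z <= `|scalar_re z| + `|im_part z|.
Proof.
rewrite /im_part; case: k z => [z|z]; last exact: complex_norm_le.
by rewrite normr0 addr0.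
Qed.

Lemma linear_of_real (X Y : normedModType K) (f : X -> Y) :
  linear_on setT (f : realified X -> realified Y) ->
  (forall x, f (unit_scalar *: x) = unit_scalar *: f x) -> linear f.
Proof.
move=> lf jf a x y; have [p [q ->]] := scalar_decomposition a.
rewrite !scalerDl -!scalerA -!addrA.
have := lf p x (emb k q *: (unit_scalar *: x) + y) Logic.I Logic.I.
rewrite -[p *: (x : realified X)]/(emb k p *: x) => ->; congr (_ + _).
have := lf q (unit_scalar *: x) y Logic.I Logic.I.
by rewrite -[q *: (_ : realified X)]/(emb k q *: (unit_scalar *: x)) => ->; rewrite jf.
Qed.

Lemma unit_scalar_isometry (V : normedModType K) :
  isometry_on_vectors (fun v : realified V => unit_scalar *: (v : V) : realified V).
Proof.
split; last by move=> v; exact: rnorm_unit_scalar.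
move=> a x y _ _; rewrite -[a *: (x : realified V)]/(emb k a *: (x : V)).
by rewrite [LHS]scalerDr [in LHS]scalerA mulrC -scalerA.
Qed.

Lemma reflexive_transfer (Y : normedModType K) :
  reflexive_space Y -> real_reflexive (realified Y).
Proof.
by case: k Y => Y; [exact: real_reflexive_of_real|exact: real_reflexive_of_complex].
Qed.

Definition bundle_linear (X Y : normedModType K) (f : X -> Y) (lf : linear f) :
  {linear X -> Y} := HB.pack f (GRing.isLinear.Build _ _ _ _ f lf).

End scalar_parts.

(** * Bochner spaces as function spaces *)

Section bochner_spaces.
Context (R : realType) d1 d2 (T1 : measurableType d1) (T2 : measurableType d2).
Variables (mu1 : {finite_measure set T1 -> \bar R}) (mu2 : {finite_measure set T2 -> \bar R}).
Variable M : set (set (T1 * T2)).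
Hypothesis sM : sigma_algebra [set: T1 * T2] M.
Variable M_sub : M `<=` @measurable _ (T1 * T2)%type.
Local Notation T := (g_sigma_algebraType M).
Local Notation mu := (restricted_product mu1 mu2 M_sub).
Local Notation rho p1 p2 := (mixed mu1 mu2 p1 p2 : (T -> R) -> \bar R).

Lemma measurable_sub_sigma (A : set T) : measurable A = M A.
Proof. by rewrite -[in RHS](measurable_g_measurableTypeE sM). Qed.

(** A null set of the product measure need not be in [M], but the set where two
    functions differ is. *)
Lemma product_ae_restricted (V : normedModType R) (f g : T -> V) : smeas f -> smeas g ->
  {ae (mu1 \x mu2)%E, forall w, f w = g w} -> {ae mu, forall w, f w = g w}.
Proof.
move=> mf mg [N [mN N0 fgN]].
pose A : set T := (fun w => `|f w - g w|) @^-1` [set~ 0].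
have mA : measurable A.
  have mh := smeas_measurable_norm (smeasB mf mg).
  rewrite -[A]setTI; apply: mh => //; apply: measurableC; exact: measurable_set1.
exists A; split=> //.
  apply/eqP; rewrite eq_le measure_ge0 andbT -N0.
  apply: (@le_measure _ _ _ (mu1 \x mu2)%E); rewrite ?inE//.
    exact: (sub_measurable M_sub mA).
  move=> w; rewrite /A /= => fg; apply: fgN => /= e; apply: fg.
  by rewrite e subrr normr0.
move=> w /= nfg h; apply: nfg; apply/eqP; rewrite -subr_eq0 -normr_eq0.
by apply/eqP.
Qed.

Section scalars.
Variable k : scalar_kind.
Local Notation K := (scalar_field R k).

Lemma Msimple_simple_map (V : normedModType K) (f : T1 * T2 -> V) :
  Msimple M f <-> @simple_map _ T V f.
Proof.
split=> -[h1 h2]; split=> // v; have := h2 v; by rewrite measurable_sub_sigma.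
Qed.

Lemma strongly_measurable_smeas (V : normedModType K) (f : T1 * T2 -> V) :
  strongly_measurable M f <-> @smeas _ T R (realified V) f.
Proof.
split=> -[f_ sf cf]; exists f_ => [n|t].
- by apply/Msimple_simple_map; exact: sf.
- by apply/realified_cvg; exact: cf.
- by apply/Msimple_simple_map; exact: sf.
- by apply/realified_cvg; exact: cf.
Qed.

Lemma mixed_normE p1 p2 (V : normedModType K) (f : T1 * T2 -> V) :
  mixed_norm mu1 mu2 p1 p2 f = rho p1 p2 (fun w => `|f w : realified V|).
Proof.
rewrite /mixed_norm LnormE; apply: eq_enorm => w1.
by rewrite LnormE gee0_abs ?enorm_ge0.
Qed.

Lemma Lmix_fspace p1 p2 (V : normedModType K) (f : T1 * T2 -> V) :
  Lmix mu1 mu2 M p1 p2 f <-> fspace (rho p1 p2) (f : T -> realified V).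
Proof.
split=> -[h1 h2]; split; first exact/strongly_measurable_smeas.
- by rewrite -mixed_normE.
- exact/strongly_measurable_smeas.
- by rewrite mixed_normE.
Qed.

Lemma mixed_norm_fnorm p1 p2 (V : normedModType K) (f : T1 * T2 -> V) :
  1 <= p1 -> 1 <= p2 -> Lmix mu1 mu2 M p1 p2 f ->
  mixed_norm mu1 mu2 p1 p2 f = (fnorm (rho p1 p2) (f : T -> realified V))%:E.
Proof.
move=> p1_ge1 p2_ge1 /Lmix_fspace hf; rewrite mixed_normE.
exact: (fspace_fnormE (mixed_function_norm mu1 mu2 M_sub p1_ge1 p2_ge1) hf).
Qed.

(** The real and imaginary parts of a functional are bounded real functionals. *)
Lemma weak_cvg_of_real q1 q2 (Y : normedModType K) (f_ : nat -> T1 * T2 -> Y) f :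
  1 <= q1 -> 1 <= q2 ->
  (forall n, Lmix mu1 mu2 M q1 q2 (f_ n)) -> Lmix mu1 mu2 M q1 q2 f ->
  (forall l, bounded_functional (rho q1 q2) (l : (T -> realified Y) -> R^o) ->
     l (f_ n) @[n --> \oo] --> l f) ->
  Lmix_weak_cvg mu1 mu2 M q1 q2 f_ f.
Proof.
move=> q1_ge1 q2_ge1 hf_ hf cf l [ll [C lC]].
have part (g : K^o -> R) : (forall a z w, g (emb k a *: z + w) = a * g z + g w) ->
    (forall z, `|g z| <= rnorm z) ->
    bounded_functional (rho q1 q2) (fun u : T -> realified Y => g (l u) : R^o).
  move=> gl gb; split=> [a u v /Lmix_fspace hu /Lmix_fspace hv|].
    by rewrite -gl -ll.
  exists `|C| => // u /Lmix_fspace hu; apply: le_trans (gb _) _.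
  have := lC u hu; rewrite mixed_norm_fnorm// -EFinM lee_fin => h; apply: le_trans h _.
  apply: ler_wpM2r (ler_norm C).
  exact: (fnorm_ge0 (mixed_function_norm mu1 mu2 M_sub q1_ge1 q2_ge1)).
have c1 := cf _ (part _ (@scalar_re_linear R k) (@scalar_re_le R k)).
have c2 := cf _ (part _ (@im_part_linear R k) (@im_part_le R k)).
apply/cvgrPdist_lt => _ /scalar_pos[e e0 ->].
have e2 : 0 < e / 2 by rewrite divr_gt0.
have gB (g : K^o -> R) : (forall a z w, g (emb k a *: z + w) = a * g z + g w) ->
    forall z w, g (z - w) = g z - g w.
  move=> gl z w; have := gl (-1) w z.
  have -> : emb k (-1) = -1 :> K.
    by apply/eqP; rewrite -addr_eq0 -(emb1 R k) -embD addNr emb0.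
  by rewrite scaleN1r addrC => ->; rewrite mulN1r addrC.
move/cvgrPdist_lt/(_ _ e2) : c1 => c1; move/cvgrPdist_lt/(_ _ e2) : c2 => c2.
apply: filterS2 c1 c2 => n; rewrite -!gB; [|exact: im_part_linear|exact: scalar_re_linear].
move=> h1 h2; rewrite (@rnorm_lt _ _ K^o); apply: le_lt_trans (rnorm_le_parts _) _.
by rewrite (splitr e); exact: ltrD.
Qed.

End scalars.

(** Taking real parts does not increase the distance to a real function. *)
Lemma separable_real_Lmix p1 p2 : 1 <= p1 -> 1 <= p2 ->
  separable_Lmix mu1 mu2 M (scalar_field R ComplexScalars)^o p1 p2 ->
  exists phi : nat -> T -> R^o, (forall i, fspace (rho p1 p2) (phi i)) /\
    forall f : T -> R^o, fspace (rho p1 p2) f -> forall e : R, 0 < e ->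
      exists i, fnorm (rho p1 p2) (fun t => f t - phi i t) < e.
Proof.
move=> p1_ge1 p2_ge1 [D [cD DL dD]].
have hP := mixed_function_norm mu1 mu2 M_sub p1_ge1 p2_ge1.
pose cplx (f : T -> R^o) : T -> realified (scalar_field R ComplexScalars)^o :=
  fun t => emb ComplexScalars (f t).
have ec (x : R) : `|emb ComplexScalars x : realified (scalar_field R ComplexScalars)^o| = `|x|.
  by apply: (@emb_inj R ComplexScalars); rewrite -emb_norm; exact: rnormE.
have hc f : fspace (rho p1 p2) f -> fspace (rho p1 p2) (cplx f).
  move=> hf; apply: (fspace_le hP _ hf _).1 => [|t]; last by rewrite /cplx ec.
  apply: smeas_comp hf.1; apply: short_map_continuous => x z.
  by rewrite -[X in `|X|]embB ec.
have D0 : D !=set0.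
  have h0 := (Lmix_fspace _ _ _).2 (hc _ (fspace0 hP R^o)).
  by have [g Dg _] := dD _ h0 1 ltr01; exists g.
have [y [yD Dy]] := countable_enum cD D0.
have hy i : fspace (rho p1 p2) (y i : T -> realified (scalar_field R ComplexScalars)^o).
  by apply/Lmix_fspace; exact: DL.
pose phi i : T -> R^o := fun t => complex.Re (y i t).
have hphi i : fspace (rho p1 p2) (phi i).
  apply: (fspace_le hP _ (hy i) _).1 => [|t]; last exact: Re_norm_le.
  apply: (smeas_comp _ (hy i).1); apply: short_map_continuous => z w.
  by rewrite -ReB; exact: Re_norm_le.
exists phi; split=> // f hf e e0.
have [g Dg hg] := dD (cplx f) ((Lmix_fspace _ _ _).2 (hc f hf)) e e0.
have [i _ yi] := Dy g Dg; exists i; rewrite -lte_fin; apply: le_lt_trans hg.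
have hd := (fspaceB hP (hc f hf) (hy i)).1.
rewrite -yi mixed_normE [leRHS](fspace_fnormE hP hd) lee_fin.
apply: (fspace_le hP (fspaceB hP hf (hphi i)).1.1 hd _).2 => t.
rewrite -[f t - phi i t]/(complex.Re (emb ComplexScalars (f t)) - complex.Re (y i t)) -ReB.
exact: Re_norm_le.
Qed.

End bochner_spaces.

(** * Pointwise defined operators *)

Section product_ae_filter.
Context (R : realType) d1 d2 (T1 : measurableType d1) (T2 : measurableType d2).
Variables (mu1 : {finite_measure set T1 -> \bar R}) (mu2 : {finite_measure set T2 -> \bar R}).

Lemma product_aeS2 (P Q S : T1 * T2 -> Prop) : (forall w, P w -> Q w -> S w) ->
  {ae (mu1 \x mu2)%E, forall w, P w} -> {ae (mu1 \x mu2)%E, forall w, Q w} ->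
  {ae (mu1 \x mu2)%E, forall w, S w}.
Proof.
move=> PQS; apply: (@filterS2 _ _ (ae_filter_ringOfSetsType
  ((mu1 \x mu2)%E : {measure set (T1 * T2) -> \bar R}))) => w; exact: PQS.
Qed.

End product_ae_filter.

Section pointwise_operators.
Context (R : realType) (k : scalar_kind) d1 d2 (T1 : measurableType d1) (T2 : measurableType d2).
Variables (mu1 : {finite_measure set T1 -> \bar R}) (mu2 : {finite_measure set T2 -> \bar R}).
Variable M : set (set (T1 * T2)).
Hypothesis sM : sigma_algebra [set: T1 * T2] M.
Variable M_sub : M `<=` @measurable _ (T1 * T2)%type.
Local Notation T := (g_sigma_algebraType M).
Local Notation mu := (restricted_product mu1 mu2 M_sub).
Local Notation rho p1 p2 := (mixed mu1 mu2 p1 p2 : (T -> R) -> \bar R).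
Local Notation K := (scalar_field R k).
Variables (X Y : normedModType K) (p1 p2 q1 q2 : R).
Hypotheses (p1_ge1 : 1 <= p1) (p2_ge1 : 1 <= p2) (q1_ge1 : 1 <= q1) (q2_ge1 : 1 <= q2).
Let hP := mixed_function_norm mu1 mu2 M_sub p1_ge1 p2_ge1.
Let hQ := mixed_function_norm mu1 mu2 M_sub q1_ge1 q2_ge1.
Local Notation JX := (fun x : realified X => unit_scalar R k *: (x : X) : realified X).
Local Notation JY := (fun y : realified Y => unit_scalar R k *: (y : Y) : realified Y).
Implicit Types G : (T1 * T2 -> X) -> T1 * T2 -> Y.

(** Locality and commutation with the scalar are linearity of the operators
    [L w].  The bound on the unit ball extends by homogeneity to functions of
    positive norm; those of norm 0 are covered by the boundedness of [G]. *)
Lemma pointwise_local G (C : R) : Lpd mu1 mu2 M p1 p2 q1 q2 G ->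
  (forall u, Lmix mu1 mu2 M p1 p2 u -> (mixed_norm mu1 mu2 p1 p2 u <= 1)%E ->
     (mixed_norm mu1 mu2 q1 q2 (G u) <= C%:E)%E) ->
  local_operator mu (rho p1 p2) (rho q1 q2) C
    (G : (T -> realified X) -> T -> realified Y) /\
  intertwining mu (rho p1 p2) JX JY (G : (T -> realified X) -> T -> realified Y).
Proof.
move=> [[G_in G_lin [c G_b]] [L cL GL]] GC.
have Gin (u : T -> realified X) : fspace (rho p1 p2) u ->
    fspace (rho q1 q2) (G u : T -> realified Y).
  by move=> /(Lmix_fspace _ _ sM)/G_in/(Lmix_fspace _ _ sM).
have lo_lin' a (u v : T -> realified X) : fspace (rho p1 p2) u -> fspace (rho p1 p2) v ->
    {ae mu, forall t, G (fun t => a *: u t + v t) t = (a *: (G u t : realified Y) + G v t : realified Y)}.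
  move=> hu hv.
  have huv := (fspace_subspace hP (realified X)).2 a u v hu hv.
  have hGuv := (fspace_subspace hQ (realified Y)).2 a _ _ (Gin u hu) (Gin v hv).
  apply: (product_ae_restricted M_sub (Gin _ huv).1 hGuv.1).
  exact: (G_lin (emb k a) u v ((Lmix_fspace _ _ sM _ _ _).2 hu) ((Lmix_fspace _ _ sM _ _ _).2 hv)).
split; last first.
  move=> u hu.
  have hJu := (fspace_isometry hP (unit_scalar_isometry X) hu).1.
  have hJG := (fspace_isometry hQ (unit_scalar_isometry Y) (Gin u hu)).1.
  apply: (product_ae_restricted M_sub (Gin _ hJu).1 hJG.1).
  have h1 := GL _ ((Lmix_fspace _ _ sM _ _ _).2 hJu).
  have h2 := GL _ ((Lmix_fspace _ _ sM _ _ _).2 hu).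
  by apply: product_aeS2 h1 h2 => w -> ->; rewrite linearZ.
split=> //.
- move=> u hu; have hu' := (Lmix_fspace _ _ sM _ _ _).2 hu.
  have N0 := fnorm_ge0 hP u.
  have [Nu0|Nun0] := eqVneq (fnorm (rho p1 p2) u) 0.
    rewrite Nu0 mulr0; have := G_b u hu'.
    rewrite (mixed_norm_fnorm sM M_sub p1_ge1 p2_ge1 hu') Nu0 mule0.
    by rewrite (mixed_norm_fnorm sM M_sub q1_ge1 q2_ge1 (G_in u hu')) lee_fin.
  set N := fnorm _ u in N0 Nun0 *.
  have Np : 0 < N by rewrite lt_def Nun0.
  have [hv Nv] := fspaceZ hP N^-1 hu; rewrite -/N in Nv.
  have Ni : `|N^-1| = N^-1 by rewrite ger0_norm// invr_ge0.
  rewrite Ni mulVf// in Nv.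
  have hv' := (Lmix_fspace _ _ sM _ _ _).2 hv.
  have := GC _ hv'; rewrite (mixed_norm_fnorm sM M_sub p1_ge1 p2_ge1 hv') Nv.
  rewrite (mixed_norm_fnorm sM M_sub q1_ge1 q2_ge1 (G_in _ hv')) => /(_ (lexx _)) h.
  have [hw Nw] := fspaceZ hQ N^-1 (Gin u hu).
  have e : {ae mu, forall t, N^-1 *: (G u t : realified Y) = G (fun t => N^-1 *: u t) t}.
    apply: (product_ae_restricted M_sub hw.1 (Gin _ hv).1).
    apply: product_aeS2 (GL _ hv') (GL _ hu') => w -> ->.
    by rewrite -[N^-1 *: u w]/(emb k N^-1 *: (u w : X)) linearZ.
  have [_ e2 _] := ae_fspace hQ hw (Gin _ hv).1 e.
  by move: h; rewrite lee_fin e2 Nw Ni mulrC ler_pdivrMr.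
- move=> A u mA hu.
  have hA := (fspace_cutoff hP mA hu).1.
  have hGA := (fspace_cutoff hQ mA (Gin u hu)).1.
  apply: (product_ae_restricted M_sub (Gin _ hA).1 hGA.1).
  have h1 := GL _ ((Lmix_fspace _ _ sM _ _ _).2 hA).
  have h2 := GL _ ((Lmix_fspace _ _ sM _ _ _).2 hu).
  apply: product_aeS2 h1 h2 => w -> e; rewrite /cutoff e.
  by rewrite -[\1_A w *: u w]/(emb k (\1_A w) *: (u w : X)) linearZ.
Qed.

Lemma fspace_scalar r1 r2 (V : normedModType K) (a : K) (u v : T -> realified V) :
  1 <= r1 -> 1 <= r2 -> fspace (rho r1 r2) u -> fspace (rho r1 r2) v ->
  fspace (rho r1 r2) (fun t => (a *: (u t : V) + v t : V) : realified V).
Proof.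
move=> r1_ge1 r2_ge1 hu hv; have h := mixed_function_norm mu1 mu2 M_sub r1_ge1 r2_ge1.
have [p [q ->]] := scalar_decomposition a.
have hJ := (fspace_isometry h (unit_scalar_isometry V) hu).1.
have hS := fspace_subspace h (realified V).
have := hS.2 p _ _ hu (hS.2 q _ _ hJ hv).
congr fspace; apply/funext => t; rewrite scalerDl -scalerA -addrA.
by [].
Qed.

Lemma local_pointwise G (C : R) (L : T -> realified X -> realified Y) : 0 <= C ->
  local_operator mu (rho p1 p2) (rho q1 q2) C
    (G : (T -> realified X) -> T -> realified Y) ->
  (forall t, linear_on setT (L t)) ->
  (forall t, exists2 c, 0 <= c & forall x, `|L t x| <= c * `|x|) ->
  (forall t x, L t (unit_scalar R k *: (x : X)) = unit_scalar R k *: (L t x : Y)) ->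
  (forall u : T -> realified X, fspace (rho p1 p2) u ->
     {ae mu, forall t, (G u t : realified Y) = L t (u t)}) ->
  Lpd mu1 mu2 M p1 p2 q1 q2 G /\
  (Lmix_opnorm mu1 mu2 M p1 p2 q1 q2 G <= C%:E)%E.
Proof.
move=> C0 hG lL bL jL GL.
have lK t : linear (L t : X -> Y) by apply: linear_of_real; [exact: lL|exact: jL].
have G_in u : Lmix mu1 mu2 M p1 p2 u -> Lmix mu1 mu2 M q1 q2 (G u).
  by move=> /(Lmix_fspace _ _ sM)/(lo_in hG)/(Lmix_fspace _ _ sM).
have G_b u : Lmix mu1 mu2 M p1 p2 u ->
    (mixed_norm mu1 mu2 q1 q2 (G u) <= C%:E * mixed_norm mu1 mu2 p1 p2 u)%E.
  move=> hu; rewrite (mixed_norm_fnorm sM M_sub p1_ge1 p2_ge1 hu).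
  rewrite (mixed_norm_fnorm sM M_sub q1_ge1 q2_ge1 (G_in u hu)) -EFinM lee_fin.
  by apply: (lo_bound hG); exact/(Lmix_fspace _ _ sM).
split; last first.
  apply: ge_ereal_sup => _ [u [/= hu u1] <-]; apply: le_trans (G_b u hu) _.
  by rewrite -[leRHS]mule1; apply: lee_wpmul2l.
split.
  split=> //; last by exists C.
  move=> a u v /(Lmix_fspace _ _ sM) hu /(Lmix_fspace _ _ sM) hv.
  have huv := fspace_scalar a p1_ge1 p2_ge1 hu hv.
  have h := product_aeS2 (fun w => @conj _ _) (restricted_ae (GL _ hu)) (restricted_ae (GL _ hv)).
  by apply: product_aeS2 (restricted_ae (GL _ huv)) h => w -> [-> ->]; exact: lK.
exists (fun w => bundle_linear (lK w)) => [w|u hu].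
  have [c c0 hc] := bL w.
  exact: (bounded_continuous (lK w) hc).
by apply: (restricted_ae (GL u _)); exact/(Lmix_fspace _ _ sM).
Qed.

Lemma Lmix0 r1 r2 (V : normedModType K) : 1 <= r1 -> 1 <= r2 ->
  Lmix mu1 mu2 M r1 r2 (fun=> 0 : V) /\ mixed_norm mu1 mu2 r1 r2 (fun=> 0 : V) = 0%E.
Proof.
move=> r1_ge1 r2_ge1; have h := mixed_function_norm mu1 mu2 M_sub r1_ge1 r2_ge1.
have h0 := (Lmix_fspace _ _ sM _ _ _).2 (fspace0 h (realified V)); split=> //.
rewrite (mixed_norm_fnorm sM M_sub r1_ge1 r2_ge1 h0).
by rewrite (seminorm0 (fspace_subspace h (realified V)) (fnorm_seminorm h (realified V))).
Qed.

End pointwise_operators.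

Theorem theorem5p4 (R : realType) (k : scalar_kind)
  (d1 d2 : measure_display)
  (T1 : measurableType d1) (T2 : measurableType d2)
  (mu1 : {finite_measure set T1 -> \bar R})
  (mu2 : {finite_measure set T2 -> \bar R})
  (M : set (set (T1 * T2)))
  (M_sigma_algebra : sigma_algebra [set: T1 * T2] M)
  (M_sub : M `<=` @measurable _ (T1 * T2)%type)
  (X Y : completeNormedModType (scalar_field R k))
  (X_separable : separable_space X) (Y_reflexive : reflexive_space Y)
  (p1 p2 q1 q2 : R)
  (p1_ge1 : 1 <= p1) (p2_ge1 : 1 <= p2) (q1_gt1 : 1 < q1) (q2_gt1 : 1 < q2)
  (L_separable :
    separable_Lmix mu1 mu2 M (scalar_field R ComplexScalars)^o p1 p2)
  (G_ : nat -> (T1 * T2 -> X) -> (T1 * T2 -> Y))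
  (G_pd : forall n, Lpd mu1 mu2 M p1 p2 q1 q2 (G_ n))
  (G_bounded : (ereal_sup
    [set Lmix_opnorm mu1 mu2 M p1 p2 q1 q2 (G_ n) | n in [set: nat]] < +oo)%E) :
  exists (nk : nat -> nat) (G : (T1 * T2 -> X) -> (T1 * T2 -> Y)),
    [/\ {homo nk : i j / (i < j)%N},
        Lpd mu1 mu2 M p1 p2 q1 q2 G,
        forall u, Lmix mu1 mu2 M p1 p2 u ->
          Lmix_weak_cvg mu1 mu2 M q1 q2 (fun i => G_ (nk i) u) (G u) &
        (Lmix_opnorm mu1 mu2 M p1 p2 q1 q2 G <=
         ereal_sup [set Lmix_opnorm mu1 mu2 M p1 p2 q1 q2 (G_ n)
                   | n in [set: nat]])%E].

Proof.
set S := ereal_sup _ in G_bounded *.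
have [q1_ge1 q2_ge1] := (ltW q1_gt1, ltW q2_gt1).
have hP := mixed_function_norm mu1 mu2 M_sub p1_ge1 p2_ge1.
have hQ := mixed_function_norm mu1 mu2 M_sub q1_ge1 q2_ge1.
have smQ := mixed_disjointly_smooth mu1 mu2 M_sub q1_gt1 q2_gt1.
have opS n : (Lmix_opnorm mu1 mu2 M p1 p2 q1 q2 (G_ n) <= S)%E.
  by apply: ereal_sup_ubound; exists n.
have GS n u : Lmix mu1 mu2 M p1 p2 u -> (mixed_norm mu1 mu2 p1 p2 u <= 1)%E ->
    (mixed_norm mu1 mu2 q1 q2 (G_ n u) <= S)%E.
  move=> hu u1; apply: le_trans (opS n).
  by apply: ereal_sup_ubound; exists u.
have [L0 N0] := Lmix0 mu1 mu2 M_sigma_algebra M_sub X p1_ge1 p2_ge1.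
have S0 : (0 <= S)%E.
  apply: le_trans (GS 0%N _ L0 _); last by rewrite N0.
  exact: Lnorm_ge0.
have SE : S = (fine S)%:E by rewrite fineK// ge0_fin_numE.
have C0 : 0 <= fine S by rewrite fine_ge0.
have hloc n := pointwise_local M_sigma_algebra M_sub p1_ge1 p2_ge1 q1_ge1 q2_ge1 (G_pd n)
  (C := fine S) (fun u hu u1 => eq_ind _ (fun s => (_ <= s)%E) (GS n u hu u1) _ SE).
have [phi [phi_in phi_d]] := separable_real_Lmix M_sigma_algebra M_sub p1_ge1 p2_ge1 L_separable.
have [A_ [mA_ A_d]] := measure_algebra_separable hP phi_in phi_d.
have [xs [xs_d xs0]] := realified_separable X_separable.
have [D [D_in D_d]] := fspace_separable hP phi_in phi_d xs_d xs0.
have Yr := reflexive_transfer Y_reflexive.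
have [t st [G [hG Gw]]] := local_operator_compactness hP hQ (fun n => (hloc n).1) smQ Yr
  mA_ A_d D_in D_d.
have iG := intertwining_limit hP hQ (unit_scalar_isometry X) (unit_scalar_isometry Y)
  (fun n => (hloc (t n)).1) hG Gw (fun n => (hloc (t n)).2).
have [L [lL bL GL]] := local_operator_pointwise hP hQ hG (realified_complete (V := Y)) xs_d xs0.
have [L' [lL' bL' jL' GL']] := pointwise_intertwining hP (unit_scalar_isometry X)
  (unit_scalar_isometry Y) iG lL bL GL xs_d.
have [pdG opG] := local_pointwise M_sigma_algebra p1_ge1 p2_ge1 q1_ge1 q2_ge1 C0 hG lL' bL' jL' GL'.
exists t, G; split=> //; last by rewrite SE.
move=> u hu; have hu' := (Lmix_fspace mu1 mu2 M_sigma_algebra p1 p2 u).1 hu.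
apply: (weak_cvg_of_real M_sigma_algebra M_sub q1_ge1 q2_ge1).
- by move=> n; have [[h _ _] _] := G_pd (t n); exact: h.
- by have [[h _ _] _] := pdG; exact: h.
by move=> l hl; exact: Gw.
Qed.
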